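(* Let $D\subset\mathbb C^n$ be a complete hyperbolic bounded domain such that $(D,k_D)$ is Gromov hyperbolic. Then $D$ has the visibility property if and only if the identity map of $D$ extends as a continuous surjective map $\Phi:\overline D^G\to\overline D$. Moreover, $\Phi$ is a homeomorphism if and only if $D$ has no geodesic loops in $\overline D$.
   Context: For a domain $D\subset\mathbb C^n$, $k_D$ denotes the Kobayashi (pseudo)distance (the integrated form of the Kobayashi–Royden metric). $D$ is complete hyperbolic if $k_D$ is a complete distance. A geodesic is a curve $\sigma:I\to D$ on an interval $I\subset\mathbb R$ with $k_D(\sigma(s),\sigma(t))=|s-t|$ for all $s,t\in I$; it is a geodesic ray if $I=[0,\infty)$ and a geodesic line if $I=(-\infty,+\infty)$. $\overline D$ is the Euclidean closure of $D$. Visibility: for $D$ complete hyperbolic and $p\neq q$ in $\partial D$ (Euclidean boundary), the pair $\{p,q\}$ has visible geodesics if there are neighborhoods $U,V$ of $p,q$ respectively with $\overline U\cap\overline V=\emptyset$ and a compact set $K\subset D$ such that every geodesic $\gamma:[0,L]\to D$ with $\gamma(0)\in U$, $\gamma(L)\in V$ satisfies $\gamma([0,L])\cap K\ne\emptyset$. $D$ has the visibility property if every pair of distinct boundary points has visible geodesics. Gromov compactification (for $D$ complete hyperbolic with $(D,k_D)$ Gromov hyperbolic): fix $z_0\in D$ and let $\Gamma_{z_0}$ be the set of geodesic rays $\gamma$ with $\gamma(0)=z_0$. Rays $\gamma,\eta\in\Gamma_{z_0}$ are equivalent if $\sup_{t\ge0}k_D(\gamma(t),\eta(t))<+\infty$.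 The Gromov boundary $\partial_GD$ is the set of equivalence classes and $\overline D^G=D\cup\partial_GD$, with its usual topology, which makes it a first countable Hausdorff compactification of $D$. In this topology: a sequence $\{\sigma_k\}\subset\partial_GD$ converges to $\sigma\in\partial_GD$ if for all representatives $\gamma_k\in\sigma_k$, every subsequence of $\{\gamma_k\}$ has a subsequence converging uniformly on compacta to a geodesic ray $\gamma\in\sigma$; a sequence $\{z_k\}\subset D$ converges to $\sigma\in\partial_GD$ if for all geodesics $\gamma_k:[0,R_k]\to D$ with $\gamma_k(0)=z_0$, $\gamma_k(R_k)=z_k$, every subsequence of $\{\gamma_k\}$ has a subsequence converging uniformly on compacta to a geodesic ray $\gamma\in\sigma$. Geodesic loops: for a compactification $X$ of $D$, a geodesic line $\gamma$ is a geodesic loop in $X$ if $\gamma$ has the same cluster set in $X$ at $+\infty$ and at $-\infty$. $D$ has no geodesic loops in $X$ if no geodesic line of $D$ is a geodesic loop in $X$. *)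

(* Defs.v *)
From HB Require Import structures.
From mathcomp Require Import all_boot all_order all_algebra complex.
From mathcomp Require Import all_classical all_reals all_analysis.
Import Order.TTheory GRing.Theory Num.Theory numFieldNormedType.Exports.

Set Implicit Arguments.
Unset Strict Implicit.
Unset Printing Implicit Defensive.

Local Open Scope classical_set_scope.
Local Open Scope ring_scope.

(* R[i] seen as a numFieldType, so that MathComp-Analysis' canonical topology
   and normed-module structure on numFieldTypes apply to it. *)
Definition CC (R : realType) : numFieldType := R[i].

(* C^n; its norm is the sup norm, with values in R[i]. *)
Notation Cn R n := 'rV[CC R]_n.

Definition cre (R : realType) (z : CC R) : R := complex.Re z.
Definition cim (R : realType) (z : CC R) : R := complex.Im z.
Definition cabs (R : realType) (z : CC R) : R := cre `|z|.

Definition is_domain (R : realType) (n : nat) (D : set (Cn R n)) : Prop :=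
  [/\ open D, connected D & D !=set0].

(** Kobayashi-Royden metric and Kobayashi distance *)

Definition unit_disc (R : realType) : set (CC R) := [set zeta | `|zeta| < 1].

(* [derivable _ zeta 1] over the field R[i] is complex differentiability. *)
Definition holo_disc (R : realType) (n : nat) (D : set (Cn R n))
    (f : CC R -> Cn R n) : Prop :=
  forall zeta : CC R, unit_disc zeta -> derivable f zeta 1 /\ D (f zeta).

Definition kobayashi_royden (R : realType) (n : nat) (D : set (Cn R n))
    (z v : Cn R n) : \bar R :=
  ereal_inf [set (cabs alpha)%:E | alpha in
    [set alpha : CC R | exists f : CC R -> Cn R n,
      [/\ holo_disc D f, f 0 = z & alpha *: derive1 f 0 = v]]].

(* C^n is not a normed module over R, so the derivative of a curve of a real
   variable is taken on the real and imaginary parts of its coordinates. *)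
Definition curve_deriv (R : realType) (n : nat) (g : R -> Cn R n) (t : R) :
    Cn R n :=
  \row_(j < n) (Complex (derive1 (fun u => cre (g u 0 j)) t)
                        (derive1 (fun u => cim (g u 0 j)) t) : CC R).

Definition C1_fun (R : realType) (h : R -> R) : Prop :=
  (forall t, derivable h t 1) /\ continuous (derive1 h).

(* C^1 on the closed interval [a, b], i.e. with one-sided derivatives at the
   end points, expressed as restriction of a C^1 curve defined on R. *)
Definition C1_on (R : realType) (n : nat) (a b : R) (g : R -> Cn R n) : Prop :=
  exists h : R -> Cn R n,
    (forall j : 'I_n, C1_fun (fun u => cre (h u 0 j)) /\
                      C1_fun (fun u => cim (h u 0 j))) /\
    (forall t, t \in `[a, b] -> g t = h t).

(* The breakpoints of the subdivision of [0, 1] are 0 :: s. *)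
Definition piecewise_C1 (R : realType) (n : nat) (g : R -> Cn R n) : Prop :=
  exists s : seq R,
    [/\ path <%R 0 s, last 0 s = 1 &
        forall i, (i < size s)%N ->
          C1_on (nth 0 (0 :: s) i) (nth 0 (0 :: s) i.+1) g].

Definition kobayashi_length (R : realType) (n : nat) (D : set (Cn R n))
    (g : R -> Cn R n) : \bar R :=
  (\int[lebesgue_measure]_(t in `[0%R, 1%R]%classic)
     kobayashi_royden D (g t) (curve_deriv g t))%E.

Definition kobayashi (R : realType) (n : nat) (D : set (Cn R n))
    (z w : Cn R n) : \bar R :=
  ereal_inf [set kobayashi_length D g | g in
    [set g : R -> Cn R n |
      [/\ piecewise_C1 g, forall t, t \in `[0, 1] -> D (g t),
          g 0 = z & g 1 = w]]].

Definition complete_hyperbolic (R : realType) (n : nat) (D : set (Cn R n)) :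
    Prop :=
  (forall z w, D z -> D w -> kobayashi D z w = 0%E -> z = w) /\
  (forall u : nat -> Cn R n, (forall k, D (u k)) ->
    (forall e : R, 0 < e -> exists N : nat, forall k m, (N <= k)%N ->
      (N <= m)%N -> (kobayashi D (u k) (u m) < e%:E)%E) ->
    exists2 z, D z & kobayashi D (u k) z @[k --> \oo] --> 0%E).

(** Gromov hyperbolicity, via the four-point condition on Gromov products *)

Definition gromov_product (R : realType) (n : nat) (D : set (Cn R n))
    (o x y : Cn R n) : R :=
  (fine (kobayashi D x o) + fine (kobayashi D y o)
   - fine (kobayashi D x y)) / 2.

Definition gromov_hyperbolic (R : realType) (n : nat) (D : set (Cn R n)) :
    Prop :=
  exists delta : R, 0 <= delta /\
    forall o x y z, D o -> D x -> D y -> D z ->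
      Num.min (gromov_product D o x y) (gromov_product D o y z) - delta
        <= gromov_product D o x z.

(** Geodesics; a curve on an interval I is a total function on R of which only
    the values on I matter. *)

Definition geodesic (R : realType) (n : nat) (D : set (Cn R n)) (I : set R)
    (g : R -> Cn R n) : Prop :=
  (forall t, I t -> D (g t)) /\
  (forall s t, I s -> I t -> kobayashi D (g s) (g t) = (`|s - t|)%:E).

Definition geodesic_ray (R : realType) (n : nat) (D : set (Cn R n)) :=
  geodesic D `[0%R, +oo[%classic.

Definition geodesic_line (R : realType) (n : nat) (D : set (Cn R n)) :=
  geodesic D [set: R].

(** Visibility *)

Definition bdry (R : realType) (n : nat) (D : set (Cn R n)) : set (Cn R n) :=
  closure D `\` D^°.

Definition visible_geodesics (R : realType) (n : nat) (D : set (Cn R n))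
    (p q : Cn R n) : Prop :=
  exists U V K : set (Cn R n),
    [/\ nbhs p U, nbhs q V, closure U `&` closure V = set0,
        compact K /\ K `<=` D &
        forall (L : R) (g : R -> Cn R n), 0 <= L ->
          geodesic D `[0%R, L]%classic g -> U (g 0) -> V (g L) ->
          (g @` `[0%R, L]%classic) `&` K !=set0].

Definition visibility (R : realType) (n : nat) (D : set (Cn R n)) : Prop :=
  forall p q, bdry D p -> bdry D q -> p <> q -> visible_geodesics D p q.

(** Gromov compactification *)

Definition rays_from (R : realType) (n : nat) (D : set (Cn R n))
    (z0 : Cn R n) : set (R -> Cn R n) :=
  [set g | geodesic_ray D g /\ g 0 = z0].

Definition ray_equiv (R : realType) (n : nat) (D : set (Cn R n))
    (g h : R -> Cn R n) : Prop :=
  (ereal_sup [set kobayashi D (g t) (h t) | t in `[0%R, +oo[%classic]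
   < +oo)%E.

(* The equivalence classes of rays. *)
Definition gromov_boundary (R : realType) (n : nat) (D : set (Cn R n))
    (z0 : Cn R n) : set (set (R -> Cn R n)) :=
  [set c | exists2 g, rays_from D z0 g &
                      c = [set h | rays_from D z0 h /\ ray_equiv D g h]].

Inductive gromov_closure (R : realType) (n : nat) (D : set (Cn R n))
    (z0 : Cn R n) : Type :=
| gint of D
| gbd of gromov_boundary D z0.
Arguments gint {R n D} z0 _.
Arguments gbd {R n D z0} _.

(* Uniform convergence on compacta to the ray g of geodesics c k defined on
   [0, l k] (on [0, +oo[ if l k = +oo); in particular l k tends to +oo. *)
Definition cvg_compacta (R : realType) (n : nat) (D : set (Cn R n))
    (l : nat -> \bar R) (c : nat -> R -> Cn R n) (g : R -> Cn R n) : Prop :=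
  forall T e : R, 0 < e -> \forall k \near \oo,
    (T%:E <= l k)%E /\
    (forall t, 0 <= t <= T -> (kobayashi D (c k t) (g t) < e%:E)%E).

(* Every subsequence has a subsequence converging to a ray in sigma. *)
Definition subseq_cvg (R : realType) (n : nat) (D : set (Cn R n))
    (l : nat -> \bar R) (c : nat -> R -> Cn R n) (sigma : set (R -> Cn R n)) :
    Prop :=
  forall phi : nat -> nat, {homo phi : i j / (i < j)%N} ->
  exists psi : nat -> nat, {homo psi : i j / (i < j)%N} /\
  exists2 g, sigma g & cvg_compacta D (l \o phi \o psi) (c \o phi \o psi) g.

Definition bd_cvg (R : realType) (n : nat) (D : set (Cn R n)) (z0 : Cn R n)
    (s : nat -> gromov_boundary D z0) (sigma : gromov_boundary D z0) : Prop :=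
  forall c : nat -> R -> Cn R n, (forall k, \val (s k) (c k)) ->
    subseq_cvg D (fun=> +oo%E) c (\val sigma).

Definition int_cvg (R : realType) (n : nat) (D : set (Cn R n)) (z0 : Cn R n)
    (z : nat -> D) (sigma : gromov_boundary D z0) : Prop :=
  forall (r : nat -> R) (c : nat -> R -> Cn R n),
    (forall k, [/\ 0 <= r k, geodesic D `[0%R, r k]%classic (c k),
                   c k 0 = z0 & c k (r k) = \val (z k)]) ->
    subseq_cvg D (fun k => (r k)%:E) c (\val sigma).

(* The topology of which the closed sets are those that are relatively closed
   in D and stable under [bd_cvg] and [int_cvg].  A sequence of boundary points
   never converges to a point of D, and a sequence with infinitely many terms
   of both kinds need not be tested. *)
Definition gromov_open (R : realType) (n : nat) (D : set (Cn R n))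
    (z0 : Cn R n) (U : set (gromov_closure D z0)) : Prop :=
  [/\ open (gint z0 @^-1` U),
      forall (z : nat -> D) sigma, int_cvg z sigma -> U (gbd sigma) ->
        \forall k \near \oo, U (gint z0 (z k)) &
      forall (s : nat -> gromov_boundary D z0) sigma, bd_cvg s sigma ->
        U (gbd sigma) -> \forall k \near \oo, U (gbd (s k))].

Section gromov_topology.
Context (R : realType) (n : nat) (D : set (Cn R n)) (z0 : Cn R n).
Local Notation T := (gromov_closure D z0).

Lemma gromov_openT : gromov_open [set: T].
Proof.
by split=> [|z s _ _|u s _ _]; [exact: openT|exact: nearW|exact: nearW].
Qed.

Lemma gromov_openI : setI_closed (@gromov_open R n D z0).
Proof.
move=> A B [oA iA bA] [oB iB bB]; split.
- by rewrite preimage_setI; exact: openI.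
- move=> z s zs [As Bs].
  by near=> k; split; near: k; [exact: iA As|exact: iB Bs].
- move=> u s us [As Bs].
  by near=> k; split; near: k; [exact: bA As|exact: bB Bs].
Unshelve. all: by end_near. Qed.

Lemma gromov_open_bigU (I : Type) (f : I -> set T) :
  (forall i, gromov_open (f i)) -> gromov_open (\bigcup_i f i).
Proof.
move=> of_; split.
- rewrite preimage_bigcup; apply: bigcup_open => i _.
  by have [] := of_ i.
- move=> z s zs [i _ fis]; have [_ iF _] := of_ i.
  by apply: filterS (iF _ _ zs fis) => k ?; exists i.
- move=> u s us [i _ fis]; have [_ _ bF] := of_ i.
  by apply: filterS (bF _ _ us fis) => k ?; exists i.
Qed.

HB.instance Definition _ := gen_eqMixin T.
HB.instance Definition _ := gen_choiceMixin T.
HB.instance Definition _ := isOpenTopological.Build T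
  gromov_openT gromov_openI gromov_open_bigU.

End gromov_topology.

Definition homeomorphism (X Y : topologicalType) (f : X -> Y) : Prop :=
  continuous f /\
  exists g : Y -> X, [/\ continuous g, cancel f g & cancel g f].

Definition extends_identity (R : realType) (n : nat) (D : set (Cn R n))
    (z0 : Cn R n) (Phi : gromov_closure D z0 -> closure D) : Prop :=
  [/\ continuous Phi, set_surj [set: gromov_closure D z0] [set: closure D] Phi &
      forall z : D, \val (Phi (gint z0 z)) = \val z].

(** Geodesic loops *)

(* Here the compactification X of D is a subset of C^n. *)
Definition geodesic_loop (R : realType) (n : nat) (D X : set (Cn R n))
    (g : R -> Cn R n) : Prop :=
  geodesic_line D g /\
  X `&` cluster (g t @[t --> +oo]) = X `&` cluster (g t @[t --> -oo]).

Definition no_geodesic_loops (R : realType) (n : nat) (D X : set (Cn R n)) :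
    Prop :=
  forall g, ~ geodesic_loop D X g.

(* Main.v *)
(** The Kobayashi distance is finite, it is the infimum of lengths of curves and,
    being a complete distance, it induces the Euclidean topology (Barth), so the
    proof of Hopf-Rinow gives proper balls, geodesics and, by an ultrafilter form
    of Ascoli, limits of geodesics.  Under visibility a limit of geodesics whose
    ends tend to [p] can only land at [p], so every ray has a landing point,
    equivalent rays land at the same point, and [Phi] is the landing map.
    Conversely, if geodesics joining points near [p] to points near [q] leave
    every compact set, the Gromov products of their ends tend to infinity; hence
    the ends converge to the same Gromov boundary point and [p = q].  Two ends of
    a loop are distinct boundary points with the same image; if two inequivalent
    rays land at the same point, the geodesics joining their points meet a fixed
    ball and converge to a loop.  So absence of loops is injectivity of [Phi],
    which by sequential compactness makes the inverse continuous. *)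

Require Import Defs.
From mathcomp Require Import all_boot all_order all_algebra complex.
From mathcomp Require Import all_classical all_reals all_analysis.
From mathcomp Require Import measurable_realfun ring lra.
Import Order.TTheory GRing.Theory Num.Theory numFieldNormedType.Exports.

Set Implicit Arguments.
Unset Strict Implicit.
Unset Printing Implicit Defensive.

Local Open Scope classical_set_scope.
Local Open Scope ring_scope.

(** * Lower integrals of functions that need not be measurable *)

Section lower_integral.
Context {R : realType}.
Implicit Types (A B C N : set R) (f g : R -> \bar R) (a c : R).
Local Notation mu := (@lebesgue_measure R).
Import HBNNSimple.
Local Open Scope ereal_scope.

(** Measurability of the Kobayashi-Royden metric along a curve is not established, so lengths are
    treated as lower integrals: a nonnegative function integrates to the supremum of the integrals
    of the simple functions below it. Such integrals are still superadditive and subadditive in the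
    domain of integration and obey affine changes of variable. This suffices for symmetry, for the
    triangle inequality, and for cutting an almost minimal curve into arcs whose lengths add up to
    no more than its own. The metric geometry is then done for an abstract length metric that
    provides almost minimal paths; a geodesic is an ultralimit of points chosen on them at
    prescribed distances from one end. An ultrafilter finer than [\oo] gives limits at all real
    times at once. The Gromov topology is phrased with subsequences, so these are extracted
    afterwards from the members of the ultrafilter. Hyperbolicity enters through chains of two
    four-point inequalities. Each chain costs [2 * delta] in a Gromov product, hence [4 * delta] in
    a distance, the constant that recurs for geodesics issuing from one point. *)

Lemma ge0_integral_sup A f : (forall t, 0 <= f t) ->
  \int[mu]_(t in A) f t = ereal_sup [set sintegral mu h |
    h in [set h : {nnsfun measurableTypeR R >-> R} | forall x, (h x)%:E <= (f \_ A) x]].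
Proof.
move=> f0; have fA0 t : 0 <= (f \_ A) t by rewrite patchE; case: ifP.
rewrite /integral [X in _ - X](_ : _ = 0).
  rewrite sube0; congr (ereal_sup _).
  by apply/seteqP; split => _ [h /= hf <-]; exists h => //= t; have := hf t;
    rewrite (@ge0_funeposE _ _ setT) ?in_setT// => ? _; exact: fA0.
apply/eqP; rewrite eq_le; apply/andP; split.
  apply: ge_ereal_sup => _ [h /= hf <-].
  rewrite (eq_sintegral (cst 0%R)) ?sintegral0// => t.
  apply/eqP; rewrite eq_le; apply/andP; split; last exact: fun_ge0.
  by have := hf t; rewrite (@ge0_funenegE _ _ setT) ?in_setT ?lee_fin// => ? _; exact: fA0.
apply: ereal_sup_ubound; exists nnsfun0 => [t /=|]; last exact: sintegral0.
exact: funeneg_ge0.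
Qed.

Lemma sintegral_le_integral A f (h : {nnsfun measurableTypeR R >-> R}) :
  (forall t, 0 <= f t) -> (forall t, (h t)%:E <= (f \_ A) t) ->
  \int[mu]_t (h t)%:E <= \int[mu]_(t in A) f t.
Proof.
move=> f0 hf; rewrite (@ge0_integral_sup A)// integralT_nnsfun.
by apply: ereal_sup_ubound; exists h.
Qed.

(** With the previous lemma, this moves every inequality between lower integrals to simple
    functions, which are measurable and have additive integrals. *)
Lemma integral_le_sintegral A f M : (forall t, 0 <= f t) ->
  (forall h : {nnsfun measurableTypeR R >-> R},
     (forall t, (h t)%:E <= (f \_ A) t) -> \int[mu]_t (h t)%:E <= M) ->
  \int[mu]_(t in A) f t <= M.
Proof.
move=> f0 hM; rewrite (@ge0_integral_sup A)//; apply: ge_ereal_sup => _ [h hf <-].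
by rewrite -integralT_nnsfun; exact: hM.
Qed.

Lemma affine_preimage_oc (a c x y : R) : c != 0%R -> (x < y)%R ->
  mu ((fun t => (a + c * t)%R) @^-1` `]x, y]) = ((y - x) / `|c|)%:E.
Proof.
move=> c0 xy; have [cp|cn|c00] := ltgtP c 0%R; last by rewrite c00 eqxx in c0.
- rewrite (_ : _ @^-1` _ = `[((y - a) / c)%R, ((x - a) / c)%R[%classic).
    rewrite lebesgue_measure_itv/= lte_fin ltr_nM2r ?invr_lt0// ltrD2r xy.
    by rewrite -EFinD -mulrBl ltr0_norm// invrN mulrN -mulNr; congr (_ * _)%:E; lra.
  apply/seteqP; split => t /=; rewrite !in_itv/= ler_ndivrMr// ltr_ndivlMr//.
    by move=> /andP[? ?]; apply/andP; split; lra.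
  by move=> /andP[? ?]; apply/andP; split; lra.
- rewrite (_ : _ @^-1` _ = `]((x - a) / c)%R, ((y - a) / c)%R]%classic).
    rewrite lebesgue_measure_itv/= lte_fin ltr_pM2r ?invr_gt0// ltrD2r xy.
    by rewrite -EFinD -mulrBl gtr0_norm//; congr (_ * _)%:E; lra.
  apply/seteqP; split => t /=; rewrite !in_itv/= ler_pdivlMr// ltr_pdivrMr//.
    by move=> /andP[? ?]; apply/andP; split; lra.
  by move=> /andP[? ?]; apply/andP; split; lra.
Qed.


Lemma measurable_affine a c :
  @measurable_fun _ _ (measurableTypeR R) (measurableTypeR R) setT
    (fun t => (a + c * t)%R).
Proof.
by apply: measurable_funD.
Qed.

Lemma measurable_comp_affine a c (h : {nnsfun measurableTypeR R >-> R}) :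
  measurable_fun setT (fun t : measurableTypeR R => h (a + c * t)%R).
Proof.
exact: (measurableT_comp (T2 := measurableTypeR R) _ (measurable_affine a c)).
Qed.

(** [|c|] times the image of Lebesgue measure under the affine map gives every half-open interval
    its length, so by uniqueness it is Lebesgue measure. *)
Lemma affine_sintegral a c (h : {nnsfun measurableTypeR R >-> R}) : c != 0%R ->
  \int[mu]_t (h t)%:E = \int[mu]_t (h (a + c * t) * `|c|)%:E.
Proof.
move=> c0; pose nc := NngNum (normr_ge0 c).
have maff := measurable_affine a c.
pose m : {measure set (measurableTypeR R) -> \bar R} := mscale nc 
  (pushforward mu (fun t : measurableTypeR R => (a + c * t)%R : measurableTypeR R)).
transitivity (\int[m maff]_t (h t)%:E).
  apply: eq_measure_integral => A mA _.
  apply: lebesgue_measure_unique => // _ [[x y] _ <-].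
  have [xy|yx] := ltP x y; last first.
    by rewrite set_itv_ge ?preimage_set0 ?measure0 ?mule0// bnd_simp -leNgt.
  transitivity (`|c|%:E * mu ((fun t => (a + c * t)%R) @^-1` `]x, y])) => //.
  rewrite affine_preimage_oc// lebesgue_measure_itv/= lte_fin xy -EFinD -EFinM.
  by rewrite mulrC divfK// normr_eq0.
under [RHS]eq_integral do rewrite mulrC EFinM.
rewrite ge0_integralZl//=; last 2 first.
- apply/measurable_EFinP. exact (measurable_comp_affine a c h).
- by move=> t _; rewrite lee_fin.
have h0 t : 0 <= (h t)%:E by rewrite lee_fin.
have mh : measurable_fun setT (EFin \o h) by exact/measurable_EFinP.
rewrite ge0_integral_mscale//.
rewrite (ge0_integral_pushforward maff _ _ mh)// => t _; exact: h0.
Qed.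

Lemma le_integral_patch A B f g : (forall t, 0 <= f t) -> (forall t, 0 <= g t) ->
  (forall t, (f \_ A) t <= (g \_ B) t) ->
  \int[mu]_(t in A) f t <= \int[mu]_(t in B) g t.
Proof.
move=> f0 g0 fg; apply: integral_le_sintegral => // h hf.
by apply: sintegral_le_integral => // t; exact: le_trans (hf t) (fg t).
Qed.

(** Change of variables as an inequality of lower integrals. [N] collects the times at which a
    piecewise smooth curve has no controlled derivative; killing the simple function on this null
    set leaves its integral unchanged. *)
Lemma le_integral_affine A B N f g a c : c != 0%R -> countable N ->
  (forall t, 0 <= f t) -> (forall t, 0 <= g t) ->
  (forall t, ~ N t -> (f \_ A) (a + c * t)%R * `|c|%:E <= (g \_ B) t) ->
  \int[mu]_(t in A) f t <= \int[mu]_(t in B) g t.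
Proof.
move=> c0 cN f0 g0 fg; apply: integral_le_sintegral => // h hf.
rewrite (affine_sintegral a h c0).
have mN : measurable (N : set (measurableTypeR R)) by exact: countable_measurable.
pose u (t : measurableTypeR R) := (h (a + c * t) * `|c| * \1_(~` N) t)%R.
have mh : measurable_fun setT (fun t : measurableTypeR R => (h (a + c * t) * `|c|)%R).
  by apply: measurable_funM => //; exact: measurable_comp_affine.
have mu' : measurable_fun setT u.
  by apply: measurable_funM => //; apply: measurable_indic; exact: measurableC.
have h0 t : 0 <= (h (a + c * t) * `|c|)%:E by rewrite lee_fin mulr_ge0.
have u0 t : 0 <= (u t)%:E by rewrite lee_fin /u !mulr_ge0.
have -> : \int[mu]_t (h (a + c * t) * `|c|)%:E = \int[mu]_t (u t)%:E.
  apply: ge0_ae_eq_integral => //; [exact/measurable_EFinP|exact/measurable_EFinP|].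
  exists N; split => //; first exact: countable_lebesgue_measure0.
  move=> t /= H; apply: contrapT => Nt; apply: H => _.
  by rewrite /u indicE mem_set// mulr1.
apply: le_integral_patch => // t.
rewrite patch_setT /u; have [Nt|Nt] := pselect (N t).
  by rewrite indicE memNset ?mulr0 ?patchE; [case: ifP|exact].
rewrite indicE mem_set// mulr1 EFinM; apply: le_trans (fg t Nt).
by rewrite lee_wpmul2r// lee_fin.
Qed.

(** As [A] and [B] are disjoint, a simple function below [f] on [A] plus one below [f] on [B] stays
    below [f] on [C]. The two suprema are then taken one after the other, which requires subtracting
    finite numbers; hence the separate case [M = +oo]. *)
Lemma integral_superadditive A B C f : (forall t, 0 <= f t) ->
  measurable A -> measurable B -> A `&` B = set0 -> A `<=` C -> B `<=` C ->
  \int[mu]_(t in A) f t + \int[mu]_(t in B) f t <= \int[mu]_(t in C) f t.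
Proof.
move=> f0 mA mB AB AC BC; set M := \int[mu]_(t in C) _.
have M0 : 0 <= M by apply: integral_ge0.
have [My|My] := eqVneq M +oo; first by rewrite My leey.
have Mf : M \is a fin_num by rewrite ge0_fin_numE// lt_neqAle My leey.
have hM (h k : {nnsfun measurableTypeR R >-> R}) : (forall t, (h t)%:E <= (f \_ A) t) ->
    (forall t, (k t)%:E <= (f \_ B) t) ->
    \int[mu]_t (h t)%:E + \int[mu]_t (k t)%:E <= M.
  move=> hA kB; rewrite -ge0_integralD//; last 4 first.
  - by move=> t _; rewrite lee_fin.
  - exact/measurable_EFinP.
  - by move=> t _; rewrite lee_fin.
  - exact/measurable_EFinP.
  apply: le_integral_patch => // t; first by rewrite adde_ge0// lee_fin.
  have pE X : (f \_ X) t = if t \in X then f t else 0 by rewrite patchE.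
  rewrite patch_setT; have := hA t; have := kB t; rewrite !pE.
  have [At|At] := pselect (A t).
    have Bt : ~ B t by move=> Bt; have : (A `&` B) t by []; rewrite AB.
    rewrite (memNset Bt) !mem_set//; last exact: AC.
    by move=> k0 h0; rewrite -[leRHS]adde0 leeD.
  rewrite (memNset At); have [Bt|Bt] := pselect (B t).
    rewrite !mem_set//; last exact: BC.
    by move=> k0 h0; rewrite -[leRHS]add0e leeD.
  rewrite (memNset Bt) => k0 h0; apply: le_trans (leeD h0 k0) _.
  by rewrite adde0; case: ifP.
have fin D' u : (forall t, 0 <= u t) -> \int[mu]_(t in D') u t <= M ->
    \int[mu]_(t in D') u t \is a fin_num.
  move=> u0 uM; rewrite ge0_fin_numE ?integral_ge0//.
  by apply: le_lt_trans uM _; rewrite -ge0_fin_numE.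
have le_sub D' : D' `<=` C -> \int[mu]_(t in D') f t <= M.
  move=> DC; apply: le_integral_patch => // t; rewrite !patchE.
  have [Dt|Dt] := pselect (D' t); first by rewrite !mem_set//; exact: DC.
  by rewrite (memNset Dt); case: ifP.
have finB := fin _ _ f0 (le_sub _ BC).
rewrite -leeBrDr//; apply: integral_le_sintegral => // h hA.
rewrite leeBrDr// addeC.
have hf : \int[mu]_t (h t)%:E \is a fin_num.
  apply: (fin setT (fun t => (h t)%:E)) => [t|]; first by rewrite lee_fin.
  by apply: le_trans (le_sub _ AC); exact: sintegral_le_integral.
rewrite -leeBrDr//; apply: integral_le_sintegral => // k kB.
by rewrite leeBrDr// addeC; exact: hM.
Qed.

(** A simple function below [f] on [C] is at most the sum of its products with the indicators of [A]
    and [B]. *)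
Lemma integral_subadditive A B C f : (forall t, 0 <= f t) ->
  measurable A -> measurable B -> C `<=` A `|` B ->
  \int[mu]_(t in C) f t <= \int[mu]_(t in A) f t + \int[mu]_(t in B) f t.
Proof.
move=> f0 mA mB CAB; apply: integral_le_sintegral => // h hC.
have mh D' : measurable D' ->
    measurable_fun setT (fun t : measurableTypeR R => (h t * \1_D' t)%:E).
  move=> mD; apply/measurable_EFinP.
  by apply: measurable_funM => //; exact: measurable_indic.
apply: (@le_trans _ _ (\int[mu]_t ((h t * \1_A t)%:E + (h t * \1_B t)%:E))).
  apply: le_integral_patch => // t; rewrite -?EFinD ?patch_setT ?lee_fin.
  - by [].
  - by rewrite addr_ge0// mulr_ge0.
  have [Ct|Ct] := pselect (C t).
    rewrite -mulrDr ler_peMr// !indicE; case: (CAB t Ct) => Dt.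
      by rewrite mem_set// lerDl.
    by rewrite [in X in (_ <= _ + X)%R]mem_set// lerDr.
  have := hC t; rewrite patchE memNset// lee_fin => h0.
  by apply: le_trans h0 _; rewrite addr_ge0// mulr_ge0.
rewrite ge0_integralD//; last 4 first.
- by move=> t _; rewrite lee_fin mulr_ge0.
- exact: mh.
- by move=> t _; rewrite lee_fin mulr_ge0.
- exact: mh.
have sub D' : \int[mu]_t (h t * \1_D' t)%:E <= \int[mu]_(t in D') f t.
  apply: le_integral_patch => // t; first by rewrite lee_fin mulr_ge0.
  rewrite patch_setT patchE indicE; case: ifP => tD; last by rewrite mulr0.
  by rewrite mulr1; apply: le_trans (hC t) _; rewrite patchE; case: ifP.
exact: leeD (sub A) (sub B).
Qed.

End lower_integral.

(** * The space C^n *)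

Section complex_space.
Context {R : realType}.
Implicit Types (z w : CC R) (x : R).

Definition real_CC x : CC R := (x%:C)%C.

Lemma ltCE z w : (z < w) = (cim w == cim z) && (cre z < cre w).
Proof. exact: ltcE. Qed.

Lemma leCE z w : (z <= w) = (cim w == cim z) && (cre z <= cre w).
Proof. exact: lecE. Qed.

Lemma real_CC_lt x y : (real_CC x < real_CC y) = (x < y).
Proof. by rewrite ltCE eqxx. Qed.

Lemma real_CC_le x y : (real_CC x <= real_CC y) = (x <= y).
Proof. by rewrite leCE eqxx. Qed.

Lemma CC_ge0E z : 0 <= z -> z = real_CC (cre z).
Proof. by case: z => a b; rewrite leCE /= => /andP[/eqP -> _]. Qed.

Lemma real_CCM x y : real_CC (x * y) = real_CC x * real_CC y.
Proof. exact: rmorphM. Qed.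

Lemma real_CCD x y : real_CC (x + y) = real_CC x + real_CC y.
Proof. exact: rmorphD. Qed.

Lemma real_CCV x : real_CC x^-1 = (real_CC x)^-1.
Proof. exact: fmorphV. Qed.

Lemma norm_real_CC x : `|real_CC x| = real_CC `|x|.
Proof. by rewrite /real_CC [LHS]normc_def /= expr0n addr0 sqrtr_sqr. Qed.

Lemma creD z w : cre (z + w) = cre z + cre w.
Proof. by case: z w => ? ? [? ?]. Qed.

Lemma cimD z w : cim (z + w) = cim z + cim w.
Proof. by case: z w => ? ? [? ?]. Qed.

Lemma creB z w : cre (z - w) = cre z - cre w.
Proof. by case: z w => ? ? [? ?]. Qed.

Lemma cimB z w : cim (z - w) = cim z - cim w.
Proof. by case: z w => ? ? [? ?]. Qed.

Lemma creMr x z : cre (real_CC x * z) = x * cre z.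
Proof. by case: z => a b /=; rewrite /cre /= mul0r subr0. Qed.

Lemma cimMr x z : cim (real_CC x * z) = x * cim z.
Proof. by case: z => a b /=; rewrite /cim /= mul0r addr0. Qed.

Lemma cabsE z : `|z| = real_CC (cabs z).
Proof. exact/CC_ge0E/normr_ge0. Qed.

Lemma cabs_ge0 z : 0 <= cabs z.
Proof. by rewrite -real_CC_le -cabsE normr_ge0. Qed.

Lemma cabsM z w : cabs (z * w) = cabs z * cabs w.
Proof. by rewrite [LHS]/cabs normrM !cabsE -real_CCM. Qed.

Lemma cabs_real x : cabs (real_CC x) = `|x|.
Proof. by rewrite /cabs norm_real_CC. Qed.

Lemma normr_cre z : `|cre z| <= cabs z.
Proof. by rewrite -real_CC_le -cabsE; exact: normc_ge_Re. Qed.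

Lemma normr_cim z : `|cim z| <= cabs z.
Proof.
rewrite -real_CC_le -cabsE [`|z|]normc_def real_CC_le -[leLHS]sqrtr_sqr ler_wsqrtr//.
by rewrite lerDr sqr_ge0.
Qed.

Lemma cabs_le z : cabs z <= `|cre z| + `|cim z|.
Proof.
rewrite -real_CC_le -cabsE real_CCD -!norm_real_CC.
have -> : `|real_CC (cim z)| = `|'i%C * real_CC (cim z) : CC R|.
  by rewrite normrM [X in _ = X * _]normc_def /= expr0n expr1n add0r sqrtr1 mul1r.
rewrite {1}(_ : z = real_CC (cre z) + 'i%C * real_CC (cim z)); last exact: complexE.
exact: ler_normD.
Qed.

Lemma continuous_atP (T : topologicalType) (f : T -> R) (t : T) :
  {for t, continuous f} <->
  forall e : R, 0 < e -> \forall u \near t, `|f t - f u| < e.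
Proof. by split => [/cvgrPdist_lt//|H]; apply/cvgrPdist_lt. Qed.

Context {n : nat}.
Implicit Types (u v : Cn R n).

(** The norm of [Cn] has its values in [R[i]], whose order is partial; the real-valued version
    allows ordinary real inequalities. *)
Definition nrm v : R := cre `|v|.

Lemma nrmE v : `|v| = real_CC (nrm v).
Proof. exact/CC_ge0E/normr_ge0. Qed.

Lemma nrm_ge0 v : 0 <= nrm v.
Proof. by rewrite -real_CC_le -nrmE normr_ge0. Qed.

Lemma nrmD u v : nrm (u + v) <= nrm u + nrm v.
Proof. by rewrite -real_CC_le real_CCD -!nrmE ler_normD. Qed.

Lemma nrmN v : nrm (- v) = nrm v.
Proof. by rewrite /nrm normrN. Qed.

Lemma nrm0_eq0 v : nrm v = 0 -> v = 0.
Proof. by move=> v0; apply/eqP; rewrite -normr_eq0 nrmE v0. Qed.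

Lemma nrm0 : nrm (0 : Cn R n) = 0.
Proof. by rewrite /nrm normr0. Qed.

Lemma nrmZ z v : nrm (z *: v) = cabs z * nrm v.
Proof. by rewrite /nrm normrZ nrmE cabsE -real_CCM. Qed.

Lemma nrm_dist_triangle u v (w : Cn R n) : nrm (u - w) <= nrm (u - v) + nrm (v - w).
Proof. by rewrite (_ : u - w = (u - v) + (v - w)) ?nrmD// addrA subrK. Qed.

Lemma nbhs_nrmP v (U : set (Cn R n)) :
  nbhs v U <-> exists2 e : R, 0 < e & forall u, nrm (v - u) < e -> U u.
Proof.
split=> [/nbhs_ballP[e /= e0 eU]|[e e0 eU]].
  have eE := CC_ge0E (ltW e0).
  exists (cre e) => [|u vu]; first by rewrite -real_CC_lt -eE.
  by apply: eU; rewrite -ball_normE /= nrmE eE real_CC_lt.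
apply/nbhs_ballP; exists (real_CC e) => /=; first by rewrite (real_CC_lt 0).
by move=> u; rewrite -ball_normE /= nrmE real_CC_lt; exact: eU.
Qed.

Lemma cabs_coord v j : cabs (v 0 j) <= nrm v.
Proof.
rewrite -real_CC_le -cabsE -nrmE.
rewrite [`|v|]mx_normE -[leLHS]nngE num_le.
exact: (le_bigmax _ (fun i => `|v i.1 i.2|%:nng) (0, j)).
Qed.

Lemma nrm_cvg (T : Type) (F : set_system T) (FF : Filter F) (f : T -> Cn R n) v :
  (forall j, cre (f t 0 j) @[t --> F] --> cre (v 0 j)) ->
  (forall j, cim (f t 0 j) @[t --> F] --> cim (v 0 j)) ->
  f @ F --> v.
Proof.
move=> fr fi; apply/cvg_ballP => e e0.
have eE := CC_ge0E (ltW e0).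
have e2 : 0 < cre e / 2 by rewrite divr_gt0// -real_CC_lt -eE.
have : \forall t \near F, forall j, ball (v 0 j) e (f t 0 j).
  apply: filter_forall => j.
  near=> t; rewrite -ball_normE /= cabsE eE real_CC_lt.
  apply: le_lt_trans (cabs_le _) _; rewrite creB cimB [ltRHS]splitr.
  apply: ltrD; near: t; first by move/cvgrPdist_lt : (fr j); exact.
  by move/cvgrPdist_lt : (fi j); exact.
by apply: filterS => t H; split=> // i j; rewrite ord1.
Unshelve. all: by end_near. Qed.

Lemma compact_CC_box x :
  compact [set z : CC R | `|cre z| <= x /\ `|cim z| <= x].
Proof.
pose f (p : R * R) : CC R := Complex p.1 p.2.
have -> : [set z : CC R | `|cre z| <= x /\ `|cim z| <= x] =
    f @` (`[- x, x] `*` `[- x, x])%classic.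
  apply/seteqP; split => [[a b] /= [ax bx]|_ [[a b] /= [ax bx] <-]] /=.
    by exists (a, b) => //=; split; rewrite /= in_itv/= -ler_norml.
  by move: ax bx; rewrite /= !in_itv/= -!ler_norml.
apply: continuous_compact; last first.
  by apply: compact_setX; exact: segment_compact.
apply: continuous_subspaceT => -[a b]; apply/cvg_ballP => e e0.
have eE := CC_ge0E (ltW e0).
have e2 : 0 < cre e / 2 by rewrite divr_gt0// -real_CC_lt -eE.
near=> p; rewrite -ball_normE /= cabsE eE real_CC_lt.
apply: le_lt_trans (cabs_le _) _; rewrite creB cimB [ltRHS]splitr.
apply: ltrD; near: p.
  have /cvgrPdist_lt : (p : R * R).1 @[p --> (a, b)] --> a by exact: cvg_fst.
  exact.
have /cvgrPdist_lt : (p : R * R).2 @[p --> (a, b)] --> b by exact: cvg_snd.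
exact.
Unshelve. all: by end_near. Qed.

Lemma compact_nrm_closed (A : set (Cn R n)) x :
  closed A -> (forall v, A v -> nrm v <= x) -> compact A.
Proof.
move=> cA Ax; apply: (subclosed_compact cA
  (rV_compact (fun _ : 'I_n => @compact_CC_box x))) => v /Ax vx j /=.
split; apply: le_trans vx; apply: le_trans (cabs_coord v j);
  [exact: normr_cre|exact: normr_cim].
Qed.

End complex_space.

(** * Piecewise C^1 curves *)

Section affine_derivative.
Context {R : realType}.
Implicit Types (h : R -> R) (p q t : R).

Lemma is_derive_affine p q t : is_derive t 1 (fun u : R => p + q * u) q.
Proof.
have := is_deriveD (is_derive_cst p t 1) (is_deriveZ q (is_derive_id t (1 : R))).
by rewrite add0r /GRing.scale /= mulr1.
Qed.

Lemma is_derive_comp_affine h p q t : derivable h (p + q * t) 1 ->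
  is_derive t 1 (fun u => h (p + q * u)) (q * derive1 h (p + q * t)).
Proof.
move=> hd; rewrite mulrC; apply: is_derive1_comp; last exact: is_derive_affine.
by split => //; rewrite derive1E.
Qed.

Lemma C1_fun_comp_affine h p q : C1_fun h -> C1_fun (fun u => h (p + q * u)).
Proof.
move=> [hd hc]; split => [t|]; first by have [] := is_derive_comp_affine (hd (p + q * t)).
rewrite (_ : derive1 _ = fun t => q * derive1 h (p + q * t)); last first.
  apply/funext => t; have [_ <-] := is_derive_comp_affine (hd (p + q * t)).
  by rewrite derive1E.
move=> t; apply: cvgM; first exact: cvg_cst.
apply: (@continuous_comp _ _ _ (fun u : R => p + q * u) (derive1 h)); last exact: hc.
by apply: cvgD; [exact: cvg_cst|apply: cvgM => //; exact: cvg_cst].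
Qed.

Context {n : nat}.
Implicit Types (g G : R -> Cn R n) (D : set (Cn R n)) (a b c : R).

Lemma C1_on_affine a b a' b' g G p q : C1_on a b g ->
  (forall t, t \in `[a', b'] -> p + q * t \in `[a, b] /\ G t = g (p + q * t)) ->
  C1_on a' b' G.
Proof.
move=> [h [hC hg]] aff; exists (fun t => h (p + q * t)); split => [j|t /aff[tab ->]].
  have [hr hi] := hC j; split; first exact: (C1_fun_comp_affine p q hr).
  exact: (C1_fun_comp_affine p q hi).
exact: hg.
Qed.

(* [piecewise_C1] on an arbitrary segment, as the closure of [C1_on] under
   concatenation; unlike lists of breakpoints this survives reversal. *)
Inductive piecewise_C1_on g : R -> R -> Prop :=
| piecewise_C1_on_smooth a b : a < b -> C1_on a b g -> piecewise_C1_on g a b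
| piecewise_C1_on_cat a b c : piecewise_C1_on g a c -> piecewise_C1_on g c b ->
    piecewise_C1_on g a b.

Lemma piecewise_C1_on_lt g a b : piecewise_C1_on g a b -> a < b.
Proof. by elim=> // ? ? c _ ? _; exact: lt_trans. Qed.

Lemma piecewise_C1_on_of_path g a s : path <%R a s -> s != [::] ->
  (forall i, (i < size s)%N -> C1_on (nth 0 (a :: s) i) (nth 0 (a :: s) i.+1) g) ->
  piecewise_C1_on g a (last a s).
Proof.
elim: s a => // b s IH a /= /andP[ab pbs] _ gC1.
have gab : piecewise_C1_on g a b by apply: piecewise_C1_on_smooth => //; exact: (gC1 0%N).
have [->//|s0] := eqVneq s [::].
apply: piecewise_C1_on_cat gab _; apply: IH => // i si.
exact: (gC1 i.+1).
Qed.

Lemma piecewise_C1_on_path g a b : piecewise_C1_on g a b -> exists s : seq R,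
  [/\ path <%R a s, last a s = b &
   forall i, (i < size s)%N -> C1_on (nth 0 (a :: s) i) (nth 0 (a :: s) i.+1) g].
Proof.
elim => [{}a {}b ab gC|{}a {}b c _ [s [as_ <- sC]] _ [t [ct <- tC]]].
  by exists [:: b]; split => //= [|[]//]; rewrite ab.
exists (s ++ t); split; [by rewrite cat_path as_|by rewrite last_cat|].
elim: s a as_ sC ct tC => // x s IH a /= /andP[ax xs] sC ct tC [_|i].
  exact: (sC 0%N).
by apply: IH => // j; exact: (sC j.+1).
Qed.

Lemma piecewise_C1P g : piecewise_C1 g <-> piecewise_C1_on g 0 1.
Proof.
split=> [[s [ps s1 sC]]|/piecewise_C1_on_path//].
rewrite -s1; apply: piecewise_C1_on_of_path => //.
by apply: contra_eq_neq s1 => ->; rewrite /= eq_sym oner_eq0.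
Qed.

Lemma piecewise_C1_on_affine_gt0 g G p q a b : 0 < q ->
  piecewise_C1_on g (p + q * a) (p + q * b) ->
  (forall t, t \in `[a, b] -> G t = g (p + q * t)) ->
  piecewise_C1_on G a b.
Proof.
move=> q0.
have aE x : x = p + q * ((x - p) / q).
  by rewrite mulrCA divff ?gt_eqF// mulr1 addrC subrK.
move Ea : (p + q * a) => a'; move Eb : (p + q * b) => b' H.
elim: H a b Ea Eb => {a' b'} [a' b' ab' gC|a' b' c' H1 IH1 H2 IH2] a b Ea Eb gG.
  apply: piecewise_C1_on_smooth.
    by move: ab'; rewrite -Ea -Eb ltrD2l ltr_pM2l.
  apply: (C1_on_affine gC) => t tab; split; last exact: gG.
  move: tab; rewrite !in_itv/= -Ea -Eb => /andP[at_ tb].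
  by rewrite !lerD2l !ler_pM2l ?at_.
have ac := piecewise_C1_on_lt H1; have cb := piecewise_C1_on_lt H2.
have Ec := aE c'; move: (_ / q) Ec => c /esym Ec.
have {}ac : a < c by move: ac; rewrite -Ea -Ec ltrD2l ltr_pM2l.
have {}cb : c < b by move: cb; rewrite -Eb -Ec ltrD2l ltr_pM2l.
apply: (@piecewise_C1_on_cat _ _ _ c).
  apply: IH1 => // t tac; apply: gG; move: tac; rewrite !in_itv/= => /andP[-> tc].
  exact: le_trans tc (ltW cb).
apply: IH2 => // t tac; apply: gG; move: tac; rewrite !in_itv/= => /andP[ct ->].
by rewrite andbT (le_trans (ltW ac)).
Qed.

(** Time reversal, the source of the symmetry of the distance: a negative slope exchanges the two
    halves of a concatenation, so the induction hypotheses are used in the opposite order. *)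
Lemma piecewise_C1_on_affine_lt0 g G p q a b : q < 0 ->
  piecewise_C1_on g (p + q * b) (p + q * a) ->
  (forall t, t \in `[a, b] -> G t = g (p + q * t)) ->
  piecewise_C1_on G a b.
Proof.
move=> q0.
have aE x : x = p + q * ((x - p) / q).
  by rewrite mulrCA divff ?lt_eqF// mulr1 addrC subrK.
move Ea : (p + q * b) => a'; move Eb : (p + q * a) => b' H.
elim: H a b Ea Eb => {a' b'} [a' b' ab' gC|a' b' c' H1 IH1 H2 IH2] a b Ea Eb gG.
  apply: piecewise_C1_on_smooth.
    by move: ab'; rewrite -Ea -Eb ltrD2l ltr_nM2l.
  apply: (C1_on_affine gC) => t tab; split; last exact: gG.
  move: tab; rewrite !in_itv/= -Ea -Eb => /andP[at_ tb].
  by rewrite !lerD2l !ler_nM2l ?at_ ?tb.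
have ac := piecewise_C1_on_lt H1; have cb := piecewise_C1_on_lt H2.
have Ec := aE c'; move: (_ / q) Ec => c /esym Ec.
have {}ac : c < b by move: ac; rewrite -Ea -Ec ltrD2l ltr_nM2l.
have {}cb : a < c by move: cb; rewrite -Eb -Ec ltrD2l ltr_nM2l.
apply: (@piecewise_C1_on_cat _ _ _ c).
  apply: IH2 => // t tac; apply: gG; move: tac; rewrite !in_itv/= => /andP[-> tc].
  exact: le_trans tc (ltW ac).
apply: IH1 => // t tac; apply: gG; move: tac; rewrite !in_itv/= => /andP[ct ->].
by rewrite andbT (le_trans (ltW cb)).
Qed.

Lemma piecewise_C1_on_eq g G a b : piecewise_C1_on g a b ->
  (forall t, t \in `[a, b] -> G t = g t) -> piecewise_C1_on G a b.
Proof.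
move=> gC gG; apply: (@piecewise_C1_on_affine_gt0 g G 0 1) => // [|t tab].
  by rewrite !add0r !mul1r.
by rewrite add0r mul1r gG.
Qed.

Lemma C1_on_sub g a b a' b' : C1_on a b g -> a <= a' -> b' <= b -> C1_on a' b' g.
Proof.
move=> gC aa bb; apply: (@C1_on_affine a b a' b' g g 0 1 gC) => t.
rewrite !in_itv/= add0r mul1r => /andP[at_ tb]; split=> //.
by rewrite (le_trans aa at_) (le_trans tb bb).
Qed.

Lemma piecewise_C1_on_prefix g a b c : piecewise_C1_on g a b -> a < c -> c <= b ->
  piecewise_C1_on g a c.
Proof.
move=> H; elim: H c => {a b} [a b ab gC|a b d H1 IH1 H2 IH2] c ac cb.
  by apply: piecewise_C1_on_smooth => //; exact: (C1_on_sub gC).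
have [cd|dc] := leP c d; first exact: IH1.
by apply: piecewise_C1_on_cat H1 _; exact: IH2.
Qed.

Lemma piecewise_C1_on_suffix g a b c : piecewise_C1_on g a b -> a <= c -> c < b ->
  piecewise_C1_on g c b.
Proof.
move=> H; elim: H c => {a b} [a b ab gC|a b d H1 IH1 H2 IH2] c ac cb.
  by apply: piecewise_C1_on_smooth => //; exact: (C1_on_sub gC).
have [dc|cd] := leP d c; first exact: IH2.
by apply: piecewise_C1_on_cat _ H2; exact: IH1.
Qed.

Lemma piecewise_C1_on_sub g a b c d : piecewise_C1_on g a b ->
  a <= c -> c < d -> d <= b -> piecewise_C1_on g c d.
Proof.
move=> gC ac cd db; apply: (piecewise_C1_on_suffix _ ac cd).
by apply: (piecewise_C1_on_prefix gC) => //; exact: le_lt_trans cd.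
Qed.

Lemma C1_fun_continuous h : C1_fun h -> continuous h.
Proof.
by move=> [hd _] t; apply/differentiable_continuous/derivable1_diffP.
Qed.

(** Only the values of [g] on each closed piece are controlled, through a C^1 curve that agrees with
    it there. The value of [f] at the breakpoint tells in which piece the crossing is to be
    sought. *)
Lemma piecewise_C1_on_ivt (f : Cn R n -> R) g a b v :
  piecewise_C1_on g a b ->
  (forall t, t \in `[a, b] -> {for g t, continuous f}) ->
  f (g a) <= v <= f (g b) ->
  exists2 t, t \in `[a, b] & f (g t) = v.
Proof.
elim=> {a b} [a b ab [h [hC gh]] fC fv|a b c H1 IH1 H2 IH2 fC /andP[av vb]].
  have hc t : {for t, continuous h}.
    apply: nrm_cvg => j; have [? ?] := hC j; exact: C1_fun_continuous.
  have aab : a \in `[a, b] by rewrite in_itv/= lexx ltW.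
  have bab : b \in `[a, b] by rewrite in_itv/= lexx ltW.
  have [||t tab ftv] := @IVT R (f \o h) a b v (ltW ab).
  - apply/continuous_in_subspaceT => t /set_mem tab.
    apply: continuous_comp; first exact: hc.
    by rewrite -gh//; exact: fC.
  - move: fv; rewrite /= -!gh// => /andP[av vb].
    by rewrite ge_min av le_max vb orbT.
  - by exists t => //; rewrite gh.
have ac := piecewise_C1_on_lt H1; have cb := piecewise_C1_on_lt H2.
have sub1 t : t \in `[a, c] -> t \in `[a, b].
  by rewrite !in_itv/= => /andP[-> tc]; exact: le_trans tc (ltW cb).
have sub2 t : t \in `[c, b] -> t \in `[a, b].
  by rewrite !in_itv/= => /andP[ct ->]; rewrite andbT; exact: le_trans (ltW ac) ct.
have [cv|vc] := leP v (f (g c)).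
  have [|//|t /sub1 ? ?] := IH1; last by exists t.
    by move=> t /sub1; exact: fC.
  exact/andP.
have [|//|t /sub2 ? ?] := IH2; last by exists t.
  by move=> t /sub2; exact: fC.
by rewrite (ltW vc).
Qed.

(** * Derivatives and Kobayashi lengths of piecewise C^1 curves *)

Definition derivable_curve g t := forall j : 'I_n,
  derivable (fun u => cre (g u 0 j)) t 1 /\ derivable (fun u => cim (g u 0 j)) t 1.

(** The ends of each piece are exceptional: [derivable] is two-sided, and [g] agrees with a C^1
    curve on one side only. *)
Lemma piecewise_C1_on_derivable g a b : piecewise_C1_on g a b ->
  exists2 N : set R, finite_set N &
    forall t, t \in `[a, b] -> ~ N t -> derivable_curve g t.
Proof.
elim=> {a b} [a b ab [h [hC gh]]|a b c _ [N1 N1f IH1] _ [N2 N2f IH2]].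
  exists [set a; b] => [|t]; first exact: finite_set2.
  rewrite in_itv/= => /andP[at_ tb] Nt.
  have {}at_ : a < t by rewrite lt_neqAle at_ andbT; apply/eqP => ta; apply: Nt; left.
  have {}tb : t < b by rewrite lt_neqAle tb andbT; apply/eqP => bt; apply: Nt; right.
  move=> j; have gh' : \near t, g t = h t.
    near=> u; apply: gh; rewrite in_itv/=; apply/andP; split.
      by apply: ltW; near: u; exact: lt_nbhsr.
    by apply: ltW; near: u; exact: lt_nbhsl.
  have [[hr _] [hi _]] := hC j.
  by split; [apply: (near_eq_derivable _ (hr t))|apply: (near_eq_derivable _ (hi t))];
    apply: filterS gh' => u ->.
exists (N1 `|` N2) => [|t tab Nt]; first by rewrite finite_setU.
have [tc|ct] := leP t c.
  apply: IH1 => [|N1t]; last by apply: Nt; left.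
  by move: tab; rewrite !in_itv/= => /andP[->].
apply: IH2 => [|N2t]; last by apply: Nt; right.
by move: tab; rewrite !in_itv/= => /andP[_ ->]; rewrite ltW.
Unshelve. all: by end_near. Qed.

Lemma curve_deriv_affine g G p q t :
  (\near t, G t = g (p + q * t)) -> derivable_curve g (p + q * t) ->
  curve_deriv G t = real_CC q *: curve_deriv g (p + q * t).
Proof.
move=> gG gd; apply/rowP => j; rewrite !mxE; have [dr di] := gd j.
have Er := is_derive_comp_affine dr; have Ei := is_derive_comp_affine di.
have gr : \near t, cre (g (p + q * t) 0 j) = cre (G t 0 j).
  by apply: filterS gG => u ->.
have gi : \near t, cim (g (p + q * t) 0 j) = cim (G t 0 j).
  by apply: filterS gG => u ->.
have -> : derive1 (fun u => cre (G u 0 j)) t =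
    q * derive1 (fun u => cre (g u 0 j)) (p + q * t).
  by rewrite derive1E; have [_ ->] := near_eq_is_derive gr Er.
have -> : derive1 (fun u => cim (G u 0 j)) t =
    q * derive1 (fun u => cim (g u 0 j)) (p + q * t).
  by rewrite derive1E; have [_ ->] := near_eq_is_derive gi Ei.
by apply/eqP; rewrite eq_complex /= !mul0r subr0 addr0 !eqxx.
Qed.


Definition kobayashi_arc_length D a b g : \bar R :=
  (\int[lebesgue_measure]_(t in `[a, b]%classic)
     kobayashi_royden D (g t) (curve_deriv g t))%E.

Lemma kobayashi_royden_ge0 D z v : (0 <= kobayashi_royden D z v)%E.
Proof.
by apply: le_ereal_inf_tmp => _ [al _ <-]; rewrite lee_fin cabs_ge0.
Qed.

Lemma kobayashi_arc_length_ge0 D a b g : (0 <= kobayashi_arc_length D a b g)%E.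
Proof. by apply: integral_ge0 => t _; exact: kobayashi_royden_ge0. Qed.

Lemma kobayashi_royden_scale D z v q : q != 0 ->
  (kobayashi_royden D z (real_CC q *: v) <= `|q|%:E * kobayashi_royden D z v)%E.
Proof.
move=> q0; rewrite -lee_pdivrMl ?normr_gt0//; apply: le_ereal_inf_tmp => _ [al [f [fD f0 fv]] <-].
rewrite lee_pdivrMl ?normr_gt0// -EFinM -cabs_real -cabsM.
apply: ereal_inf_lbound; exists (real_CC q * al) => //; exists f; split => //.
by rewrite -fv scalerA.
Qed.

(** Homogeneity of the Kobayashi-Royden metric produces a factor [|q|], which cancels the Jacobian
    of the inverse change of variable. The exceptional times are the breakpoints of [g] and the
    images of [a'] and [b'], near which [G] is unknown outside its interval. *)
Lemma kobayashi_arc_length_affine D a b a' b' g G p q :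
  piecewise_C1_on g a b -> q != 0 ->
  (forall t, t \in `[a', b'] -> p + q * t \in `[a, b] /\ G t = g (p + q * t)) ->
  (kobayashi_arc_length D a' b' G <= kobayashi_arc_length D a b g)%E.
Proof.
move=> gC q0 gG; have [N Nf gd] := piecewise_C1_on_derivable gC.
have qK s : p + q * (- p / q + q^-1 * s) = s.
  by field.
apply: (@le_integral_affine R _ _ (N `|` [set p + q * a'; p + q * b']) _ _ (- p / q) q^-1).
- by rewrite invr_eq0.
- by apply: finite_set_countable; rewrite finite_setU; split=> //; exact: finite_set2.
- by move=> t; exact: kobayashi_royden_ge0.
- by move=> t; exact: kobayashi_royden_ge0.
move=> s Ns; set t := _ + _; have sE : s = p + q * t by rewrite qK.
rewrite !patchE; case: ifPn => [/set_mem /= tab|_]; last first.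
  by rewrite mul0e; case: ifP => // _; exact: kobayashi_royden_ge0.
have [sab Gt] := gG _ tab; rewrite -sE in sab Gt.
rewrite mem_set// Gt (@curve_deriv_affine g _ p q) -?sE.
- apply: le_trans (_ : (`|q|%:E * kobayashi_royden D (g s) (curve_deriv g s) * `|q^-1|%:E <= _)%E).
    by rewrite lee_wpmul2r ?lee_fin ?normr_ge0//; exact: kobayashi_royden_scale.
  by rewrite muleAC -EFinM -normrM divff// normr1 mul1e.
- have : t \in `]a', b'[.
    move: tab; rewrite !in_itv/= => /andP[at_ tb]; rewrite !lt_neqAle at_ tb !andbT.
    apply/andP; split; apply/eqP => tE; apply: Ns; right; [left|right];
      by rewrite /= sE ?tE// -tE.
  rewrite in_itv/= => /andP[at_ tb].
  near=> u; have [] // := gG u; rewrite in_itv/=; apply/andP; split.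
    by apply: ltW; near: u; exact: lt_nbhsr.
  by apply: ltW; near: u; exact: lt_nbhsl.
- by apply: gd => // Ns'; apply: Ns; left.
Unshelve. all: by end_near. Qed.

(** Superadditivity asks for disjoint domains, so the point [c] is first removed from the second
    interval, with the identity as affine map and [c] as null set. *)
Lemma kobayashi_arc_length_cat D a b c g : a <= c -> c <= b ->
  (kobayashi_arc_length D a c g + kobayashi_arc_length D c b g
     <= kobayashi_arc_length D a b g)%E.
Proof.
move=> ac cb; have KR0 t := kobayashi_royden_ge0 D (g t) (curve_deriv g t).
apply: (@le_trans _ _ (kobayashi_arc_length D a c g +
    \int[lebesgue_measure]_(t in `]c, b]%classic) kobayashi_royden D (g t) (curve_deriv g t))%E).
  rewrite leeD2l//; apply: (@le_integral_affine R _ _ [set c] _ _ 0 1) => //.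
  move=> t tc; rewrite add0r mul1r normr1 mule1 !patchE.
  case: ifPn => [/set_mem /= tcb|_]; last by case: ifP.
  rewrite mem_set//=; move: tcb; rewrite !in_itv/= => /andP[ct ->].
  by rewrite andbT lt_neqAle ct andbT; apply/eqP => ctE; exact: tc.
apply: integral_superadditive => //.
- by apply/seteqP; split => // t /=; rewrite !in_itv/= => -[/andP[_ tc] /andP[ct _]];
    rewrite leNgt ct in tc.
- by move=> t /=; rewrite !in_itv/= => /andP[-> tc]; exact: le_trans tc cb.
- by move=> t /=; rewrite !in_itv/= => /andP[ct ->]; rewrite andbT (le_trans ac)// ltW.
Qed.

Lemma kobayashi_le_arc_length D a b g : piecewise_C1_on g a b ->
  (forall t, t \in `[a, b] -> D (g t)) ->
  (kobayashi D (g a) (g b) <= kobayashi_arc_length D a b g)%E.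
Proof.
move=> gC gD; have ab : 0 < b - a by rewrite subr_gt0 (piecewise_C1_on_lt gC).
have aff t : t \in `[0, 1] -> a + (b - a) * t \in `[a, b].
  by rewrite !in_itv/= => /andP[t0 t1]; apply/andP; split; nra.
apply: le_trans (kobayashi_arc_length_affine (a' := 0) (b' := 1)
    (G := fun t => g (a + (b - a) * t)) (p := a) (q := b - a) D gC _ _).
- apply: ereal_inf_lbound; exists (fun t => g (a + (b - a) * t)) => //; split.
  + apply/piecewise_C1P; apply: piecewise_C1_on_affine_gt0 ab _ _ => //.
    by rewrite mulr0 addr0 mulr1 addrC subrK.
  + by move=> t /aff; exact: gD.
  + by rewrite mulr0 addr0.
  + by rewrite mulr1 addrC subrK.
- by rewrite gt_eqF.
- by move=> t /aff.
Qed.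

Lemma kobayashi_le_arc_length_rev D a b g : piecewise_C1_on g a b ->
  (forall t, t \in `[a, b] -> D (g t)) ->
  (kobayashi D (g b) (g a) <= kobayashi_arc_length D a b g)%E.
Proof.
move=> gC gD; have ab : a - b < 0 by rewrite subr_lt0 (piecewise_C1_on_lt gC).
have aff t : t \in `[0, 1] -> b + (a - b) * t \in `[a, b].
  by rewrite !in_itv/= => /andP[t0 t1]; apply/andP; split; nra.
apply: le_trans (kobayashi_arc_length_affine (a' := 0) (b' := 1)
    (G := fun t => g (b + (a - b) * t)) (p := b) (q := a - b) D gC _ _).
- apply: ereal_inf_lbound; exists (fun t => g (b + (a - b) * t)) => //; split.
  + apply/piecewise_C1P; apply: piecewise_C1_on_affine_lt0 ab _ _ => //.
    by rewrite mulr0 addr0 mulr1 addrC subrK.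
  + by move=> t /aff; exact: gD.
  + by rewrite mulr0 addr0.
  + by rewrite mulr1 addrC subrK.
- by rewrite lt_eqF.
- by move=> t /aff.
Qed.

End affine_derivative.

(** * The Kobayashi distance *)

Section kobayashi_local.
Context {R : realType} {n : nat}.
Implicit Types (D : set (Cn R n)) (z w v x : Cn R n) (e : R).

Lemma affine_disc_cvg x v (zeta : CC R) :
  (fun h : CC R => h^-1 *: ((x + (h + zeta) *: v) - (x + zeta *: v))) @ 0^' --> v.
Proof.
have H : \forall h \near 0^',
    cst v h = (fun h : CC R => h^-1 *: ((x + (h + zeta) *: v) - (x + zeta *: v))) h.
  near=> h; have h0 : h != 0 by near: h; exact: nbhs_dnbhs_neq.
  by rewrite /= scalerDl opprD addrACA subrr add0r addrK scalerA mulVf// scale1r.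
exact: cvg_trans (near_eq_cvg H) (cvg_cst v).
Unshelve. all: by end_near. Qed.

(** The competitor is the affine disc through [x] in direction [v] that fills the ball of radius
    [e]. *)
Lemma kobayashi_royden_le D x v e : 0 < e -> (forall u, nrm (x - u) < e -> D u) ->
  (kobayashi_royden D x v <= (nrm v / e)%:E)%E.
Proof.
move=> e0 xD; pose al := real_CC (nrm v / e).
have al0 : al == 0 -> v = 0.
  rewrite /al => /eqP/(congr1 (@cre R)) /= /eqP; rewrite mulf_eq0 invr_eq0 (gt_eqF e0) orbF.
  by move=> /eqP; exact: nrm0_eq0.
(* For [v = 0] both [al] and [al^-1] are 0: the disc is constant and still a valid competitor. *)
pose f (zeta : CC R) : Cn R n := x + zeta *: (al^-1 *: v).
apply: ereal_inf_lbound; exists al; last first.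
  by rewrite /al cabs_real ger0_norm// divr_ge0 ?nrm_ge0// ltW.
exists f; split.
- move=> zeta; rewrite /unit_disc /= cabsE (real_CC_lt _ 1) => z1; split.
    apply/cvg_ex; exists (al^-1 *: v).
    by under eq_fun do rewrite /= [_ *: 1]mulr1; exact: affine_disc_cvg.
  apply: xD; rewrite /f opprD addrA subrr add0r nrmN nrmZ.
  apply: (@le_lt_trans _ _ (cabs zeta * e)); last by rewrite gtr_pMl.
  rewrite ler_wpM2l ?cabs_ge0// nrmZ -real_CCV cabs_real invf_div.
  have [->|v0] := eqVneq v 0; first by rewrite nrm0 mulr0 ltW.
  have nv : 0 < nrm v.
    by rewrite lt_neqAle nrm_ge0 andbT eq_sym; apply: contra_neq v0; exact: nrm0_eq0.
  by rewrite gtr0_norm ?divr_gt0// divfK// (gt_eqF nv).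
- by rewrite /f scale0r addr0.
- rewrite /derive1; have := @affine_disc_cvg x (al^-1 *: v) 0.
  move=> /(cvg_lim (@norm_hausdorff _ _)) ->.
  by rewrite scalerA; have [/eqP/al0 ->|a0] := eqVneq al 0;
    [rewrite scaler0|rewrite divff// scale1r].
Qed.

Lemma C1_fun_affine (p q : R) : C1_fun (fun t : R => p + q * t).
Proof.
apply: (@C1_fun_comp_affine R id); split => [t|]; first exact: derivable_id.
rewrite (_ : derive1 (id : R -> R) = (cst 1 : R -> R)); first exact: cst_continuous.
by apply/funext => t; rewrite derive1E derive_id.
Qed.

Let segment z v (t : R) : Cn R n := z + real_CC t *: v.

Let cre_segment z v t j : cre (segment z v t 0 j) = cre (z 0 j) + cre (v 0 j) * t.
Proof. by rewrite !mxE creD creMr mulrC. Qed.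

Let cim_segment z v t j : cim (segment z v t 0 j) = cim (z 0 j) + cim (v 0 j) * t.
Proof. by rewrite !mxE cimD cimMr mulrC. Qed.

Let piecewise_C1_on_segment z v : piecewise_C1_on (segment z v) 0 1.
Proof.
apply: piecewise_C1_on_smooth => //; exists (segment z v); split => // j; split.
  by under eq_fun do rewrite cre_segment; exact: C1_fun_affine.
by under eq_fun do rewrite cim_segment; exact: C1_fun_affine.
Qed.

Let curve_deriv_segment z v t : curve_deriv (segment z v) t = v.
Proof.
apply/rowP => j; rewrite mxE.
under eq_fun do rewrite cre_segment;
  under [X in Complex _ (derive1 X _)]eq_fun do rewrite cim_segment.
rewrite !derive1E; have [_ ->] := is_derive_affine (cre (z 0 j)) (cre (v 0 j)) t.
have [_ ->] := is_derive_affine (cim (z 0 j)) (cim (v 0 j)) t.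
by case: (v 0 j).
Qed.

(** The segment from [z] to [w] stays in the ball of radius [e], so each of its points is the centre
    of a ball of radius [e] inside [D], and the metric along it is at most [nrm (z - w) / e]. *)
Lemma kobayashi_le_nrm D z w e : 0 < e -> (forall u, nrm (z - u) < e + e -> D u) ->
  nrm (z - w) < e ->
  (kobayashi D z w <= (nrm (z - w) / e)%:E)%E /\
  (kobayashi D w z <= (nrm (z - w) / e)%:E)%E.
Proof.
move=> e0 zD zw; pose g := segment z (w - z).
have gz (t : R) : t \in `[0, 1] -> nrm (z - g t) < e.
  rewrite in_itv/= => /andP[t0 t1].
  rewrite opprD addrA subrr add0r nrmN nrmZ cabs_real ger0_norm// -(opprB z) nrmN.
  by apply: le_lt_trans zw; rewrite ler_piMl ?nrm_ge0.
have gD t : t \in `[0, 1] -> D (g t).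
  by move=> /gz gt; apply: zD; rewrite (lt_trans gt)// ltrDl.
have g0 : g 0 = z by rewrite /g /segment scale0r addr0.
have g1 : g 1 = w by rewrite /g /segment scale1r addrC subrK.
have L : (kobayashi_arc_length D 0 1 g <= (nrm (z - w) / e)%:E)%E.
  apply: le_trans (_ : (\int[lebesgue_measure]_(t in `[0%R, 1%R]%classic)
     cst (nrm (z - w) / e)%:E t <= _)%E); last first.
    by rewrite integral_cst//= lebesgue_measure_itv/= lte_fin ltr01 EFinN sube0 mule1.
  have nwe : (0 <= (nrm (z - w) / e)%:E)%E by rewrite lee_fin divr_ge0 ?nrm_ge0// ltW.
  apply: le_integral_patch => // t; first exact: kobayashi_royden_ge0.
  rewrite !patchE; case: ifPn => // /set_mem /= /gz gt.
  rewrite curve_deriv_segment -(nrmN (z - w)) opprB; apply: kobayashi_royden_le => // u gu.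
  apply: zD; apply: le_lt_trans (nrm_dist_triangle _ (g t) _) _.
  exact: ltrD.
split; apply: le_trans L; rewrite -{1}g0 -{1}g1.
  exact: kobayashi_le_arc_length (piecewise_C1_on_segment z (w - z)) gD.
exact: kobayashi_le_arc_length_rev (piecewise_C1_on_segment z (w - z)) gD.
Qed.

(** * The Kobayashi distance is a finite pseudodistance *)

Lemma kobayashi_ge0 D z w : (0 <= kobayashi D z w)%E.
Proof.
apply: le_ereal_inf_tmp => _ [g _ <-]; apply: integral_ge0 => t _.
exact: kobayashi_royden_ge0.
Qed.

Lemma kobayashi_sym D z w : kobayashi D z w = kobayashi D w z.
Proof.
suff H x y : (kobayashi D x y <= kobayashi D y x)%E by apply/eqP; rewrite eq_le !H.
apply: le_ereal_inf_tmp => _ [g [gC gD <- <-] <-].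
by apply: kobayashi_le_arc_length_rev => //; exact/piecewise_C1P.
Qed.

(** Infinite infima have to be allowed: the finiteness of the distance is itself deduced from the
    triangle inequality. *)
Lemma le_ereal_inf_add (S1 S2 : set \bar R) (x : \bar R) :
  (forall y, S1 y -> 0 <= y)%E -> (forall y, S2 y -> 0 <= y)%E ->
  (forall y1 y2, S1 y1 -> S2 y2 -> x <= y1 + y2)%E ->
  (x <= ereal_inf S1 + ereal_inf S2)%E.
Proof.
move=> p1 p2 H.
have i1 : (0 <= ereal_inf S1)%E by exact: le_ereal_inf_tmp.
have i2 : (0 <= ereal_inf S2)%E by exact: le_ereal_inf_tmp.
have H1 y1 : S1 y1 -> (x <= y1 + ereal_inf S2)%E.
  move=> Sy1; have := p1 _ Sy1; case: y1 Sy1 => // [r Sr _|Sy _].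
    rewrite addeC -leeBlDr//; apply: le_ereal_inf_tmp => y2 Sy2.
    by rewrite leeBlDr// addeC; exact: H.
  by case: (ereal_inf S2) i2 => // *; exact: leey.
have [i2y|i2y] := eqVneq (ereal_inf S2) +oo%E.
  by rewrite i2y; case: (ereal_inf S1) i1 => // *; exact: leey.
have i2f : ereal_inf S2 \is a fin_num by rewrite ge0_fin_numE// lt_neqAle i2y leey.
rewrite -leeBlDr//; apply: le_ereal_inf_tmp => y1 Sy1.
by rewrite leeBlDr//; exact: H1.
Qed.

(** The two curves are concatenated on [[0, 2]], and subadditivity of the lower integral bounds the
    length of the result. *)
Lemma kobayashi_triangle D x y z : (kobayashi D x z <= kobayashi D x y + kobayashi D y z)%E.
Proof.
apply: le_ereal_inf_add => [_ [g _ <-]|_ [g _ <-]|_ _ [g [gC gD g0 g1] <-] [h [hC hD h0 h1] <-]].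
- by apply: integral_ge0 => t _; exact: kobayashi_royden_ge0.
- by apply: integral_ge0 => t _; exact: kobayashi_royden_ge0.
pose G (t : R) := if t <= 1 then g t else h (t - 1).
have Gg t : t \in `[0, 1] -> G t = g t by rewrite in_itv/= /G => /andP[_ ->].
have Gh t : t \in `[1, 2] -> G t = h (-1 + 1 * t).
  rewrite in_itv/= /G mul1r (addrC (-1)) le_eqVlt => /andP[/predU1P[<- _|t1 _]].
    by rewrite lexx subrr h0 g1.
  by rewrite leNgt t1.
move/piecewise_C1P in gC; move/piecewise_C1P in hC.
have E1 : -1 + 1 * 1 = 0 :> R by rewrite mul1r addNr.
have E2 : -1 + 1 * 2 = 1 :> R by lra.
have G01 : piecewise_C1_on G 0 1 by exact: piecewise_C1_on_eq gC Gg.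
have G12 : piecewise_C1_on G 1 2.
  apply: (@piecewise_C1_on_affine_gt0 _ _ h _ (-1) 1) => //.
  by rewrite E1 E2.
have G02 := piecewise_C1_on_cat G01 G12.
have GD t : t \in `[0, 2] -> D (G t).
  rewrite in_itv/= => /andP[t0 t2]; have [t1|t1] := leP t 1.
    by rewrite Gg ?in_itv/= ?t0//; apply: gD; rewrite in_itv/= t0.
  rewrite Gh ?in_itv/= ?(ltW t1)// mul1r; apply: hD; rewrite in_itv/=.
  by apply/andP; split; lra.
rewrite -g0 -h1 (_ : g 0 = G 0); last by rewrite Gg// in_itv/= lexx ler01.
rewrite (_ : h 1 = G 2); last first.
  by rewrite Gh ?E2// in_itv/= lexx ler1n.
apply: le_trans (kobayashi_le_arc_length G02 GD) _.
apply: le_trans (_ : (kobayashi_arc_length D 0 1 G + kobayashi_arc_length D 1 2 G <= _)%E).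
  apply: integral_subadditive => // [t|t /=]; first exact: kobayashi_royden_ge0.
  rewrite !in_itv/= => /andP[t0 t2]; have [t1|t1] := leP t 1; first by left; rewrite t0.
  by right; rewrite ltW.
apply: leeD.
  apply: (@kobayashi_arc_length_affine _ _ _ 0 1 _ _ _ _ 0 1) => // t t01.
  by rewrite add0r mul1r; split => //; exact: Gg.
apply: (@kobayashi_arc_length_affine _ _ _ 0 1 _ _ _ _ (-1) 1) => // t t12.
split; last exact: Gh.
by move: t12; rewrite !in_itv/= => /andP[? ?]; apply/andP; split; lra.
Qed.

Lemma open_nrm_ball D z : open D -> D z ->
  exists2 e : R, 0 < e & forall u, nrm (z - u) < e + e -> D u.
Proof.
move=> oD Dz; have /nbhs_nrmP[e e0 eD] : nbhs z D by exact: open_nbhs_nbhs.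
by exists (e / 2); [rewrite divr_gt0|rewrite -splitr].
Qed.

Lemma kobayashi_near D z e : open D -> D z -> 0 < e ->
  \forall w \near z, (kobayashi D z w < e%:E)%E.
Proof.
move=> oD Dz e0; have [r r0 rD] := open_nrm_ball oD Dz.
apply/nbhs_nrmP; exists (Num.min r (e * r)) => [|w].
  by rewrite lt_min r0 mulr_gt0.
rewrite lt_min => /andP[zr ze]; have [kzw _] := kobayashi_le_nrm r0 rD zr.
by apply: le_lt_trans kzw _; rewrite lte_fin ltr_pdivrMr.
Qed.

Lemma kobayashi_refl D z : open D -> D z -> kobayashi D z z = 0%E.
Proof.
move=> oD Dz; have [r r0 rD] := open_nrm_ball oD Dz.
have [|+ _] := @kobayashi_le_nrm D z z r r0 rD; first by rewrite subrr nrm0.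
rewrite subrr nrm0 mul0r => kz; apply/eqP; rewrite eq_le kz.
exact: kobayashi_ge0.
Qed.

(** The points at finite distance from [z] form a nonempty relatively open and closed subset of the
    connected set [D]. *)
Lemma kobayashi_fin_num D z w : is_domain D -> D z -> D w ->
  kobayashi D z w \is a fin_num.
Proof.
move=> [oD cD _] Dz Dw; rewrite ge0_fin_numE ?kobayashi_ge0//.
pose B := [set w | D w /\ (kobayashi D z w < +oo)%E].
have nearD x : D x -> \forall y \near x, D y /\ (kobayashi D x y < +oo)%E.
  move=> Dx; near=> y; split; near: y; first exact: open_nbhs_nbhs.
  have := kobayashi_near oD Dx ltr01; apply: filterS => y.
  by move=> /lt_trans; apply; rewrite ltry.
have oB : open B.
  rewrite openE => x [Dx kx]; rewrite /interior.
  have := nearD _ Dx; apply: filterS => y [Dy kxy]; split => //.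
  by apply: le_lt_trans (kobayashi_triangle D z x y) _; rewrite lte_add_pinfty.
have oDB : open (D `\` B).
  rewrite openE => x [Dx kx]; rewrite /interior.
  have := nearD _ Dx; apply: filterS => y [Dy kxy]; split => // -[_ kzy]; apply: kx.
  split => //; apply: le_lt_trans (kobayashi_triangle D z y x) _.
  by rewrite lte_add_pinfty// kobayashi_sym.
have BD : B = D.
  apply: cD.
  - by exists z; split => //; rewrite kobayashi_refl// ltry.
  - by exists B => //; apply/seteqP; split => [x Bx|x []//]; split => //; case: Bx.
  - exists (~` (D `\` B)); first by rewrite closedC.
    apply/seteqP; split => [x Bx|x [Dx nDB]]; first by split; [case: Bx|case].
    by apply: contrapT => nBx; exact: nDB.
by have [] : B w by rewrite BD.
Unshelve. all: by end_near. Qed.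

End kobayashi_local.

(** * Complete length metrics: Hopf-Rinow and Ascoli *)

(** [dist_path] speaks of almost minimal curves without length or continuity: an intermediate value
    clause provides points at every distance from [x], and the last clause says that following the
    curve from [x] over two successive points to [y] exceeds the distance by at most [e]. *)
Record complete_length_metric {R : realType} {T : topologicalType} (D : set T)
    (d : T -> T -> R) : Prop := CompleteLengthMetric {
  dist_ge0 : forall x y, 0 <= d x y;
  dist_refl : forall x, D x -> d x x = 0;
  dist_sep : forall x y, D x -> D y -> d x y = 0 -> x = y;
  dist_sym : forall x y, d x y = d y x;
  dist_triangle : forall x y z, D x -> D y -> D z -> d x z <= d x y + d y z;
  dist_near : forall x e, D x -> 0 < e -> \forall y \near x, D y /\ d x y < e;
  dist_nbhs : forall x U, D x -> nbhs x U ->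
    exists2 e, 0 < e & forall y, D y -> d x y < e -> U y;
  dist_locally_compact : forall x, D x ->
    exists2 e, 0 < e & compact [set y | D y /\ d x y <= e];
  dist_complete : forall u : nat -> T, (forall k, D (u k)) ->
    (forall e, 0 < e -> exists N : nat, forall k m, (N <= k)%N -> (N <= m)%N ->
       d (u k) (u m) < e) ->
    exists2 x, D x & forall e, 0 < e -> \forall k \near \oo, d (u k) x < e;
  dist_path : forall x y e, D x -> D y -> 0 < e -> exists g : R -> T,
    [/\ forall t, t \in `[0, 1] -> D (g t),
        forall v, 0 <= v <= d x y -> exists2 t, t \in `[0, 1] & d x (g t) = v &
        forall s t, s \in `[0, 1] -> t \in `[0, 1] -> s <= t ->
          d x (g s) + d (g s) (g t) + d (g t) y <= d x y + e] }.

Lemma ultra_cvg (K : Type) (F : set_system K) (T : topologicalType) (f : K -> T)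
    (A : set T) : UltraFilter F -> compact A -> (\forall k \near F, A (f k)) ->
  exists2 p, A p & f @ F --> p.
Proof.
move=> FU cA FA; have [p [Ap clp]] := cA (f @ F) _ FA.
exists p => // U /= Up; have [//|nU] := in_ultra_setVsetC (f @^-1` U) FU.
by have [q [nUq Uq]] := clp (~` U) U nU Up.
Qed.

Lemma filter_meet (K : Type) (F : set_system K) (A B : set K) :
  ProperFilter F -> F A -> F B -> exists k, A k /\ B k.
Proof. by move=> FF FA FB; have [k [? ?]] := filter_ex (filterI FA FB); exists k. Qed.

(** Converts limits along an ultrafilter into subsequences: a member of a proper filter finer than
    [\oo] meets every tail, so indices can be picked recursively. *)
Lemma strictly_increasing_selection (F : set_system nat) (A : nat -> set nat) :
  ProperFilter F -> \oo `<=` F -> (forall m, F (A m)) ->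
  exists2 psi : nat -> nat, {homo psi : i j / (i < j)%N} & forall m, A m (psi m).
Proof.
move=> FF oF FA.
have next m (k : nat) : exists j, (k < j)%N /\ A m j.
  have /filter_ex[j [Aj kj]] : F (A m `&` [set j | (k < j)%N]).
    by apply: filterI => //; apply: oF; exists k.+1.
  by exists j.
have /choice[f fP] : forall p : nat * nat, exists j, (p.2 < j)%N /\ A p.1 j.
  by move=> [m k]; exact: next.
pose fix psi m := if m is m'.+1 then f (m, psi m') else f (0%N, 0%N).
exists psi; last by case => [|m] /=; [have [] := fP (0%N, 0%N)|have [] := fP (m.+1, psi m)].
apply: homo_ltn => [//|m /=]; first exact: ltn_trans.
by have [] := fP (m.+1, psi m).
Qed.

Section length_metric.
Context {R : realType} {T : topologicalType} {D : set T} {d : T -> T -> R}.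
Hypothesis dP : complete_length_metric D d.
Implicit Types (x y z : T) (r e s t : R) (I : set R) (g c : R -> T).

Let d0 := dist_ge0 dP.
Let dxx := dist_refl dP.
Let dC := dist_sym dP.
Let dT := dist_triangle dP.
Local Hint Resolve d0 : core.

Lemma dist_cvg_lt (K : Type) (F : set_system K) {FF : Filter F} (f : K -> T) x e :
  D x -> f @ F --> x -> 0 < e -> \forall k \near F, D (f k) /\ d x (f k) < e.
Proof. by move=> Dx fx e0; exact: fx (dist_near dP Dx e0). Qed.

Lemma dist_cvg (K : Type) (F : set_system K) {FF : Filter F} (f : K -> T) x :
  D x -> (forall e, 0 < e -> \forall k \near F, D (f k) /\ d x (f k) < e) ->
  f @ F --> x.
Proof.
move=> Dx H U /= Ux; have [e e0 eU] := dist_nbhs dP Dx Ux.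
by apply: (@filterS _ F _ _ _ _ (H _ e0)) => k [Dk]; exact: eU.
Qed.

Definition dist_ball x r := [set y | D y /\ d x y <= r].

Lemma dist_ball_lim (K : Type) (F : set_system K) (f : K -> T) x y r :
  ProperFilter F -> D x -> D y -> (\forall k \near F, dist_ball x r (f k)) ->
  f @ F --> y -> dist_ball x r y.
Proof.
move=> FF Dx Dy Fr fy; split => //; apply/ler_addgt0Pr => e e0.
have Fe : \forall k \near F, D (f k) /\ d y (f k) < e by exact: dist_cvg_lt.
have [k [[Dk xk] [_ ke]]] := filter_meet FF Fr Fe.
by apply: le_trans (dT Dx Dk Dy) _; apply: lerD => //; rewrite dC ltW.
Qed.

Lemma compact_dist_ballS x r z s : D x -> D z -> compact (dist_ball x r) ->
  dist_ball z s `<=` dist_ball x r -> compact (dist_ball z s).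
Proof.
move=> Dx Dz cB sub; rewrite compact_ultra => F FU Fz.
have Fx : F (dist_ball x r) by exact: filterS Fz.
have [y [Dy _] Fy] := @ultra_cvg _ F _ id _ FU cB Fx.
by exists y; split => //; apply: (@dist_ball_lim _ F id).
Qed.

Lemma dist_intermediate x y v e : D x -> D y -> 0 <= v <= d x y -> 0 < e ->
  exists2 u, D u & d x u = v /\ d u y <= d x y - v + e.
Proof.
move=> Dx Dy vxy e0; have [g [gD gv gl]] := dist_path dP Dx Dy e0.
have [t t01 gtv] := gv _ vxy; exists (g t); first exact: gD.
split=> //; have := gl t t t01 t01 (lexx _).
by rewrite gtv (dxx (gD _ t01)); lra.
Qed.

(** The length property: [u] is the point at distance [r] on an almost minimal path from [z] to [y].
    One [e] is the excess of the radius, the other that of the path. *)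
Lemma dist_ball_proj z r y e : D z -> 0 <= r -> 0 < e -> dist_ball z (r + e) y ->
  exists2 u, dist_ball z r u & d y u <= e + e.
Proof.
move=> Dz r0 e0 [Dy zy]; have [yr|ry] := leP (d z y) r.
  by exists y => //; rewrite dxx// addr_ge0// ltW.
have [|u Du [zu uy]] := dist_intermediate Dz Dy _ e0 (v := r).
  by rewrite r0 ltW.
exists u; first by split => //; rewrite zu.
by rewrite dC; apply: le_trans uy _; rewrite lerD2r lerBlDl.
Qed.

(** Projecting to the compact ball makes the ultrafilter converge to some [p]. The radius [3 * e] is
    [e] for this convergence and [e + e] for the projection. *)
Lemma ultra_dist_ball_small (F : set_system T) z r e : UltraFilter F -> D z ->
  0 <= r -> 0 < e -> compact (dist_ball z r) -> F (dist_ball z (r + e)) ->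
  exists2 p, dist_ball z r p & F (dist_ball p (3 * e)).
Proof.
move=> FU Dz r0 e0 cB FB.
have /choice[pi piP] : forall y, exists u, dist_ball z (r + e) y ->
    dist_ball z r u /\ d y u <= e + e.
  move=> y; have [By|nBy] := pselect (dist_ball z (r + e) y); last by exists z.
  by have [u Bu yu] := dist_ball_proj Dz r0 e0 By; exists u.
have Fpi : \forall y \near F, dist_ball z r (pi y).
  by apply: filterS FB => y /piP[].
have [p Bp pip] := ultra_cvg FU cB Fpi; exists p => //.
have Fp : \forall y \near F, D (pi y) /\ d p (pi y) < e.
  exact: dist_cvg_lt Bp.1 pip e0.
apply: filterS2 FB Fp => y By [Dpy ppy]; split; first exact: By.1.
apply: le_trans (dT Bp.1 Dpy By.1) _; have [_ ype] := piP _ By.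
rewrite (_ : 3 * e = e + (e + e)); last by ring.
by apply: lerD; [exact: ltW|rewrite dC].
Qed.

(** By compactness one [e] makes all balls of radius [e] centred in the given ball compact;
    enlarging by [e / 3] keeps each ultrafilter in one of them. *)
Lemma compact_dist_ball_extend z r : D z -> 0 <= r -> compact (dist_ball z r) ->
  exists2 e, 0 < e & compact (dist_ball z (r + e)).
Proof.
move=> Dz r0 cB.
have unif : \forall e \near 0^'+, dist_ball z r `<=` [set x | compact (dist_ball x e)].
  apply: ((compact_near_coveringP _).1 cB R 0^'+ (fun e x => compact (dist_ball x e))).
  move=> x [Dx _]; have [e e0 ce] := dist_locally_compact dP Dx.
  have e2 : 0 < e / 2 by rewrite divr_gt0.
  exists ([set y | D y /\ d x y < e / 2], [set s | s < e / 2]).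
    by split; [exact (dist_near dP Dx e2)|exact: nbhs_right_lt].
  move=> [y s] /= [[Dy xy] se]; apply: (compact_dist_ballS Dx Dy ce) => w [Dw yw].
  split => //; apply: le_trans (dT Dx Dy Dw) _.
  by rewrite [leRHS]splitr; apply: lerD; [exact: ltW|exact: le_trans yw (ltW se)].
have [e [e0 ce]] := filter_meet _ (nbhs_right_gt 0) unif.
exists (e / 3); first by rewrite divr_gt0.
rewrite compact_ultra => F FU FB.
have [|p Bp Fp] := ultra_dist_ball_small FU Dz r0 _ cB FB; first by rewrite divr_gt0.
have e3 : 3 * (e / 3) = e by field.
rewrite e3 in Fp.
have [y [Dy _] Fy] := @ultra_cvg _ F _ id _ FU (ce _ Bp) Fp.
by exists y; split => //; apply: (@dist_ball_lim _ F id).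
Qed.

(** Smaller balls being compact, every ultrafilter on the ball contains balls of arbitrarily small
    radius. Their centres form a Cauchy sequence, since any two of these balls meet, and
    completeness gives the limit. *)
Lemma compact_dist_ball_closed z r : D z -> 0 < r ->
  (forall s, 0 <= s < r -> compact (dist_ball z s)) -> compact (dist_ball z r).
Proof.
move=> Dz r0 cB; rewrite compact_ultra => F FU FB.
have small e : 0 < e -> exists2 p, D p & F (dist_ball p e).
  move=> e0; pose s := Num.max 0 (r - e / 3).
  have e3 : 0 < e / 3 by rewrite divr_gt0.
  have [|||p [Dp _]] := @ultra_dist_ball_small F z s (e / 3) FU Dz _ e3.
  - by rewrite le_max lexx.
  - by apply: cB; rewrite le_max lexx gt_max r0/= ltrBlDr ltrDl.
  - apply: filterS FB => y [Dy zy]; split => //; apply: le_trans zy _.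
    by rewrite -lerBlDr le_max lexx orbT.
  by rewrite (_ : 3 * (e / 3) = e); [exists p|field].
have /choice[p pP] : forall k : nat, exists p, D p /\ F (dist_ball p k.+1%:R^-1).
  by move=> k; have [|p Dp Fp] := small k.+1%:R^-1; [rewrite invr_gt0|exists p].
have pD k := (pP k).1.
have pp k m : d (p k) (p m) <= k.+1%:R^-1 + m.+1%:R^-1.
  have [y [[Dy ky] [_ my]]] := filter_meet _ (pP k).2 (pP m).2.
  by apply: le_trans (dT (pD k) Dy (pD m)) _; apply: lerD => //; rewrite dC.
have invlt e : 0 < e -> exists N : nat, forall k, (N <= k)%N -> k.+1%:R^-1 < e.
  move=> e0; have [N _ NP] := near_infty_natSinv_lt (PosNum e0).
  by exists N => k Nk; exact: NP.
have [|q Dq pq] := dist_complete dP pD.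
  move=> e e0; have [|N NP] := invlt (e / 2); first by rewrite divr_gt0.
  exists N => k m Nk Nm; apply: le_lt_trans (pp _ _) _.
  by rewrite [ltRHS]splitr; apply: ltrD; exact: NP.
have Fq : (id : T -> T) @ F --> q.
  apply: dist_cvg => // e e0.
  have e2 : 0 < e / 2 by rewrite divr_gt0.
  have [N NP] := invlt _ e2; have [M _ MP] := pq _ e2.
  pose k := maxn N M.
  apply: filterS (pP k).2 => y [Dy ky]; split => //.
  apply: le_lt_trans (dT Dq (pD k) Dy) _.
  rewrite [ltRHS]splitr; apply: ltrD; first by rewrite dC; apply: MP => /=; exact: leq_maxr.
  by apply: le_lt_trans ky _; apply: NP; exact: leq_maxl.
by exists q; split => //; apply: (@dist_ball_lim _ F id).
Qed.

(** A noncompact ball would bound the radii of the compact ones; at their supremum the ball is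
    compact and can be enlarged. *)
Theorem hopf_rinow z r : D z -> compact (dist_ball z r).
Proof.
move=> Dz; apply: contrapT => ncr.
pose S := [set s | 0 <= s /\ compact (dist_ball z s)].
have down s s' : s' <= s -> compact (dist_ball z s) -> compact (dist_ball z s').
  move=> ss cs; apply: (compact_dist_ballS Dz Dz cs) => y [Dy zy].
  by split => //; exact: le_trans ss.
have [e e0 ce] := dist_locally_compact dP Dz.
have Se : S e by split => //; exact: ltW.
have ubS : ubound S r.
  by move=> s [_ cs]; rewrite leNgt; apply/negP => rs; apply: ncr; exact: down (ltW rs) cs.
have hsS : has_sup S by split; [exists e|exists r].
have eS : e <= sup S by exact: ub_le_sup (ex_intro _ r ubS) _ Se.
have S0 : 0 < sup S by exact: lt_le_trans eS.
have cS : compact (dist_ball z (sup S)).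
  apply: compact_dist_ball_closed => // s /andP[s0 sS].
  have ss0 : 0 < sup S - s by rewrite subr_gt0.
  have [s' [_ cs'] ss'] := sup_adherent ss0 hsS.
  by apply: down cs'; rewrite ltW//; move: ss'; rewrite opprB addrCA subrr addr0.
have [e' e'0 ce'] := compact_dist_ball_extend Dz (ltW S0) cS.
have : sup S + e' <= sup S.
  have Se' : S (sup S + e') by split => //; rewrite addr_ge0// ltW.
  exact: ub_le_sup (ex_intro _ r ubS) _ Se'.
by rewrite gerDl leNgt e'0.
Qed.


(** * Isometric curves: ultralimits, segments, Ascoli *)

Definition isometric_on I g := (forall t, I t -> D (g t)) /\
  (forall s t, I s -> I t -> d (g s) (g t) = `|s - t|).

Lemma isometric_on_sub I I' g : I' `<=` I -> isometric_on I g -> isometric_on I' g.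
Proof.
by move=> sub [gD gd]; split => [t /sub|s t /sub + /sub]; [exact: gD|exact: gd].
Qed.

Lemma dist_lipschitz x y z w : D x -> D y -> D z -> D w ->
  `|d x y - d z w| <= d x z + d y w.
Proof.
move=> Dx Dy Dz Dw.
have := dT Dx Dz Dy; have := dT Dz Dw Dy; have := dT Dz Dx Dw; have := dT Dx Dy Dw.
by rewrite (dC z x) (dC w y) ler_norml => *; apply/andP; split; lra.
Qed.

Lemma isometric_ultralimit (K : Type) (F : set_system K) (c : K -> R -> T) I z :
  UltraFilter F -> D z ->
  (forall t, I t -> exists r, \forall k \near F, dist_ball z r (c k t)) ->
  (forall s t e, I s -> I t -> 0 < e ->
     \forall k \near F, `|d (c k s) (c k t) - `|s - t| | <= e) ->
  exists2 g, isometric_on I g & forall t, I t -> c ^~ t @ F --> g t.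
Proof.
move=> FU Dz cb ci.
have /choice[g gP] : forall t, exists y, I t -> D y /\ c ^~ t @ F --> y.
  move=> t; have [It|nIt] := pselect (I t); last by exists z.
  have [r Fr] := cb _ It.
  have [y [Dy _] cy] := ultra_cvg FU (hopf_rinow (r := r) Dz) Fr.
  by exists y.
exists g => [|t /gP[]//]; split => [t /gP[]//|s t Is It].
have [Ds cs] := gP _ Is; have [Dt ct] := gP _ It.
suff H e : 0 < e -> `|d (g s) (g t) - `|s - t| | <= e.
  apply/eqP; rewrite -subr_eq0 -normr_le0; apply/ler_addgt0Pr => e e0.
  by rewrite add0r; exact: H.
move=> e0; have e3 : 0 < e / 3 by rewrite divr_gt0.
have FF : ProperFilter F by exact: ultra_proper.
have Fs := dist_cvg_lt (FF := FF) Ds cs e3; have Ft := dist_cvg_lt (FF := FF) Dt ct e3.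
have [k [kst [[Dks ks] [Dkt kt]]]] := filter_meet FF (ci _ _ _ Is It e3) (filterI Fs Ft).
rewrite -[X in `|X|](subrKA (d (c k s) (c k t))); apply: le_trans (ler_normD _ _) _.
apply: le_trans (lerD (dist_lipschitz Ds Dt Dks Dkt) kst) _.
by lra.
Qed.

(** On an almost minimal path with excess [eps k], let [c k t] be a point at distance [t] from [x].
    These choices are isometric up to [eps k], and their ultralimit is the segment. *)
Lemma isometric_segment x y : D x -> D y ->
  exists g, [/\ isometric_on [set t | 0 <= t <= d x y] g, g 0 = x & g (d x y) = y].
Proof.
move=> Dx Dy.
have [eps [eps0 eps_small]] : exists eps : nat -> R,
    (forall k, 0 < eps k) /\ forall e, 0 < e -> \forall k \near \oo, eps k < e.
  exists (fun k => k.+1%:R^-1); split => [k|e e0]; first by rewrite invr_gt0.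
  exact: (near_infty_natSinv_lt (PosNum e0)).
have /choice[h hP] := fun k => dist_path dP Dx Dy (eps0 k).
pose I := [set t | 0 <= t <= d x y].
have /choice[c cP] : forall k : nat, exists c : R -> T, forall t, I t ->
    [/\ D (c t), d x (c t) = t, d (c t) y <= d x y - t + eps k &
      exists2 u, u \in `[0, 1] & c t = h k u].
  move=> k; have [hD hv hl] := hP k.
  have /choice[c cP] : forall t, exists u, I t -> u \in `[0, 1] /\ d x (h k u) = t.
    move=> t; have [/hv[u u01 hu]|nIt] := pselect (I t); last by exists 0.
    by exists u.
  exists (fun t => h k (c t)) => t It; have [ct hct] := cP _ It.
  split; [exact: hD|by []| |by exists (c t)].
  have := hl _ _ ct ct (lexx _); rewrite (dxx (hD _ ct)) hct => H; lra.
have cc (k : nat) s t : I s -> I t -> `|d (c k s) (c k t) - `|s - t| | <= eps k.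
  move=> Is It; have [Ds xs ys [us us01 hs]] := cP k _ Is.
  have [Dt xt yt [ut ut01 ht]] := cP k _ It.
  have [hD _ hl] := hP k.
  have lo : `|s - t| <= d (c k s) (c k t).
    have := dT Dx Ds Dt; have := dT Dx Dt Ds; rewrite xs xt (dC (c k t)) => *.
    by rewrite ler_norml; apply/andP; split; lra.
  rewrite ger0_norm ?subr_ge0// lerBlDl.
  have sy := dT Dx Ds Dy; have ty := dT Dx Dt Dy; rewrite xs in sy; rewrite xt in ty.
  (* The path may backtrack, so the two points can occur on it in either order; both orders give the
     same bound. *)
  have [st|ts] := leP us ut.
    have := hl _ _ us01 ut01 st; rewrite -hs -ht xs => H.
    by have := ler_norm (t - s); rewrite distrC => ?; lra.
  have := hl _ _ ut01 us01 (ltW ts); rewrite -hs -ht xt (dC (c k t)) => H.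
  by have := ler_norm (s - t) => ?; lra.
have [F [FU oF]] := ultraFilterLemma (eventually_filter).
have small e : 0 < e -> \forall k \near F, eps k < e.
  by move=> e0; apply: oF; exact: eps_small.
have [t It|s t e Is It e0|g gi gc] := @isometric_ultralimit _ F c I x FU Dx.
- exists (d x y); apply: nearW => k; have [Dc xc _ _] := cP k _ It.
  by split => //; rewrite xc; case/andP: It.
- by apply: filterS (small _ e0) => k /ltW; exact: le_trans (cc _ _ _ Is It).
have xy0 : 0 <= d x y by exact: d0.
have I0 : I 0 by rewrite /I /= lexx.
have I1 : I (d x y) by rewrite /I /= lexx andbT.
have close t w : I t -> D w -> (forall e, 0 < e -> \forall k \near F, d (c k t) w < e) ->
    g t = w.
  move=> It Dw cw; apply: (dist_sep dP) => //; first exact: gi.1.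
  apply/eqP; rewrite eq_le d0 andbT; apply/ler_addgt0Pr => e e0.
  have e2 : 0 < e / 2 by rewrite divr_gt0.
  have FF : ProperFilter F by exact: ultra_proper.
  have [k [[Dk gk] kw]] :=
    filter_meet FF (dist_cvg_lt (FF := FF) (gi.1 _ It) (gc _ It) e2) (cw _ e2).
  by have := dT (gi.1 _ It) Dk Dw; lra.
exists g; split => //; apply: close => // e e0.
  by apply: nearW => k; have [_ xc _ _] := cP k _ I0; rewrite dC xc.
apply: filterS (small _ e0) => k; have [_ _ yc _] := cP k _ I1.
by apply: le_lt_trans; apply: le_trans yc _; rewrite subrr add0r.
Qed.

(** Isometric curves are equicontinuous, so pointwise convergence is uniform on the compact
    [[0, t]]. *)
Lemma isometric_cvg_uniform (K : Type) (F : set_system K) (l : K -> \bar R)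
    (c : K -> R -> T) g t e : Filter F ->
  (forall k, isometric_on [set s | 0 <= s /\ (s%:E <= l k)%E] (c k)) ->
  isometric_on [set s | 0 <= s] g ->
  (\forall k \near F, (t%:E <= l k)%E) ->
  (forall s, 0 <= s -> c ^~ s @ F --> g s) -> 0 < e ->
  \forall k \near F, forall s, 0 <= s <= t -> d (c k s) (g s) < e.
Proof.
move=> FF ci gi Fl cg e0; have e3 : 0 < e / 3 by rewrite divr_gt0.
have cpt : compact `[0, t]%classic by exact: segment_compact.
suff : \forall k \near F, `[0, t]%classic `<=`
    [set s | 0 <= s <= t -> d (c k s) (g s) < e].
  by apply: filterS => k H s st; apply: H => //=; rewrite in_itv/=.
apply: ((compact_near_coveringP _).1 cpt K F (fun k s => 0 <= s <= t -> d (c k s) (g s) < e)).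
move=> s /=; rewrite in_itv/= => /andP[s0 st].
have Fs := dist_cvg_lt (FF := FF) (gi.1 _ s0) (cg _ s0) e3.
exists ([set u | `|s - u| < e / 3], [set k | (t%:E <= l k)%E /\ d (g s) (c k s) < e / 3]).
  split; first exact: nbhsx_ballx.
  by apply: filterS2 Fl Fs => k ? [].
move=> [u k] /= [su [tl gck]] /andP[u0 ut].
have cd v : 0 <= v <= t -> [set s | 0 <= s /\ (s%:E <= l k)%E] v.
  by move=> /andP[v0 vt]; split => //; apply: le_trans tl; rewrite lee_fin.
have Is := cd s ltac:(by rewrite s0). have Iu := cd u ltac:(by rewrite u0).
have := dT ((ci k).1 _ Iu) ((ci k).1 _ Is) (gi.1 _ u0).
have := dT ((ci k).1 _ Is) (gi.1 _ s0) (gi.1 _ u0).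
have -> : d (c k u) (c k s) = `|s - u| by rewrite (ci k).2// distrC.
have -> : d (g s) (g u) = `|s - u| by exact: gi.2.
by rewrite (dC (c k s) (g s)) => *; lra.
Qed.

Lemma isometric_ascoli (l : nat -> \bar R) (c : nat -> R -> T) z : D z ->
  (forall k, isometric_on [set s | 0 <= s /\ (s%:E <= l k)%E] (c k)) ->
  (forall k, c k 0 = z) ->
  (forall t, \forall k \near \oo, (t%:E <= l k)%E) ->
  exists psi g, [/\ {homo psi : i j / (i < j)%N},
    isometric_on [set s | 0 <= s] g, g 0 = z &
    forall t e, 0 < e -> \forall k \near \oo, (t%:E <= l (psi k))%E /\
      forall s, 0 <= s <= t -> d (c (psi k) s) (g s) < e].
Proof.
move=> Dz ci cz cl; have [F [FU oF]] := ultraFilterLemma (eventually_filter).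
have Fl t : \forall k \near F, (t%:E <= l k)%E by apply: oF; exact: cl.
have Fl0 := Fl 0.
have [t t0|s t e s0 t0 e0|g gi gc] := @isometric_ultralimit _ F c [set s | 0 <= s] z FU Dz.
- exists t; apply: filterS (Fl t) => k tl.
  have It : [set s | 0 <= s /\ (s%:E <= l k)%E] t by [].
  have I0 : [set s | 0 <= s /\ (s%:E <= l k)%E] 0.
    by split => //=; apply: le_trans tl; rewrite lee_fin.
  split; first exact: (ci k).1.
  by rewrite -(cz k) (ci k).2// sub0r normrN ger0_norm.
- apply: filterS2 (Fl s) (Fl t) => k sl tl.
  by rewrite (ci k).2// subrr normr0 ltW.
have gz : g 0 = z.
  apply: (dist_sep dP) => //; first exact: (gi.1 _ (lexx 0)).
  apply/eqP; rewrite eq_le d0 andbT; apply/ler_addgt0Pr => e e0.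
  have FF : ProperFilter F by exact: ultra_proper.
  have [k [_ [_ ]]] :=
    filter_meet FF Fl0 (dist_cvg_lt (FF := FF) (gi.1 _ (lexx 0)) (gc _ (lexx 0)) e0).
  by rewrite cz add0r => /ltW.
(* Closeness [1 / (m + 1)] on [[0, m]]: one index in each [A m] already gives a subsequence
   converging on all compacta. *)
pose A (m : nat) := [set k | (m%:R%:E <= l k)%E /\
  forall s, 0 <= s <= m%:R -> d (c k s) (g s) < m.+1%:R^-1].
have [|psi psi_inc psiA] := @strictly_increasing_selection F A _ oF.
  move=> m; apply: filterI; first exact: Fl.
  by apply: (isometric_cvg_uniform (l := l)) => //; rewrite invr_gt0.
exists psi, g; split => // t e e0.
near=> m; have [ml mc] := psiA m.
have tm : t <= m%:R by near: m; exact: nbhs_infty_ger.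
split; first by apply: le_trans ml; rewrite lee_fin.
move=> s /andP[s0 st]; apply: (@lt_trans _ _ m.+1%:R^-1).
  by apply: mc; rewrite s0 (le_trans st).
by near: m; exact: (near_infty_natSinv_lt (PosNum e0)).
Unshelve. all: by end_near. Qed.

End length_metric.

(** * The Kobayashi distance as a complete length metric *)

Section kobayashi_metric.
Context {R : realType} {n : nat} (D : set (Cn R n)).
Hypothesis domD : is_domain D.
Implicit Types (x y z w : Cn R n) (e r : R).

Definition kdist z w : R := fine (kobayashi D z w).

Lemma kobayashiE z w : D z -> D w -> kobayashi D z w = (kdist z w)%:E.
Proof. by move=> Dz Dw; rewrite fineK// kobayashi_fin_num. Qed.

Let oD : open D. Proof. by case: domD. Qed.

Lemma kdist_ge0 z w : 0 <= kdist z w.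
Proof. by rewrite fine_ge0// kobayashi_ge0. Qed.

Lemma kdist_refl z : D z -> kdist z z = 0.
Proof. by move=> Dz; rewrite /kdist kobayashi_refl. Qed.

Lemma kdist_sym z w : kdist z w = kdist w z.
Proof. by rewrite /kdist kobayashi_sym. Qed.

Lemma kdist_triangle x y z : D x -> D y -> D z ->
  kdist x z <= kdist x y + kdist y z.
Proof.
move=> Dx Dy Dz; rewrite -lee_fin EFinD -!kobayashiE//.
exact: kobayashi_triangle.
Qed.

Lemma kdist_near x e : D x -> 0 < e -> \forall y \near x, D y /\ kdist x y < e.
Proof.
move=> Dx e0; have H1 := kobayashi_near oD Dx e0.
have H2 : \forall y \near x, D y by exact: open_nbhs_nbhs.
by apply: filterS2 H1 H2 => y xy Dy; split => //; rewrite -lte_fin -kobayashiE.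
Qed.

Lemma kdist_continuous z x : D z -> D x -> {for x, continuous (kdist z)}.
Proof.
move=> Dz Dx; apply/continuous_atP => e e0.
have := kdist_near Dx e0; apply: filterS => y [Dy xy].
have := kdist_triangle Dz Dy Dx; have := kdist_triangle Dz Dx Dy.
rewrite (kdist_sym y x) => *.
by rewrite ltr_norml; apply/andP; split; lra.
Qed.

(** For a curve of length at most [kdist x y + e], the lengths of its three arcs bound the three
    distances, and superadditivity bounds their sum. *)
Lemma kdist_path x y e : D x -> D y -> 0 < e -> exists g : R -> Cn R n,
  [/\ piecewise_C1_on g 0 1, forall t, t \in `[0, 1] -> D (g t),
      g 0 = x, g 1 = y & forall s t, s \in `[0, 1] -> t \in `[0, 1] -> s <= t ->
          kdist x (g s) + kdist (g s) (g t) + kdist (g t) y <= kdist x y + e].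
Proof.
move=> Dx Dy e0.
have [_ [g [gC gD g0 g1] <-] gL] := lb_ereal_inf_adherent e0 (kobayashi_fin_num domD Dx Dy).
move/piecewise_C1P in gC; exists g; split => // s t s01 t01 st.
have seg a b : a \in `[0, 1] -> b \in `[0, 1] -> a <= b ->
    ((kdist (g a) (g b))%:E <= kobayashi_arc_length D a b g)%E.
  move=> a01 b01; rewrite -kobayashiE; [|exact: gD|exact: gD].
  rewrite le_eqVlt => /predU1P[->|ab].
    by rewrite kobayashi_refl ?kobayashi_arc_length_ge0//; exact: gD.
  move: a01 b01; rewrite !in_itv/= => /andP[a0 a1] /andP[b0 b1].
  apply: kobayashi_le_arc_length; first exact: (piecewise_C1_on_sub gC a0 ab b1).
  move=> u; rewrite in_itv/= => /andP[au ub]; apply: gD.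
  by rewrite in_itv/= (le_trans a0 au) (le_trans ub b1).
have I0 : (0 : R) \in `[0, 1] by rewrite in_itv/= lexx ler01.
have I1 : (1 : R) \in `[0, 1] by rewrite in_itv/= lexx ler01.
move: (s01) (t01); rewrite !in_itv/= => /andP[s0 s1] /andP[t0 t1].
rewrite -lee_fin !EFinD -{1}g0 -{1}g1.
apply: le_trans (leeD (leeD (seg _ _ I0 s01 s0) (seg _ _ s01 t01 st)) (seg _ _ t01 I1 t1)) _.
apply: le_trans (leeD (kobayashi_arc_length_cat D g s0 st) (lexx _)) _.
apply: le_trans (kobayashi_arc_length_cat D g t0 t1) _.
by rewrite -kobayashiE//; exact: ltW.
Qed.

Hypothesis chD : complete_hyperbolic D.

Lemma kdist_sep x y : D x -> D y -> kdist x y = 0 -> x = y.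
Proof. by move=> Dx Dy xy; apply: chD.1 => //; rewrite kobayashiE// xy. Qed.

Lemma closed_nrm_ball x r : closed [set y | nrm (x - y) <= r].
Proof.
rewrite -[X in closed X]setCK closedC openE => y /= /negP; rewrite -ltNge => ry.
rewrite /interior; apply/nbhs_nrmP; exists (nrm (x - y) - r); first by rewrite subr_gt0.
move=> z yz /=; apply/negP; rewrite -ltNge.
have := nrm_dist_triangle x z y; rewrite -(nrmN (z - y)) opprB => ?; lra.
Qed.

Lemma compact_nrm_ball x r : compact [set y | nrm (x - y) <= r].
Proof.
apply: (@compact_nrm_closed _ _ _ (nrm x + r)); first exact: closed_nrm_ball.
move=> y /= xy; rewrite (_ : y = x - (x - y)); last by rewrite opprB addrC subrK.
by apply: le_trans (nrmD _ _) _; rewrite nrmN lerD2l.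
Qed.

Lemma nrm_continuous x y : {for y, continuous (fun u : Cn R n => nrm (x - u))}.
Proof.
apply/continuous_atP => e e0; apply/nbhs_nrmP; exists e => // z.
have := nrm_dist_triangle x y z; have := nrm_dist_triangle x z y.
rewrite -(nrmN (z - y)) opprB => *.
by rewrite ltr_norml; apply/andP; split; lra.
Qed.

(* Barth's theorem: a path from [x] leaving a small Euclidean sphere crosses it,
   and on that compact sphere the distance to [x] is bounded below. *)
Lemma kdist_nbhs x (U : set (Cn R n)) : D x -> nbhs x U ->
  exists2 e, 0 < e & forall y, D y -> kdist x y < e -> U y.
Proof.
move=> Dx /nbhs_nrmP[r1 r10 r1U]; have [r2 r20 r2D] := open_nrm_ball oD Dx.
pose r := Num.min (r1 / 2) r2.
have r0 : 0 < r by rewrite lt_min r20 divr_gt0.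
have rr1 : r < r1 by rewrite gt_min ltr_pdivrMr// ltr_pMr// ltr1n.
have rr2 : r < r2 + r2 by rewrite (@le_lt_trans _ _ r2)// ?ge_min ?lexx ?orbT// ltrDl.
pose S := [set y | nrm (x - y) = r].
have SD y : S y -> D y by move=> Sy; apply: r2D; rewrite Sy.
have cS : compact S.
  apply: (subclosed_compact _ (@compact_nrm_ball x r)); last by move=> y /= ->.
  have -> : S = [set y | nrm (x - y) <= r] `&` ~` [set y | nrm (x - y) < r].
    apply/seteqP; split => [y /= ->|y /= [yr /negP]]; first by rewrite lexx ltxx.
    by rewrite -leNgt => ry; apply/eqP; rewrite eq_le yr.
  apply: closedI; first exact: closed_nrm_ball.
  rewrite closedC openE => y /= yr; rewrite /interior.
  have /continuous_atP/(_ (r - nrm (x - y))) := @nrm_continuous x y.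
  rewrite subr_gt0 => /(_ yr); apply: filterS => z /=.
  by rewrite ltr_norml => /andP[? ?]; lra.
have [e e0 eS] : exists2 e, 0 < e & forall y, S y -> e <= kdist x y.
  have : \forall e \near 0^'+, S `<=` [set y | e <= kdist x y].
    apply: ((compact_near_coveringP _).1 cS R 0^'+ (fun e y => e <= kdist x y)).
    move=> y Sy; have Dy := SD _ Sy.
    have xy0 : 0 < kdist x y.
      rewrite lt_neqAle kdist_ge0 andbT eq_sym; apply/eqP => /(kdist_sep Dx Dy) xy.
      by move: Sy r0; rewrite /S /= xy subrr nrm0 => <-; rewrite ltxx.
    have xy2 : 0 < kdist x y / 2 by rewrite divr_gt0.
    exists ([set z | D z /\ kdist y z < kdist x y / 2], [set e | e < kdist x y / 2]).
      by split; [exact (kdist_near Dy xy2)|exact: nbhs_right_lt].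
    move=> [z e] /= [[Dz yz] ey].
    by have := kdist_triangle Dx Dz Dy; rewrite (kdist_sym z y) => ?; lra.
  move=> He; have [e [e0 eS]] := filter_meet _ (nbhs_right_gt 0) He.
  by exists e.
exists e => // y Dy xye; apply: r1U; rewrite ltNge; apply/negP => r1y.
have e'0 : 0 < e - kdist x y by rewrite subr_gt0.
(* An excess smaller than [e - kdist x y] places the crossing point of the sphere at distance less
   than [e] from [x]. *)
have [g [gC gD g0 g1 gl]] := kdist_path Dx Dy (divr_gt0 e'0 (ltr0n R 2)).
have [t t01 gt] : exists2 t, t \in `[0, 1] & nrm (x - g t) = r.
  apply: (piecewise_C1_on_ivt (f := fun u => nrm (x - u)) gC).
    by move=> t _; exact: nrm_continuous.
  by rewrite g0 g1 subrr nrm0 (ltW r0) (le_trans (ltW rr1)).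
have := gl t t t01 t01 (lexx _); rewrite (kdist_refl (gD _ t01)).
have := eS _ gt; have := kdist_ge0 (g t) y; lra.
Qed.

(** By comparison of the topologies a small Kobayashi ball lies in a Euclidean ball that is compact
    and contained in [D]. *)
Lemma kdist_locally_compact x : D x ->
  exists2 e, 0 < e & compact [set y | D y /\ kdist x y <= e].
Proof.
move=> Dx; have [r r0 rD] := open_nrm_ball oD Dx.
have [|e e0 eU] := @kdist_nbhs x [set y | nrm (x - y) <= r] Dx.
  by apply/nbhs_nrmP; exists r => // y /ltW.
have e2 : 0 < e / 2 by rewrite divr_gt0.
exists (e / 2) => //; rewrite compact_ultra => F FU FB.
have FK : F [set y | nrm (x - y) <= r].
  apply: filterS FB => y [Dy xy]; apply: eU => //; apply: le_lt_trans xy _.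
  by rewrite ltr_pdivrMr// ltr_pMr// ltr1n.
have [y yr Fy] := @ultra_cvg _ F _ id _ FU (@compact_nrm_ball x r) FK.
have Dy : D y by apply: rD; apply: le_lt_trans yr _; rewrite ltrDl.
exists y; split => //; split => //; apply/ler_addgt0Pr => e' e'0.
have Fe' : F [set z | D z /\ kdist y z < e'] by exact: Fy (kdist_near Dy e'0).
have [z [[Dz xz] [_ yz]]] := filter_meet _ FB Fe'.
by have := kdist_triangle Dx Dz Dy; rewrite (kdist_sym z y) => ?; lra.
Qed.

Lemma kdist_complete (u : nat -> Cn R n) : (forall k, D (u k)) ->
  (forall e, 0 < e -> exists N : nat, forall k m, (N <= k)%N -> (N <= m)%N ->
       kdist (u k) (u m) < e) ->
  exists2 x, D x & forall e, 0 < e -> \forall k \near \oo, kdist (u k) x < e.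
Proof.
move=> uD uC; have [|x Dx ux] := chD.2 u uD.
  move=> e e0; have [N NP] := uC e e0; exists N => k m Nk Nm.
  by rewrite kobayashiE// lte_fin; exact: NP.
exists x => // e e0; have [_ /cvgrPdist_lt/(_ e e0)] := (fine_cvgP _ _).1 ux.
by apply: filterS => k; rewrite sub0r normrN ger0_norm// kdist_ge0.
Qed.

Lemma kdist_complete_length_metric : complete_length_metric D kdist.
Proof.
split.
- exact: kdist_ge0.
- exact: kdist_refl.
- exact: kdist_sep.
- exact: kdist_sym.
- exact: kdist_triangle.
- exact: kdist_near.
- exact: kdist_nbhs.
- exact: kdist_locally_compact.
- exact: kdist_complete.
move=> x y e Dx Dy e0; have [g [gC gD g0 g1 gl]] := kdist_path Dx Dy e0.
exists g; split => // v vxy.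
apply: (piecewise_C1_on_ivt (f := kdist x) gC); last by rewrite g0 g1 kdist_refl.
by move=> t t01; apply: kdist_continuous => //; exact: gD.
Qed.

Lemma geodesicP (I : set R) g : geodesic D I g <-> isometric_on (D := D) (d := kdist) I g.
Proof.
split=> -[gD gd]; split => // s t Is It.
  by rewrite /kdist gd.
by rewrite kobayashiE ?gd//; exact: gD.
Qed.

End kobayashi_metric.

(** * Geodesics in Gromov hyperbolic domains *)

Lemma increasing_cvg_oo (phi : nat -> nat) : {homo phi : i j / (i < j)%N} ->
  phi @ \oo --> \oo.
Proof.
move=> inc P [N _ NP]; exists N => // k Nk; apply: NP => /=; apply: leq_trans Nk _.
by elim: k => // k IH; apply: leq_ltn_trans IH (inc _ _ _).
Qed.

Lemma not_near_oo_subsequence (P : set nat) : ~ (\forall k \near \oo, P k) ->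
  exists2 phi : nat -> nat, {homo phi : i j / (i < j)%N} & forall k, ~ P (phi k).
Proof.
move=> nP; have /choice[f fP] : forall N, exists k, (N < k)%N /\ ~ P k.
  move=> N; apply: contrapT => H; apply: nP; exists N.+1 => // k Nk.
  by apply: contrapT => nPk; apply: H; exists k.
exists (fun k => iter k.+1 f 0%N) => [|k]; last by case: (fP (iter k f 0%N)).
apply: homo_ltn => [//|m /=]; first exact: ltn_trans.
by case: (fP (f (iter m f 0%N))).
Qed.

Section gromov_geometry.
Context {R : realType} {n : nat} {D : set (Cn R n)}.
Hypothesis domD : is_domain D.
Hypothesis chD : complete_hyperbolic D.
Implicit Types (x y z w o p q : Cn R n) (e r t : R) (g h eta theta : R -> Cn R n).

Let d := kdist D.
Let dP : complete_length_metric D d := kdist_complete_length_metric domD chD.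
Local Notation iso := (isometric_on (D := D) (d := d)).
Local Notation seg r := [set t : R | 0 <= t <= r].
Local Notation halfline := [set t : R | 0 <= t].

Lemma segE r : `[0, r]%classic = seg r :> set R.
Proof. by apply/seteqP; split => t /=; rewrite in_itv/=. Qed.

Lemma halflineE : `[0, +oo[%classic = halfline :> set R.
Proof. by apply/seteqP; split => t /=; rewrite in_itv/= andbT. Qed.

Lemma dist_geodesic_start r t g o : iso (seg r) g -> g 0 = o -> 0 <= t <= r ->
  d o (g t) = t.
Proof.
move=> [_ gd] <- tr; have /andP[t0 _] := tr.
rewrite gd//=; first by rewrite sub0r normrN ger0_norm.
by rewrite lexx; case/andP: tr => ?; exact: le_trans.
Qed.

Lemma dist_ray_start t g o : iso halfline g -> g 0 = o -> 0 <= t -> d o (g t) = t.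
Proof.
move=> gi g0 t0; apply: (@dist_geodesic_start t) => //; last by rewrite t0 lexx.
by apply: isometric_on_sub gi => s /= /andP[].
Qed.

Variable delta : R.
Hypothesis delta0 : 0 <= delta.
Hypothesis gh : forall o x y z, D o -> D x -> D y -> D z ->
  Num.min (gromov_product D o x y) (gromov_product D o y z) - delta
    <= gromov_product D o x z.

Lemma gromov_productE o x y : gromov_product D o x y = (d o x + d o y - d x y) / 2.
Proof. by rewrite /gromov_product (kobayashi_sym D x o) (kobayashi_sym D y o). Qed.

Lemma gromov_four_point o x y z s : D o -> D x -> D y -> D z ->
  s <= gromov_product D o x y -> s <= gromov_product D o y z ->
  s - delta <= gromov_product D o x z.
Proof.
move=> Do Dx Dy Dz xy yz; apply: le_trans (gh Do Dx Dy Dz).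
by rewrite lerD2r le_min xy.
Qed.

(* At the point [g s] where [(g 0 | g s)_o = (g s | g L)_o], this common value is
   the mean of [d o (g s)] and [(g 0 | g L)_o]: apply the four-point condition. *)
Lemma gromov_product_center o g L : D o -> 0 <= L -> iso (seg L) g ->
  exists2 s, 0 <= s <= L & d o (g s) <= gromov_product D o (g 0) (g L) + 2 * delta.
Proof.
move=> Do L0 gi.
have I0 : seg L 0 by rewrite /= lexx.
have IL : seg L L by rewrite /= lexx andbT.
have Dx := gi.1 _ I0; have Dy := gi.1 _ IL.
have xy : d (g 0) (g L) = L by rewrite gi.2// sub0r normrN ger0_norm.
pose s := (L + d o (g 0) - d o (g L)) / 2.
have T1 := dist_triangle dP Dx Do Dy; have T2 := dist_triangle dP Do Dx Dy.
have T3 := dist_triangle dP Do Dy Dx.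
have C1 := dist_sym dP (g 0) o; have C2 := dist_sym dP (g L) (g 0).
have sL : 0 <= s <= L by apply/andP; split; rewrite /s; lra.
have Du := gi.1 _ sL.
have ux : d (g s) (g 0) = s by rewrite gi.2// subr0 ger0_norm//; case/andP: sL.
have uy : d (g s) (g L) = L - s.
  by rewrite gi.2// distrC ger0_norm// subr_ge0; case/andP: sL.
exists s => //.
(* The base point is [g s]: there the product of [g 0] and [g L] vanishes, as [g s] lies between
   them, and the choice of [s] makes the products of [o] with [g 0] and with [g L] equal. *)
have := gh Du Dx Do Dy; rewrite !gromov_productE xy ux uy.
rewrite (dist_sym dP (g s) o) (dist_sym dP (g 0) o) => H.
suff : (s + d o (g s) - d o (g 0)) / 2 <= delta by rewrite /s; lra.
have E : (s + d o (g s) - d o (g 0)) / 2 = (d o (g s) + (L - s) - d o (g L)) / 2.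
  by rewrite /s; lra.
by move: H; rewrite -E minxx; lra.
Qed.

(** The elementary counterpart of [gromov_product_center]; it keeps products bounded along a line
    passing through a fixed point. *)
Lemma gromov_product_le o g (I : set R) a b s : D o -> iso I g ->
  I a -> I b -> I s -> a <= s <= b -> gromov_product D o (g a) (g b) <= d o (g s).
Proof.
move=> Do gi Ia Ib Is /andP[as_ sb].
have T1 := dist_triangle dP Do (gi.1 _ Is) (gi.1 _ Ia).
have T2 := dist_triangle dP Do (gi.1 _ Is) (gi.1 _ Ib).
rewrite gi.2// ger0_norm ?subr_ge0// in T1.
rewrite gi.2// distrC ger0_norm ?subr_ge0// in T2.
rewrite gromov_productE gi.2// distrC ger0_norm; last by rewrite subr_ge0; lra.
lra.
Qed.

Lemma gromov_product_along o eta r t : D o -> iso (seg r) eta -> eta 0 = o ->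
  0 <= t <= r -> gromov_product D o (eta t) (eta r) = t.
Proof.
move=> Do ei e0 /andP[t0 tr]; rewrite gromov_productE.
have r0 : 0 <= r by exact: le_trans tr.
have It : seg r t by rewrite /= t0.
have Ir : seg r r by rewrite /= r0 lexx.
rewrite (dist_geodesic_start ei e0 It) (dist_geodesic_start ei e0 Ir) ei.2//.
by rewrite distrC ger0_norm ?subr_ge0//; lra.
Qed.

Lemma gromov_productC o x y : gromov_product D o x y = gromov_product D o y x.
Proof. by rewrite !gromov_productE (dist_sym dP x y); lra. Qed.

(** Going from [eta t] through [eta r] and [theta s] to [theta t] uses the four-point condition
    twice, so the product of [eta t] and [theta t] is at least [t - 2 * delta]. Both points are at
    distance [t] from [o]. *)
Lemma geodesics_close o eta theta r s t : D o ->
  iso (seg r) eta -> eta 0 = o -> iso (seg s) theta -> theta 0 = o ->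
  0 <= t <= r -> t <= s -> t <= gromov_product D o (eta r) (theta s) ->
  d (eta t) (theta t) <= 4 * delta.
Proof.
move=> Do ei e0 hi h0 tr ts tp; have /andP[t0 t_r] := tr.
have r0 : 0 <= r by exact: le_trans t_r.
have s0 : 0 <= s by exact: le_trans ts.
have ts' : 0 <= t <= s by rewrite t0.
have Det : D (eta t) by exact: ei.1.
have Der : D (eta r) by apply: ei.1; rewrite /= r0 lexx.
have Dht : D (theta t) by exact: hi.1.
have Dhs : D (theta s) by apply: hi.1; rewrite /= s0 lexx.
have e1 := gromov_product_along Do ei e0 tr.
have e2 := gromov_product_along Do hi h0 ts'.
have p1 : t - delta <= gromov_product D o (eta t) (theta s).
  by apply: (gromov_four_point Do Det Der Dhs) => //; rewrite e1.
have p2 : t - delta - delta <= gromov_product D o (eta t) (theta t).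
  by apply: (gromov_four_point Do Det Dhs Dht) => //; rewrite gromov_productC e2 lerBlDr lerDl.
by move: p2; rewrite gromov_productE (dist_geodesic_start ei e0)// (dist_geodesic_start hi h0)//; lra.
Qed.

(** The reverse chain, from [eta r] through [eta t] and [theta t] to [theta s]. The middle product
    is at least [t - c / 2]. *)
Lemma gromov_product_ge o eta theta r s t c : D o ->
  iso (seg r) eta -> eta 0 = o -> iso (seg s) theta -> theta 0 = o ->
  0 <= t <= r -> t <= s -> 0 <= c -> d (eta t) (theta t) <= c ->
  t - c / 2 - 2 * delta <= gromov_product D o (eta r) (theta s).
Proof.
move=> Do ei e0 hi h0 tr ts c0 tc; have /andP[t0 t_r] := tr.
have r0 : 0 <= r by exact: le_trans t_r.
have s0 : 0 <= s by exact: le_trans ts.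
have ts' : 0 <= t <= s by rewrite t0.
have Det : D (eta t) by exact: ei.1.
have Der : D (eta r) by apply: ei.1; rewrite /= r0 lexx.
have Dht : D (theta t) by exact: hi.1.
have Dhs : D (theta s) by apply: hi.1; rewrite /= s0 lexx.
have e1 := gromov_product_along Do ei e0 tr.
have e2 := gromov_product_along Do hi h0 ts'.
have p : t - c / 2 <= gromov_product D o (eta t) (theta t).
  by rewrite gromov_productE (dist_geodesic_start ei e0)// (dist_geodesic_start hi h0)//; lra.
have p1 : t - c / 2 - delta <= gromov_product D o (eta r) (theta t).
  by apply: (gromov_four_point Do Der Det Dht) => //; rewrite gromov_productC e1; have := delta0; lra.
have := @gromov_four_point o _ _ _ (t - c / 2 - delta) Do Der Dht Dhs p1.
have le_t : t - c / 2 - delta <= t by have := delta0; lra.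
by rewrite e2 => /(_ le_t); lra.
Qed.

(** Any bound [c] improves to a universal one: at the later time [r = t + c / 2 + 2 * delta] the
    ends have product at least [t]. *)
Lemma rays_close o eta theta c t : D o -> iso halfline eta -> eta 0 = o ->
  iso halfline theta -> theta 0 = o -> 0 <= t ->
  (forall s, 0 <= s -> d (eta s) (theta s) <= c) ->
  d (eta t) (theta t) <= 4 * delta.
Proof.
move=> Do ei e0 hi h0 t0 close.
have c0 : 0 <= c by apply: le_trans (close 0 (lexx _)); exact: (dist_ge0 dP).
pose r := t + c / 2 + 2 * delta.
have tr : 0 <= t <= r by rewrite t0 /r; have := delta0; lra.
have r0 : 0 <= r by case/andP: tr => _; exact: le_trans.
have sub s : seg s `<=` halfline by move=> u /= /andP[].
have ei' : iso (seg r) eta := isometric_on_sub (sub r) ei.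
have hi' : iso (seg r) theta := isometric_on_sub (sub r) hi.
apply: (geodesics_close (r := r) (s := r) Do ei' e0 hi' h0 tr); first by case/andP: tr.
have := @gromov_product_ge o eta theta r r r c Do ei' e0 hi' h0.
by rewrite r0 lexx => /(_ isT isT c0 (close _ r0)); rewrite /r; lra.
Qed.

End gromov_geometry.

(** * The Gromov boundary *)

Section gromov_boundary_theory.
Context {R : realType} {n : nat} {D : set (Cn R n)} {z0 : Cn R n}.
Hypothesis domD : is_domain D.
Hypothesis chD : complete_hyperbolic D.
Hypothesis Dz0 : D z0.
Implicit Types (x y z w p q : Cn R n) (r e t : R) (g h : R -> Cn R n).
Implicit Types (sigma tau : gromov_boundary D z0) (phi psi : nat -> nat).

Let d := kdist D.
Let dP : complete_length_metric D d := kdist_complete_length_metric domD chD.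
Local Notation iso := (isometric_on (D := D) (d := d)).
Local Notation seg r := [set t : R | 0 <= t <= r].
Local Notation halfline := [set t : R | 0 <= t].
Local Notation upto l := [set t : R | 0 <= t /\ (t%:E <= l)%E].

Lemma rays_fromP g : rays_from D z0 g <-> iso halfline g /\ g 0 = z0.
Proof.
rewrite /rays_from /geodesic_ray /= halflineE.
by split=> -[/(geodesicP domD)].
Qed.

Lemma ray_equivP g h : iso halfline g -> iso halfline h ->
  (ray_equiv D g h <-> exists c, forall t, 0 <= t -> d (g t) (h t) <= c).
Proof.
move=> gi hi; rewrite /ray_equiv halflineE; split=> [supy|[c cb]]; last first.
  apply: (@le_lt_trans _ _ c%:E); last exact: ltry.
  apply: ge_ereal_sup => _ [t /= t0 <-].
  by rewrite (kobayashiE domD) ?lee_fin; [exact: cb|exact: gi.1|exact: hi.1].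
set S := [set _ | _ in _] in supy.
have Sle t : 0 <= t -> ((d (g t) (h t))%:E <= ereal_sup S)%E.
  move=> t0; apply: ereal_sup_ubound; exists t => //.
  by rewrite (kobayashiE domD)//; [exact: gi.1|exact: hi.1].
have fS : ereal_sup S \is a fin_num.
  by rewrite fin_real// supy andbT (lt_le_trans _ (Sle 0 (lexx _)))// ltNyr.
by exists (fine (ereal_sup S)) => t t0; rewrite -lee_fin (fineK fS); exact: Sle.
Qed.

Lemma boundary_rep sigma : exists g, \val sigma g.
Proof.
case: sigma => c /= /set_mem [g gr ->]; exists g; split=> //.
have [gi g0] := (rays_fromP g).1 gr; apply/ray_equivP => //.
by exists 0 => t t0; rewrite (dist_refl dP)//; exact: gi.1.
Qed.

Lemma boundary_ray sigma g : \val sigma g -> iso halfline g /\ g 0 = z0.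
Proof. by case: sigma => c /= /set_mem [h hr ->] [/rays_fromP]. Qed.

Lemma boundary_close sigma g h : \val sigma g -> \val sigma h ->
  exists c, forall t, 0 <= t -> d (g t) (h t) <= c.
Proof.
move=> sg sh; have [gi _] := boundary_ray sg; have [hi _] := boundary_ray sh.
case: sigma sg sh => c /= /set_mem [k /rays_fromP[ki _] ->].
move=> [_ /(ray_equivP ki gi)[a kg]] [_ /(ray_equivP ki hi)[b kh]].
exists (a + b) => t t0.
apply: le_trans (dist_triangle dP (gi.1 _ t0) (ki.1 _ t0) (hi.1 _ t0)) _.
by rewrite (dist_sym dP (g t)); apply: lerD; [exact: kg|exact: kh].
Qed.

Lemma boundary_mem sigma g h c : \val sigma g -> iso halfline h -> h 0 = z0 ->
  (forall t, 0 <= t -> d (g t) (h t) <= c) -> \val sigma h.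
Proof.
move=> sg hi h0 gh; have [gi _] := boundary_ray sg.
case: sigma sg => s /= /set_mem [k /rays_fromP[ki k0] ->].
move=> [_ /(ray_equivP ki gi)[a kg]]; split; first exact/rays_fromP.
apply/(ray_equivP ki hi); exists (a + c) => t t0.
apply: le_trans (dist_triangle dP (ki.1 _ t0) (gi.1 _ t0) (hi.1 _ t0)) _.
by apply: lerD; [exact: kg|exact: gh].
Qed.

Lemma boundary_eq sigma tau g h c : \val sigma g -> \val tau h ->
  (forall t, 0 <= t -> d (g t) (h t) <= c) -> sigma = tau.
Proof.
move=> sg th gh; have [gi g0] := boundary_ray sg; have [hi h0] := boundary_ray th.
have sh := boundary_mem sg hi h0 gh.
apply: val_inj; apply/seteqP; split => k.
  move=> sk; have [ki k0] := boundary_ray sk; have [b bh] := boundary_close sh sk.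
  exact: boundary_mem th ki k0 bh.
move=> tk; have [ki k0] := boundary_ray tk; have [b bh] := boundary_close th tk.
exact: boundary_mem sh ki k0 bh.
Qed.

Lemma boundary_of_ray g : iso halfline g -> g 0 = z0 ->
  exists sigma : gromov_boundary D z0, \val sigma g.
Proof.
move=> gi g0; have gr : rays_from D z0 g by exact/rays_fromP.
have cP : gromov_boundary D z0 [set h | rays_from D z0 h /\ ray_equiv D g h].
  by exists g.
exists (SigSub (mem_set cP)); split => //; apply/ray_equivP => //.
by exists 0 => t t0; rewrite (dist_refl dP)//; exact: gi.1.
Qed.

Definition uniform_cvg (l : nat -> \bar R) (c : nat -> R -> Cn R n) g :=
  forall t e, 0 < e -> \forall k \near \oo, (t%:E <= l k)%E /\
    forall s, 0 <= s <= t -> d (c k s) (g s) < e.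

Lemma cvg_compactaP (l : nat -> \bar R) (c : nat -> R -> Cn R n) g :
  (forall k, iso (upto (l k)) (c k)) -> iso halfline g ->
  (cvg_compacta D l c g <-> uniform_cvg l c g).
Proof.
move=> ci gi; split=> H t e e0; apply: filterS (H t e e0) => k [tl cg]; split=> // s st.
  have /andP[s0 s_t] := st.
  rewrite -lte_fin -kobayashiE//; [exact: cg| |exact: gi.1].
  by apply: (ci k).1; split => //; apply: le_trans tl; rewrite lee_fin.
have /andP[s0 s_t] := st.
rewrite (kobayashiE domD) ?lte_fin; [exact: cg| |exact: gi.1].
by apply: (ci k).1; split => //; apply: le_trans tl; rewrite lee_fin.
Qed.

Lemma uniform_cvg_sub l c g phi : {homo phi : i j / (i < j)%N} ->
  uniform_cvg l c g -> uniform_cvg (l \o phi) (c \o phi) g.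
Proof. by move=> inc H t e e0; exact: increasing_cvg_oo inc _ (H t e e0). Qed.

(** Makes convergence independent of the chosen geodesics: an Ascoli limit of any subsequence of
    [c'] stays within [a + 2] of [g], hence belongs to [sigma]. The 2 is one unit of approximation
    for each of the two convergences. *)
Lemma subseq_cvg_close sigma (l l' : nat -> \bar R) (c c' : nat -> R -> Cn R n) g a :
  \val sigma g -> uniform_cvg l c g -> (forall k, iso (upto (l k)) (c k)) ->
  (forall k, iso (upto (l' k)) (c' k)) -> (forall k, c' k 0 = z0) ->
  (forall t, \forall k \near \oo, (t%:E <= l' k)%E) ->
  (forall t, 0 <= t -> \forall k \near \oo, d (c' k t) (c k t) <= a) ->
  subseq_cvg D l' c' (\val sigma).
Proof.
move=> sg cg ci ci' c0' l'y cc' phi inc.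
have [gi g0] := boundary_ray sg.
have phioo := increasing_cvg_oo inc.
have [|||psi [h [incp hi h0 ch]]] :=
    @isometric_ascoli _ _ _ _ dP (l' \o phi) (c' \o phi) z0 Dz0.
- by move=> k; exact: ci'.
- by move=> k; exact: c0'.
- by move=> t; exact: phioo (l'y t).
exists psi; split => //; exists h; last first.
  by apply/cvg_compactaP => // k; exact: ci'.
have psioo := increasing_cvg_oo incp.
apply: (boundary_mem (c := a + 2) sg hi h0) => t t0.
have tt : 0 <= t <= t by rewrite t0 lexx.
have [k [[tl' chk] [[tl cgk] cc]]] : exists k,
    ((t%:E <= l' (phi (psi k)))%E /\
       forall s, 0 <= s <= t -> d (c' (phi (psi k)) s) (h s) < 1) /\
    ((t%:E <= l (phi (psi k)))%E /\
       forall s, 0 <= s <= t -> d (c (phi (psi k)) s) (g s) < 1) /\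
    d (c' (phi (psi k)) t) (c (phi (psi k)) t) <= a.
  apply: (filter_meet eventually_filter (ch t 1 ltr01)).
  apply: (psioo [set m | _] (phioo [set m | _] (filterI (cg t 1 ltr01) (cc' t t0)))).
set m := phi (psi k) in tl' chk tl cgk cc.
have Dc : D (c m t) by exact: (ci m).1.
have Dc' : D (c' m t) by exact: (ci' m).1.
have T1 := dist_triangle dP (gi.1 _ t0) Dc (hi.1 _ t0).
have T2 := dist_triangle dP Dc Dc' (hi.1 _ t0).
have S1 := dist_sym dP (g t) (c m t); have S2 := dist_sym dP (c m t) (c' m t).
have := cgk _ tt; have := chk _ tt; lra.
Qed.

(** [int_cvg] quantifies over all segments from [z0] to the points; here one converging choice is
    exhibited, which is what Ascoli provides. Hyperbolicity leads back to [int_cvg]. *)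
Definition ray_approx (x : nat -> D) sigma :=
  exists (r : nat -> R) (c : nat -> R -> Cn R n) (g : R -> Cn R n),
  [/\ forall k, [/\ 0 <= r k, iso (seg (r k)) (c k), c k 0 = z0 & c k (r k) = \val (x k)],
      \val sigma g & uniform_cvg (EFin \o r) c g].

Lemma upto_segE r : upto r%:E = seg r.
Proof.
apply/seteqP; split => t /=; rewrite lee_fin; first by move=> [-> ->].
by move=> /andP[].
Qed.

Lemma segment_from_basepoint (x : D) : exists (r : R) (c : R -> Cn R n),
  [/\ 0 <= r, iso (seg r) c, c 0 = z0 & c r = \val x].
Proof.
have [c [ci c0 c1]] := isometric_segment dP Dz0 (set_valP x).
by exists (d z0 (\val x)), c; split => //; exact: (dist_ge0 dP).
Qed.

Lemma segment_length r c x : iso (seg r) c -> c 0 = z0 -> c r = x -> 0 <= r ->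
  d z0 x = r.
Proof.
by move=> ci c0 <- r0; apply: (dist_geodesic_start ci) => //; rewrite r0 lexx.
Qed.

Lemma ray_approx_ex (x : nat -> D) :
  (forall a, \forall k \near \oo, a <= d z0 (\val (x k))) ->
  exists psi sigma, {homo psi : i j / (i < j)%N} /\ ray_approx (x \o psi) sigma.
Proof.
move=> xoo; have /choice[r /choice[c rc]] := fun k => segment_from_basepoint (x k).
have [|||psi [g [inc gi g0 cg]]] :=
    @isometric_ascoli _ _ _ _ dP (EFin \o r) c z0 Dz0.
- by move=> k; rewrite upto_segE; have [] := rc k.
- by move=> k; have [] := rc k.
- move=> t; apply: filterS (xoo t) => k; have [r0 ci c0 cr] := rc k.
  by rewrite (segment_length ci c0 cr r0) lee_fin.
have [sigma sg] := boundary_of_ray gi g0.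
by exists psi, sigma; split => //; exists (r \o psi), (c \o psi), g; split => // k; exact: rc.
Qed.

Lemma ray_approx_sub (x : nat -> D) sigma phi : {homo phi : i j / (i < j)%N} ->
  ray_approx x sigma -> ray_approx (x \o phi) sigma.
Proof.
move=> inc [r [c [g [rc sg cg]]]]; exists (r \o phi), (c \o phi), g; split => //.
  by move=> k; exact: rc.
exact: uniform_cvg_sub inc cg.
Qed.

Lemma int_cvg_approx (x : nat -> D) sigma phi : {homo phi : i j / (i < j)%N} ->
  int_cvg x sigma ->
  exists2 psi, {homo psi : i j / (i < j)%N} & ray_approx (x \o phi \o psi) sigma.
Proof.
move=> inc xs; have /choice[r /choice[c rc]] := fun k => segment_from_basepoint (x k).
have [|psi [incp [g sg cg]]] := xs r c _ phi inc.
  by move=> k; have [r0 ci c0 cr] := rc k; split => //; apply/(geodesicP domD); rewrite segE.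
exists psi => //; exists (r \o phi \o psi), (c \o phi \o psi), g; split => //.
  by move=> k; exact: rc.
apply/cvg_compactaP => //; last exact: (boundary_ray sg).1.
by move=> k; rewrite upto_segE; have [] := rc (phi (psi k)).
Qed.

(** * The Gromov boundary under the four-point condition *)

Variable delta : R.
Hypothesis delta0 : 0 <= delta.
Hypothesis gh : forall o x y z, D o -> D x -> D y -> D z ->
  Num.min (gromov_product D o x y) (gromov_product D o y z) - delta
    <= gromov_product D o x z.

(** Two segments from [z0] to the same point have equal length, and this length is the Gromov
    product of their common end with itself, so they stay [4 * delta] close throughout. *)
Lemma ray_approx_int_cvg (x : nat -> D) sigma : ray_approx x sigma -> int_cvg x sigma.
Proof.
move=> [r [c [g [rc sg cg]]]] r' c' rc'.
have ci' k : iso (seg (r' k)) (c' k).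
  by have [_ /(geodesicP domD)] := rc' k; rewrite segE.
have rr k : r' k = r k.
  have [r0 ci c0 cr] := rc k; have [r0' _ c0' cr'] := rc' k.
  by rewrite -(segment_length ci c0 cr r0) (segment_length (ci' k) c0' cr' r0').
have roo t : \forall k \near \oo, (t%:E <= (r k)%:E)%E.
  by apply: filterS (cg t 1 ltr01) => k [].
apply: (subseq_cvg_close (l := EFin \o r) (c := c) (a := 4 * delta) sg cg).
- by move=> k; rewrite upto_segE; have [] := rc k.
- by move=> k; rewrite upto_segE.
- by move=> k; have [] := rc' k.
- by move=> t; apply: filterS (roo t) => k; rewrite rr.
move=> t t0; apply: filterS (roo t) => k; rewrite lee_fin => tr.
have [r0 ci c0 cr] := rc k; have [r0' _ c0' cr'] := rc' k.
apply: (geodesics_close domD chD delta0 gh (r := r' k) (s := r k) Dz0) => //.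
  by rewrite t0 rr.
have xx : d (\val (x k)) (\val (x k)) = 0 by exact: (dist_refl dP (set_valP (x k))).
have x0 := segment_length ci c0 cr r0.
by rewrite cr' cr gromov_productE -[kdist D]/d xx x0; lra.
Qed.

(** Sequential compactness of the boundary. A limit found for one choice of representatives serves
    all choices, since equivalent rays are [4 * delta] close. *)
Lemma bd_cvg_ex (s : nat -> gromov_boundary D z0) :
  exists psi sigma, {homo psi : i j / (i < j)%N} /\ bd_cvg (s \o psi) sigma.
Proof.
have /choice[c sc] := fun k => boundary_rep (s k).
have upy : upto +oo%E = halfline.
  by apply/seteqP; split => t /= => [[]//|t0]; split => //; exact: leey.
have [|||psi [g [inc gi g0 cg]]] :=
    @isometric_ascoli _ _ _ _ dP (fun=> +oo%E) c z0 Dz0.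
- by move=> k; rewrite upy; have [] := boundary_ray (sc k).
- by move=> k; have [] := boundary_ray (sc k).
- by move=> t; apply: nearW => k; exact: leey.
have [sigma sg] := boundary_of_ray gi g0.
exists psi, sigma; split => // c' sc'.
apply: (subseq_cvg_close (l := fun=> +oo%E) (c := c \o psi) (a := 4 * delta) sg cg).
- by move=> k; rewrite upy; have [] := boundary_ray (sc (psi k)).
- by move=> k; rewrite upy; have [] := boundary_ray (sc' k).
- by move=> k; have [] := boundary_ray (sc' k).
- by move=> t; apply: nearW => k; exact: leey.
move=> t t0; apply: nearW => k.
have [ci c0] := boundary_ray (sc (psi k)); have [ci' c0'] := boundary_ray (sc' k).
have [a ca] := boundary_close (sc' k) (sc (psi k)).
exact: (rays_close domD chD delta0 gh Dz0 ci' c0' ci c0 t0 ca).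
Qed.

(** Large products keep the two segments [4 * delta] close up to any given time; each limit ray adds
    one unit of approximation. *)
Lemma ray_approx_eq (x y : nat -> D) sigma tau : ray_approx x sigma ->
  ray_approx y tau ->
  (forall a, \forall k \near \oo, a <= gromov_product D z0 (\val (x k)) (\val (y k))) ->
  sigma = tau.
Proof.
move=> [r [c [g [rc sg cg]]]] [r' [c' [h [rc' th ch]]]] xy.
have [gi g0] := boundary_ray sg; have [hi h0] := boundary_ray th.
apply: (boundary_eq (c := 4 * delta + 2) sg th) => t t0.
have tt : 0 <= t <= t by rewrite t0 lexx.
have [k [[tr cgk] [[tr' chk] xyk]]] := filter_meet eventually_filter (cg t 1 ltr01)
  (filterI (ch t 1 ltr01) (xy t)).
have [r0 ci c0 cr] := rc k; have [r0' ci' c0' cr'] := rc' k.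
move: tr tr' => /=; rewrite !lee_fin => tr tr'.
have I1 : 0 <= t <= r k by rewrite t0.
have I2 : 0 <= t <= r' k by rewrite t0.
have Dc := ci.1 _ I1; have Dc' := ci'.1 _ I2.
have : d (c k t) (c' k t) <= 4 * delta.
  apply: (geodesics_close domD chD delta0 gh (r := r k) (s := r' k) Dz0) => //.
  by rewrite cr cr'.
have T1 := dist_triangle dP (gi.1 _ t0) Dc (hi.1 _ t0).
have T2 := dist_triangle dP Dc Dc' (hi.1 _ t0).
rewrite (dist_sym dP (g t) (c k t)) in T1.
have := cgk _ tt; have := chk _ tt; lra.
Qed.

Lemma ray_approx_product (x y : nat -> D) sigma a : ray_approx x sigma ->
  ray_approx y sigma ->
  exists k, a <= gromov_product D z0 (\val (x k)) (\val (y k)).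
Proof.
move=> [r [c [g [rc sg cg]]]] [r' [c' [h [rc' th ch]]]].
have [gi g0] := boundary_ray sg; have [hi h0] := boundary_ray th.
have [b bP] := boundary_close sg th.
have b0 : 0 <= b by apply: le_trans (bP 0 (lexx _)); exact: (dist_ge0 dP).
(* At this time the two segments are within [b + 2], and the value is the one for which
   [gromov_product_ge] yields [a]. *)
pose t := Num.max 0 (a + (b + 2) / 2 + 2 * delta).
have t0 : 0 <= t by rewrite le_max lexx.
have ta : a + (b + 2) / 2 + 2 * delta <= t by rewrite le_max lexx orbT.
have tt : 0 <= t <= t by rewrite t0 lexx.
have [k [[tr cgk] [tr' chk]]] := filter_meet eventually_filter (cg t 1 ltr01)
  (ch t 1 ltr01).
have [r0 ci c0 cr] := rc k; have [r0' ci' c0' cr'] := rc' k.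
move: tr tr' => /=; rewrite !lee_fin => tr tr'.
have I1 : 0 <= t <= r k by rewrite t0.
have I2 : 0 <= t <= r' k by rewrite t0.
have Dc := ci.1 _ I1; have Dc' := ci'.1 _ I2.
exists k; rewrite -cr -cr'.
have ccb : d (c k t) (c' k t) <= b + 2.
  have T1 := dist_triangle dP Dc (gi.1 _ t0) Dc'.
  have T2 := dist_triangle dP (gi.1 _ t0) (hi.1 _ t0) Dc'.
  rewrite (dist_sym dP (h t) (c' k t)) in T2.
  have := cgk _ tt; have := chk _ tt; have := bP _ t0; lra.
have b2 : 0 <= b + 2 by lra.
have := gromov_product_ge domD chD delta0 gh Dz0 ci c0 ci' c0' I1 tr' b2 ccb.
lra.
Qed.

Lemma int_cvg_topology (x : nat -> D) sigma : int_cvg x sigma ->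
  (fun k => gint z0 (x k)) @ \oo --> (gbd sigma : gromov_closure D z0).
Proof.
move=> xs U; rewrite nbhsE => -[V [oV Vs] VU].
have [_ iV _] : gromov_open V := oV.
by apply: filterS (iV _ _ xs Vs) => k; exact: VU.
Qed.

Lemma bd_cvg_topology (s : nat -> gromov_boundary D z0) sigma : bd_cvg s sigma ->
  (fun k => gbd (s k)) @ \oo --> (gbd sigma : gromov_closure D z0).
Proof.
move=> ss U; rewrite nbhsE => -[V [oV Vs] VU].
have [_ _ bV] : gromov_open V := oV.
by apply: filterS (bV _ _ ss Vs) => k; exact: VU.
Qed.

End gromov_boundary_theory.

(** * Visibility and landing points of rays *)

Section visibility_landing.
Context {R : realType} {n : nat} {D : set (Cn R n)} {z0 : Cn R n}.
Hypothesis domD : is_domain D.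
Hypothesis bD : bounded_set D.
Hypothesis chD : complete_hyperbolic D.
Hypothesis Dz0 : D z0.
Implicit Types (x y z w p q : Cn R n) (a r e t : R) (g h : R -> Cn R n).
Implicit Types (sigma tau : gromov_boundary D z0) (phi psi : nat -> nat).

Let d := kdist D.
Let dP : complete_length_metric D d := kdist_complete_length_metric domD chD.
Local Notation iso := (isometric_on (D := D) (d := d)).
Local Notation seg r := [set t : R | 0 <= t <= r].
Local Notation halfline := [set t : R | 0 <= t].

Lemma nrm_seq_cvg (u : nat -> Cn R n) p :
  (forall k, nrm (p - u k) < k.+1%:R^-1) -> u @ \oo --> p.
Proof.
move=> up U /nbhs_nrmP[e e0 eU].
have := near_infty_natSinv_lt (PosNum e0); apply: filterS => k ke /=.
by apply: eU; apply: lt_trans (up k) ke.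
Qed.

Lemma closure_seq (A : set (Cn R n)) p : closure A p ->
  exists2 u : nat -> Cn R n, (forall k, A (u k)) & u @ \oo --> p.
Proof.
move=> Ap; have /choice[u uP] : forall k : nat, exists x, A x /\ nrm (p - x) < k.+1%:R^-1.
  move=> k; have [|x [Ax px]] := Ap [set x | nrm (p - x) < k.+1%:R^-1].
    by apply/nbhs_nrmP; exists k.+1%:R^-1; rewrite ?invr_gt0.
  by exists x.
by exists u => [k|]; [case: (uP k)|apply: nrm_seq_cvg => k; case: (uP k)].
Qed.

Lemma compact_closure : compact (closure D).
Proof.
have [M [Mr MP]] := bD.
pose r := cre (M + 1).
have rP x : D x -> nrm x <= r.
  move=> Dx; rewrite -real_CC_le -nrmE.
  have M1 : M < M + 1 by rewrite ltrDl.
  apply: le_trans (MP _ M1 _ Dx) _.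
  by rewrite -(CC_ge0E _)//; apply: le_trans (MP _ M1 _ Dx).
have cD : closed [set x : Cn R n | nrm (0 - x) <= r] by exact: closed_nrm_ball.
apply: (subclosed_compact (@closed_closure _ D) (@compact_nrm_ball _ _ 0 r)).
rewrite [X in _ `<=` X](closure_id _).1//; apply: closureS => x /rP /=.
by rewrite sub0r nrmN.
Qed.

Lemma bdryP p : bdry D p <-> closure D p /\ ~ D p.
Proof. by rewrite /bdry (_ : interior D = D)//; apply/interior_id; case: domD. Qed.

Lemma closure_lim (K : Type) (F : set_system K) (f : K -> Cn R n) p :
  ProperFilter F -> (\forall k \near F, D (f k)) -> f @ F --> p -> closure D p.
Proof.
move=> FF FD fp U Up; have [k [Dk Uk]] := filter_meet FF FD (fp U Up).
by exists (f k).
Qed.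

(** Kobayashi balls are compact, hence closed in [Cn], so a point outside [D] has a neighbourhood
    missing any of them. *)
Lemma dist_escape (K : Type) (F : set_system K) (f : K -> Cn R n) p a :
  ProperFilter F -> (\forall k \near F, D (f k)) -> f @ F --> p -> ~ D p ->
  \forall k \near F, a < d z0 (f k).
Proof.
move=> FF FD fp nDp.
have cB : closed (dist_ball (D := D) (d := d) z0 a).
  by apply: compact_closed; [exact: norm_hausdorff|exact: hopf_rinow].
have Up : nbhs p (~` dist_ball (D := D) (d := d) z0 a).
  by apply: open_nbhs_nbhs; split; [rewrite openC|case].
apply: (@filterS2 _ F _ _ _ _ _ FD (fp _ Up)) => k Dk nB.
by rewrite ltNge; apply/negP => ka; exact: nB.
Qed.

Lemma dist_escape_lim (K : Type) (F : set_system K) (f : K -> Cn R n) p :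
  ProperFilter F -> (forall a, \forall k \near F, a <= d z0 (f k)) -> f @ F --> p -> ~ D p.
Proof.
move=> FF Fa fp Dp.
have Fp : \forall k \near F, D (f k) /\ d p (f k) < 1.
  exact: (dist_cvg_lt dP (FF := FF) Dp fp ltr01).
have [k [[Dk pk] ak]] := filter_meet FF Fp (Fa (d z0 p + 1)).
by have := dist_triangle dP Dz0 Dp Dk; lra.
Qed.

Lemma compact_sub_dist_ball (A : set (Cn R n)) : compact A -> A `<=` D ->
  exists a, forall x, A x -> d z0 x <= a.
Proof.
move=> cA AD.
have : \forall a \near +oo, A `<=` [set x | d z0 x <= a].
  apply: ((compact_near_coveringP _).1 cA R +oo (fun a x => d z0 x <= a)).
  move=> x /AD Dx; exists ([set y | D y /\ d x y < 1], [set a | d z0 x + 1 < a]).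
    by split; [exact: (dist_near dP Dx ltr01)|exact: nbhs_pinfty_gt (num_real _)].
  move=> [y a] /= [[Dy xy] xa].
  by have := dist_triangle dP Dz0 Dx Dy; lra.
by move=> /filter_ex[a aP]; exists a.
Qed.

Lemma cluster_pinftyP g q : cluster (g t @[t --> +oo]) q <->
  forall a (U : set (Cn R n)), nbhs q U -> exists2 t, a <= t & U (g t).
Proof.
split=> [gq a U Uq|H A U].
  have [|x [[t at_ <-] Ux]] := gq (g @` [set t | a <= t]) U _ Uq; last by exists t.
  by apply: filterS (nbhs_pinfty_ge (num_real a)) => t at_; exists t.
move=> [M [_ MA]] Uq; have [t Mt Ut] := H (M + 1) U Uq.
exists (g t); split => //; apply: MA; apply: lt_le_trans Mt.
by rewrite ltrDl.
Qed.

Lemma cluster_pinfty_neq0 g : (forall t, 0 <= t -> D (g t)) ->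
  exists2 p, closure D p & cluster (g t @[t --> +oo]) p.
Proof.
move=> gD; have [] := compact_closure (F := g t @[t --> +oo]) _.
  apply: filterS (nbhs_pinfty_ge (num_real 0)) => t t0.
  by apply: subset_closure; exact: gD.
by move=> p [Dp gp]; exists p.
Qed.

Lemma cluster_unique_cvg g p : (forall t, 0 <= t -> D (g t)) ->
  (forall q, cluster (g t @[t --> +oo]) q -> q = p) -> g t @[t --> +oo] --> p.
Proof.
move=> gD gp U Up; apply: contrapT => nU.
have /choice[t tP] : forall k : nat, exists t, [/\ 0 <= t, k%:R <= t & ~ U (g t)].
  move=> k; apply: contrapT => H; apply: nU.
  apply: filterS (nbhs_pinfty_ge (num_real k%:R)) => t kt.
  by apply: contrapT => nUt; apply: H; exists t; split => //; exact: le_trans kt.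
have [F [FU oF]] := ultraFilterLemma eventually_filter.
have [|q _ gq] := @ultra_cvg _ F _ (g \o t) _ FU compact_closure.
  by apply: nearW => k; apply: subset_closure; apply: gD; case: (tP k).
have /gp qp : cluster (g t @[t --> +oo]) q.
  apply/cluster_pinftyP => a V Vq.
  have Fa : \forall k \near F, a <= k%:R by apply: oF; exact: nbhs_infty_ger.
  have [k [ak Vk]] := filter_meet _ Fa (gq V Vq).
  by exists (t k) => //; case: (tP k) => _ kt _; exact: le_trans kt.
have FUp : \forall k \near F, U (g (t k)) by rewrite -qp in Up; exact: gq Up.
have [k [Uk _]] := filter_meet _ FUp FUp.
by case: (tP k).
Qed.

Lemma isometric_shift g r s : iso (seg r) g -> 0 <= s ->
  iso (seg (r - s)) (fun t => g (s + t)).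
Proof.
move=> [gD gd] s0; have sub t : seg (r - s) t -> seg r (s + t).
  by move=> /= /andP[t0 tr]; apply/andP; split; lra.
split=> [t /sub|t t' /sub It /sub It']; first exact: gD.
by rewrite gd//; congr (`|_|); lra.
Qed.

Lemma geodesic_ray_not_clustering_inside g q : iso halfline g ->
  cluster (g t @[t --> +oo]) q -> bdry D q.
Proof.
move=> gi /cluster_pinftyP gq; apply/bdryP; split.
  move=> U Uq; have [t t0 Ut] := gq 0 U Uq; exists (g t); split => //.
  exact: gi.1.
move=> Dq; have D0 := gi.1 _ (lexx 0).
have [t ta [Dt qt]] := gq (d (g 0) q + 1) _ (dist_near dP Dq ltr01).
have t0 : 0 <= t by have := dist_ge0 dP (g 0) q; lra.
have := dist_triangle dP D0 Dq Dt.
have -> : d (g 0) (g t) = t by rewrite (gi.2 0 t (lexx 0) t0) sub0r normrN ger0_norm.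
lra.
Qed.

(* A geodesic ray obtained as a limit of segments whose far ends converge to [p]
   accumulates only at [p]: otherwise the tails of the segments, which stay far
   from the base point, would join neighbourhoods of two boundary points. *)
Lemma visible_limit_cluster (K : Type) (F : set_system K) (b : K -> R)
    (c : K -> R -> Cn R n) g a p q : visibility D -> ProperFilter F ->
  (forall k, iso (seg (b k)) (c k)) ->
  (\forall k \near F, d z0 (c k 0) <= a) ->
  (forall t, \forall k \near F, t <= b k) ->
  iso halfline g -> (forall t, 0 <= t -> c ^~ t @ F --> g t) ->
  c k (b k) @[k --> F] --> p -> cluster (g t @[t --> +oo]) q -> q = p.
Proof.
move=> visD FF ci ca cb gi cg cp gq; apply: contrapT => qp.
have Fb0 := cb 0.
have FDp : \forall k \near F, D (c k (b k)).
  by apply: filterS Fb0 => k b0; apply: (ci k).1; rewrite /= b0 lexx.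
have bp : bdry D p.
  apply/bdryP; split; first exact: closure_lim FDp cp.
  apply: (dist_escape_lim FF) cp => a'.
  apply: filterS3 ca Fb0 (cb (a + a')) => k ck b0 ba.
  have I0 : seg (b k) 0 by rewrite /= lexx.
  have I1 : seg (b k) (b k) by rewrite /= b0 lexx.
  have T1 := dist_triangle dP ((ci k).1 _ I0) Dz0 ((ci k).1 _ I1).
  have E : d (c k 0) (c k (b k)) = b k by rewrite (ci k).2// sub0r normrN ger0_norm.
  have S1 := dist_sym dP (c k 0) z0; lra.
have bq := geodesic_ray_not_clustering_inside gi gq.
have [U [V [A [Uq Vp _ [cA AD] UVA]]]] := visD _ _ bq bp qp.
have [rho rhoP] := compact_sub_dist_ball cA AD.
(* The segments start within [a] of [z0], so after time [rho + a + 1] they are farther than [rho]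
   from it and miss the compact set. *)
have [t ta Ut] := (cluster_pinftyP g q).1 gq (Num.max 0 (rho + a + 1)) _ (nbhs_interior Uq).
have [t0 trho] : 0 <= t /\ rho + a + 1 <= t by move: ta; rewrite ge_max => /andP.
have Fcut : \forall k \near F, U (c k t).
  by have := cg t t0 _ (open_nbhs_nbhs (conj (open_interior U) Ut)); apply: filterS => k /interior_subset.
have FV : \forall k \near F, V (c k (b k)) by exact: cp.
have [k [[Uk Vk] [ck tb]]] := filter_meet FF (filterI Fcut FV) (filterI ca (cb t)).
have [||||_ [[s /= sI <-] /rhoP cs]] := UVA (b k - t) (fun s => c k (t + s)).
- by rewrite subr_ge0.
- by apply/(geodesicP domD); rewrite segE; exact: isometric_shift.
- by rewrite addr0.
- by rewrite addrC subrK.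
move: sI; rewrite in_itv/= => /andP[s0 sb].
have b0 : 0 <= b k by exact: le_trans tb.
have I0 : seg (b k) 0 by rewrite /= lexx.
have I1 : seg (b k) (t + s) by apply/andP; split; lra.
have T1 := dist_triangle dP ((ci k).1 _ I0) Dz0 ((ci k).1 _ I1).
have E : d (c k 0) (c k (t + s)) = t + s.
  by rewrite (ci k).2// sub0r normrN ger0_norm// addr_ge0.
rewrite E (dist_sym dP (c k 0) z0) in T1.
by clear - ck trho s0 cs T1; lra.
Qed.

(** The limit lemma is applied to the initial pieces of [g] itself, indexed by their end time along
    an ultrafilter at [+oo]; every cluster point then equals the ultralimit. *)
Lemma ray_lands g : visibility D -> iso halfline g ->
  exists2 p, bdry D p & g t @[t --> +oo] --> p.
Proof.
move=> visD gi.
have [F [FU oF]] := ultraFilterLemma (@proper_pinfty_nbhs R).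
have [|p _ gp] := @ultra_cvg _ F _ g _ FU compact_closure.
  apply: oF; apply: filterS (nbhs_pinfty_ge (num_real 0)) => t t0.
  by apply: subset_closure; exact: gi.1.
have clp : cluster (g t @[t --> +oo]) p.
  apply/cluster_pinftyP => a U Up.
  have Fa : \forall t \near F, a <= t by apply: oF; exact: nbhs_pinfty_ge (num_real _).
  by have [t [? ?]] := filter_meet _ Fa (gp U Up); exists t.
exists p; first exact: geodesic_ray_not_clustering_inside clp.
apply: cluster_unique_cvg; first exact: gi.1.
have FF : ProperFilter F by exact: ultra_proper.
have ci (b : R) : iso (seg b) g by apply: isometric_on_sub gi => t /= /andP[].
have ca : \forall b \near F, d z0 (g 0) <= d z0 (g 0) by exact: nearW.
have cb t : \forall b \near F, t <= b by apply: oF; exact: nbhs_pinfty_ge (num_real _).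
have cg t : 0 <= t -> (fun _ : R => g t) @ F --> g t by move=> _; exact: cvg_cst.
by move=> q; exact: (visible_limit_cluster visD FF ci ca cb gi cg gp).
Qed.

(** A geodesic from [g t] to [h t] has length at most [c], so it stays at distance at least [t - c]
    from [z0] and for large [t] misses the compact set given by visibility. *)
Lemma close_rays_land g h c p q : visibility D -> iso halfline g -> g 0 = z0 ->
  iso halfline h -> (forall t, 0 <= t -> d (g t) (h t) <= c) ->
  g t @[t --> +oo] --> p -> h t @[t --> +oo] --> q -> bdry D p -> bdry D q -> p = q.
Proof.
move=> visD gi g0 hi gh gp hq bp bq; apply: contrapT => pq.
have [U [V [A [Up Vq _ [cA AD] UVA]]]] := visD _ _ bp bq pq.
have [rho rhoP] := compact_sub_dist_ball cA AD.
have FU : \forall t \near +oo, U (g t) by exact: gp Up.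
have FV : \forall t \near +oo, V (h t) by exact: hq Vq.
have [t [[Ut Vt] [t0 trho]]] := filter_meet (@proper_pinfty_nbhs R) (filterI FU FV)
  (filterI (nbhs_pinfty_ge (num_real 0)) (nbhs_pinfty_gt (num_real (rho + c)))).
have Dg := gi.1 _ t0; have Dh := hi.1 _ t0.
have [k [ki k0 k1]] := isometric_segment dP Dg Dh.
have [||||_ [[s /= sI <-] /rhoP ks]] := UVA (d (g t) (h t)) k.
- exact: (dist_ge0 dP).
- by apply/(geodesicP domD); rewrite segE.
- by rewrite k0.
- by rewrite k1.
rewrite in_itv/= in sI.
have Dk := ki.1 _ sI.
have E : d (g t) (k s) = s by exact: (dist_geodesic_start ki k0 sI).
have E2 : d z0 (g t) = t by exact: (dist_ray_start gi g0 t0).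
have := dist_triangle dP Dz0 Dk Dg; rewrite (dist_sym dP (k s)) E E2.
have := gh _ t0; case/andP: sI; clear - trho ks; lra.
Qed.

End visibility_landing.

(** * Visibility gives the extension *)

Section extension.
Context {R : realType} {n : nat} {D : set (Cn R n)} {z0 : Cn R n}.
Hypothesis domD : is_domain D.
Hypothesis bD : bounded_set D.
Hypothesis chD : complete_hyperbolic D.
Hypothesis Dz0 : D z0.
Implicit Types (x y z w p q : Cn R n) (a r e t : R) (g h : R -> Cn R n).
Implicit Types (sigma tau : gromov_boundary D z0) (phi psi : nat -> nat).

Let d := kdist D.
Let dP : complete_length_metric D d := kdist_complete_length_metric domD chD.
Local Notation iso := (isometric_on (D := D) (d := d)).
Local Notation seg r := [set t : R | 0 <= t <= r].
Local Notation halfline := [set t : R | 0 <= t].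

Lemma uniform_cvg_pointwise (F : set_system nat) (l : nat -> \bar R)
    (c : nat -> R -> Cn R n) g t : ProperFilter F -> \oo `<=` F ->
  (forall k, iso [set t | 0 <= t /\ (t%:E <= l k)%E] (c k)) -> iso halfline g ->
  uniform_cvg (D := D) l c g -> 0 <= t -> c ^~ t @ F --> g t.
Proof.
move=> FF oF ci gi cg t0; apply: (dist_cvg dP); first exact: gi.1.
move=> e e0; apply: oF; apply: filterS (cg t e e0) => k [tl cgk].
have Dc : D (c k t) by exact: (ci k).1.
by split => //; rewrite (dist_sym dP); apply: cgk; rewrite t0 lexx.
Qed.

Lemma cvg_pinfty_cluster g q : g t @[t --> +oo] --> q -> cluster (g t @[t --> +oo]) q.
Proof.
move=> gq; apply/cluster_pinftyP => a U Uq.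
have FU : \forall t \near +oo, U (g t) by exact: gq Uq.
have [t [Ut at_]] := filter_meet (@proper_pinfty_nbhs R) FU (nbhs_pinfty_ge (num_real a)).
by exists t.
Qed.

Lemma ray_approx_lands (x : nat -> D) sigma p q (F : set_system nat) :
  visibility D -> ProperFilter F -> \oo `<=` F -> ray_approx x sigma ->
  (forall g, \val sigma g -> g t @[t --> +oo] --> q) ->
  \val (x k) @[k --> F] --> p -> q = p.
Proof.
move=> visD FF oF [r [c [g [rc sg cg]]]] gq xp.
have [gi g0] := boundary_ray domD sg.
have ci k : iso (seg (r k)) (c k) by have [] := rc k.
have ci' k : iso [set t | 0 <= t /\ (t%:E <= (r k)%:E)%E] (c k) by rewrite upto_segE.
have ca : \forall k \near F, d z0 (c k 0) <= d z0 z0.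
  by apply: nearW => k; have [_ _ ->] := rc k.
have cb t : \forall k \near F, t <= r k.
  by apply: oF; apply: filterS (cg t 1 ltr01) => k [/=]; rewrite lee_fin.
have cF t : 0 <= t -> c ^~ t @ F --> g t.
  by move=> t0; exact: (uniform_cvg_pointwise FF oF ci').
have cp : c k (r k) @[k --> F] --> p.
  by rewrite (_ : (fun k => c k (r k)) = fun k => \val (x k))//; apply/funext => k; have [] := rc k.
exact: (visible_limit_cluster domD chD Dz0 visD FF ci ca cb gi cF cp
  (cvg_pinfty_cluster (gq _ sg))).
Qed.

Lemma landing_map : visibility D -> exists land : gromov_boundary D z0 -> closure D,
  forall sigma, bdry D (\val (land sigma)) /\
    forall g, \val sigma g -> g t @[t --> +oo] --> \val (land sigma).
Proof.
move=> visD; suff /choice[land landP] : forall sigma, exists p : closure D,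
    bdry D (\val p) /\ forall g, \val sigma g -> g t @[t --> +oo] --> \val p.
  by exists land.
move=> sigma; have [g sg] := boundary_rep domD chD sigma.
have [gi g0] := boundary_ray domD sg.
have [p bp gp] := ray_lands domD bD chD Dz0 visD gi.
have Dp : closure D p by case: bp.
exists (SigSub (mem_set Dp)); split => //= h sh.
have [hi h0] := boundary_ray domD sh.
have [q bq hq] := ray_lands domD bD chD Dz0 visD hi.
have [c gh] := boundary_close domD chD sg sh.
by rewrite (close_rays_land domD chD Dz0 visD gi g0 hi gh gp hq bp bq).
Qed.

Lemma closure_val_cvg_subsequence (u : nat -> Cn R n) : (forall k, closure D (u k)) ->
  exists F p, [/\ UltraFilter F, \oo `<=` F, closure D p & u @ F --> p].
Proof.
move=> uD; have [F [FU oF]] := ultraFilterLemma eventually_filter.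
have [|p Dp up] := @ultra_cvg _ F _ u _ FU (compact_closure bD); first exact: nearW.
by exists F, p.
Qed.

Lemma continuous_val (X : topologicalType) (A : set X) : continuous (fun x : A => \val x).
Proof. exact: initial_continuous. Qed.

Lemma visibility_extends : visibility D ->
  exists Phi : gromov_closure D z0 -> closure D, extends_identity Phi.
Proof.
move=> visD; have [land landP] := landing_map visD.
have cl (z : D) : closure D (\val z) by apply: subset_closure; exact: set_valP.
pose Phi (x : gromov_closure D z0) : closure D :=
  match x with gint z => SigSub (mem_set (cl z)) | gbd s => land s end.
exists Phi; split => //; last first.
  (* Surjectivity: a sequence of [D] tending to a boundary point escapes every ball, and a
     subsequence of it approximates a Gromov boundary point that lands there. *)
  move=> y _; have [Dy|nDy] := pselect (D (\val y)).
    by exists (gint z0 (SigSub (mem_set Dy))) => //; apply: val_inj.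
  have [u uD uy] := closure_seq (set_valP y : closure D (\val y)).
  pose x k : D := SigSub (mem_set (uD k)).
  have xoo a : \forall k \near \oo, a <= d z0 (\val (x k)).
    have uD' : \forall k \near \oo, D (u k) by exact: nearW.
    have := dist_escape domD chD Dz0 a eventually_filter uD' uy nDy.
    by apply: filterS => k /ltW.
  have [psi [sigma [inc xs]]] := ray_approx_ex domD chD Dz0 xoo.
  exists (gbd sigma) => //=; apply: val_inj => /=.
  apply: (ray_approx_lands visD eventually_filter _ xs (landP sigma).2) => //.
  exact: cvg_comp (increasing_cvg_oo inc) uy.
apply/continuousP => O oO.
have [W oW WO] : exists2 W, open W & set_val @^-1` W = O by exact: oO.
suff : gromov_open (Phi @^-1` O) by [].
have sub V s : closure D s -> open V -> V s -> exists2 e : R, 0 < e &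
    forall y, closure D y -> nrm (s - y) < e + e -> V y.
  move=> _ oV Vs; have /nbhs_nrmP[e e0 eV] : nbhs s V by exact: open_nbhs_nbhs.
  by exists (e / 2); [rewrite divr_gt0|move=> y _; rewrite -splitr; exact: eV].
split.
- by exists W => //; rewrite -WO.
- move=> x sigma xs; rewrite -WO /= => Ws; apply: contrapT => nW.
  have [phi incphi phiP] := not_near_oo_subsequence nW.
  have [psi incpsi xa] := int_cvg_approx domD chD Dz0 incphi xs.
  have [F [p [FU oF Dp xp]]] := @closure_val_cvg_subsequence
    (fun k => \val (x (phi (psi k)))) (fun k => cl _).
  have FF : ProperFilter F by exact: ultra_proper.
  have E := ray_approx_lands visD FF oF xa (landP sigma).2 xp.
  have Up : nbhs p W by rewrite -E; exact: open_nbhs_nbhs.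
  have FW : \forall k \near F, W (\val (x (phi (psi k)))) by exact: xp Up.
  have [k [Wk _]] := filter_meet FF FW FW.
  exact: phiP _ Wk.
move=> s sigma ss; rewrite -WO /= => Ws; apply: contrapT => nW.
have [phi incphi phiP] := not_near_oo_subsequence nW.
have [e e0 eW] := sub _ _ (set_valP (land sigma)) oW Ws.
have /choice[c sc] := fun k => boundary_rep domD chD (s k).
have [psi [incpsi [g sg cg]]] := ss c sc phi incphi.
pose m k := phi (psi k).
have [gi g0] := boundary_ray domD sg.
have ci k : iso halfline (c (m k)) /\ c (m k) 0 = z0 by exact: (boundary_ray domD (sc (m k))).
have upy : [set t | 0 <= t /\ (t%:E <= +oo)%E] = halfline.
  by apply/seteqP; split => t /= => [[]//|t0]; split => //; exact: leey.
have ci' k : iso [set t | 0 <= t /\ (t%:E <= (fun=> +oo)%E k)%E] (c (m k)).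
  by rewrite upy; case: (ci k).
have {}cg : uniform_cvg (D := D) (fun=> +oo%E) (c \o m) g.
  by apply/(cvg_compactaP domD ci' gi).
(* Each ray is cut at a time [b k >= k] where it is within [e] of its own landing point. That point
   is outside [W], which contains the [2 * e] ball about the landing point of [sigma], so the cut
   points stay [e] away from the latter. The limit lemma for segments contradicts this. *)
have /choice[b bP] : forall k : nat, exists b, k%:R <= b /\
    e <= nrm (\val (land sigma) - c (m k) b).
  move=> k; have [_ /(_ _ (sc (m k))) lk] := landP (s (m k)).
  have Ue : nbhs (\val (land (s (m k)))) [set y | nrm (\val (land (s (m k))) - y) < e].
    by apply/nbhs_nrmP; exists e.
  have FU : \forall t \near +oo, nrm (\val (land (s (m k))) - c (m k) t) < e by exact: lk Ue.
  have [t [te kt]] := filter_meet (@proper_pinfty_nbhs R) FU (nbhs_pinfty_ge (num_real k%:R)).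
  exists t; split => //; rewrite leNgt; apply/negP => et.
  apply: (phiP (psi k)); apply: eW; first exact: set_valP.
  apply: le_lt_trans (nrm_dist_triangle _ (c (m k) t) _) _.
  by apply: ltrD => //; rewrite -nrmN opprB.
have b0 k : 0 <= b k by apply: le_trans (bP k).1.
have [|F [p [FU oF Dp cp]]] := @closure_val_cvg_subsequence (fun k => c (m k) (b k)).
  by move=> k; apply: subset_closure; exact: (ci k).1.1 _ (b0 k).
have FF : ProperFilter F by exact: ultra_proper.
have E : \val (land sigma) = p.
  have ck k : iso (seg (b k)) (c (m k)).
    by apply: isometric_on_sub (ci k).1 => t /= /andP[].
  have ca : \forall k \near F, d z0 (c (m k) 0) <= d z0 z0.
    by apply: nearW => k; rewrite (ci k).2.
  have cb t : \forall k \near F, t <= b k.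
    apply: oF; apply: filterS (nbhs_infty_ger t) => k tk.
    exact: le_trans tk (bP k).1.
  have cF t : 0 <= t -> (c \o m) ^~ t @ F --> g t.
    by move=> t0; exact: (uniform_cvg_pointwise FF oF ci').
  exact: (visible_limit_cluster domD chD Dz0 visD FF ck ca cb gi cF cp
    (cvg_pinfty_cluster ((landP sigma).2 _ sg))).
have Up : nbhs p [set y | nrm (p - y) < e] by apply/nbhs_nrmP; exists e.
have FW : \forall k \near F, nrm (p - c (m k) (b k)) < e by exact: cp Up.
have [k [Wk _]] := filter_meet FF FW FW.
by have := (bP k).2; rewrite E leNgt Wk.
Qed.

End extension.

(** * Consequences of the extension *)

Section loops.
Context {R : realType} {n : nat} {D : set (Cn R n)} {z0 : Cn R n}.
Hypothesis domD : is_domain D.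
Hypothesis bD : bounded_set D.
Hypothesis chD : complete_hyperbolic D.
Hypothesis Dz0 : D z0.
Variable delta : R.
Hypothesis delta0 : 0 <= delta.
Hypothesis gh : forall o x y z, D o -> D x -> D y -> D z ->
  Num.min (gromov_product D o x y) (gromov_product D o y z) - delta
    <= gromov_product D o x z.
Variable Phi : gromov_closure D z0 -> closure D.
Hypothesis PhiE : extends_identity Phi.
Implicit Types (x y z w p q : Cn R n) (a r e t : R) (g h : R -> Cn R n).
Implicit Types (sigma tau : gromov_boundary D z0) (phi psi : nat -> nat).

Let d := kdist D.
Let dP : complete_length_metric D d := kdist_complete_length_metric domD chD.
Local Notation iso := (isometric_on (D := D) (d := d)).
Local Notation seg r := [set t : R | 0 <= t <= r].
Local Notation halfline := [set t : R | 0 <= t].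

Let Phi_cvg (F : set_system nat) (X : nat -> gromov_closure D z0)
    (x : gromov_closure D z0) : X @ F --> x -> \val (Phi (X k)) @[k --> F] --> \val (Phi x).
Proof.
move=> Xx; have [Pc _ _] := PhiE.
have PX : (fun k => Phi (X k)) @ F --> Phi x by exact: cvg_comp Xx (Pc x).
exact: cvg_comp PX (@continuous_val _ _ (Phi x)).
Qed.

Lemma extension_int_lim (x : nat -> D) sigma : ray_approx x sigma ->
  \val (x k) @[k --> \oo] --> \val (Phi (gbd sigma)).
Proof.
move=> xs; have [_ _ Pi] := PhiE.
have /int_cvg_topology/Phi_cvg := ray_approx_int_cvg domD chD Dz0 delta0 gh xs.
by under eq_fun do rewrite Pi.
Qed.

Lemma extension_bd_lim (s : nat -> gromov_boundary D z0) sigma : bd_cvg s sigma ->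
  \val (Phi (gbd (s k))) @[k --> \oo] --> \val (Phi (gbd sigma)).
Proof. by move=> /bd_cvg_topology/Phi_cvg. Qed.

Let lim_unique (u : nat -> Cn R n) p q : u @ \oo --> p -> u @ \oo --> q -> p = q.
Proof. by move=> up uq; exact: (cvg_unique (@norm_hausdorff _ _) up uq). Qed.

Lemma dist_oo_in_D (u : nat -> Cn R n) (uD : forall k, D (u k)) p :
  u @ \oo --> p -> ~ D p ->
  forall a, \forall k \near \oo, a <= d z0 (\val (SigSub (mem_set (uD k)) : D)).
Proof.
move=> up nDp a; have uD' : \forall k \near \oo, D (u k) by exact: nearW.
have := dist_escape domD chD Dz0 a eventually_filter uD' up nDp.
by apply: filterS => k /ltW.
Qed.

Lemma ray_approx_pair (x y : nat -> D) :
  (forall a, \forall k \near \oo, a <= d z0 (\val (x k))) ->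
  (forall a, \forall k \near \oo, a <= d z0 (\val (y k))) ->
  exists psi sigma tau, [/\ {homo psi : i j / (i < j)%N},
    ray_approx (x \o psi) sigma & ray_approx (y \o psi) tau].
Proof.
move=> xoo yoo; have [psi [sigma [inc xs]]] := ray_approx_ex domD chD Dz0 xoo.
have [a|psi' [tau [inc' ys]]] := ray_approx_ex (x := y \o psi) domD chD Dz0.
  exact: increasing_cvg_oo inc _ (yoo a).
exists (psi \o psi'), sigma, tau; split => //; first by move=> i j /inc' /inc.
exact: ray_approx_sub inc' xs.
Qed.

Lemma extends_visibility : visibility D.
Proof.
move=> p q bp bq pq; apply: contrapT => nvis.
have [cp nDp] := (bdryP domD p).1 bp; have [cq nDq] := (bdryP domD q).1 bq.
have pq0 : 0 < nrm (p - q).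
  rewrite lt_neqAle nrm_ge0 andbT eq_sym; apply/eqP => /nrm0_eq0/eqP.
  by rewrite subr_eq0 => /eqP.
(* A quarter of the distance keeps the closed neighbourhoods of [p] and [q] disjoint; [1 / (k + 1)]
   makes the ends converge. The compact set tested at stage [k] is the Kobayashi ball of radius
   [k]. *)
pose e (k : nat) := Num.min (nrm (p - q) / 4) k.+1%:R^-1.
have e0 k : 0 < e k by rewrite lt_min invr_gt0 ltr0n andbT divr_gt0.
have e4 k : e k <= nrm (p - q) / 4 by rewrite ge_min lexx.
have ek k : e k <= k.+1%:R^-1 by rewrite ge_min lexx orbT.
have cball w k u : closure [set u | nrm (w - u) < e k] u -> nrm (w - u) <= nrm (p - q) / 4.
  have cN : closed [set u | nrm (w - u) <= nrm (p - q) / 4] by exact: closed_nrm_ball.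
  have /closureS/[apply] : [set u | nrm (w - u) < e k] `<=`
      [set u | nrm (w - u) <= nrm (p - q) / 4].
    by move=> v /= /ltW vk; exact: le_trans (e4 k).
  exact: cN.
have /choice[L /choice[g gP]] : forall k : nat, exists L g, [/\ 0 <= L, iso (seg L) g,
    nrm (p - g 0) < e k, nrm (q - g L) < e k & forall s, seg L s -> k%:R < d z0 (g s)].
  move=> k; apply: contrapT => H; apply: nvis.
  exists [set u | nrm (p - u) < e k], [set u | nrm (q - u) < e k],
    (dist_ball (D := D) (d := d) z0 k%:R); split.
  - by apply/nbhs_nrmP; exists (e k).
  - by apply/nbhs_nrmP; exists (e k).
  - apply/seteqP; split => // u [/cball pu /cball qu].
    have := nrm_dist_triangle p u q; rewrite -(nrmN (u - q)) opprB.
    by move=> ?; exfalso; clear pq; lra.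
  - by split; [exact: hopf_rinow|move=> ? []].
  move=> L g L0 gg pg qg; apply: contrapT => nK; apply: H; exists L, g.
  move/(geodesicP domD) : gg; rewrite segE => gi.
  split => // s sL; rewrite ltNge; apply/negP => gk; apply: nK; exists (g s).
  by split; [exists s => //=; rewrite in_itv/=|split => //; exact: gi.1].
have L0 k : 0 <= L k by have [] := gP k.
have I0 k : seg (L k) 0 by rewrite /= lexx L0.
have I1 k : seg (L k) (L k) by rewrite /= lexx L0.
have gi k : iso (seg (L k)) (g k) by have [] := gP k.
have xD k : D (g k 0) by exact: (gi k).1.
have yD k : D (g k (L k)) by exact: (gi k).1.
have xp : (fun k => g k 0) @ \oo --> p.
  by apply: nrm_seq_cvg => k; have [_ _ pg _ _] := gP k; exact: lt_le_trans pg (ek k).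
have yq : (fun k => g k (L k)) @ \oo --> q.
  by apply: nrm_seq_cvg => k; have [_ _ _ qg _] := gP k; exact: lt_le_trans qg (ek k).
have [psi [sigma [tau [inc xs ys]]]] :=
  ray_approx_pair (dist_oo_in_D xD xp nDp) (dist_oo_in_D yD yq nDq).
have st : sigma = tau.
  apply: (ray_approx_eq domD chD Dz0 delta0 gh xs ys) => a /=.
  suff H : \forall k \near \oo, a <= gromov_product D z0 (g k 0) (g k (L k)).
    exact: increasing_cvg_oo inc _ H.
  apply: filterS (nbhs_infty_ger (a + 2 * delta)) => k /= ak.
  (* Some point of the geodesic is at distance at most the product plus [2 * delta], whereas all its
     points are farther than [k]. *)
  have [s sL zs] := gromov_product_center domD chD gh Dz0 (L0 k) (gi k).
  have [_ _ _ _ /(_ s sL)] := gP k; rewrite /d => ks.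
  by clear pq; lra.
apply: pq; have px : (fun k => g (psi k) 0) @ \oo --> p.
  exact: cvg_comp (increasing_cvg_oo inc) xp.
have qy : (fun k => g (psi k) (L (psi k))) @ \oo --> q.
  exact: cvg_comp (increasing_cvg_oo inc) yq.
rewrite (lim_unique px (extension_int_lim xs)) (lim_unique qy (extension_int_lim ys)).
by rewrite st.
Qed.

Lemma loop_not_injective g : geodesic_loop D (closure D) g -> ~ injective Phi.
Proof.
move=> [/(geodesicP domD) gi gcl] Pinj; rewrite -/d in gi.
have Dg t : D (g t) by exact: gi.1.
have [p Dp pp] := cluster_pinfty_neq0 bD (fun t _ => Dg t).
have [_ pm] : (closure D `&` cluster (g t @[t --> -oo])) p by rewrite -gcl.
have {}pm : cluster (g (- t) @[t --> +oo]) p.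
  by move: pm; rewrite -ninfty.
have /choice[s sP] : forall k : nat, exists t, k%:R <= t /\ nrm (p - g t) < k.+1%:R^-1.
  move=> k; have [|t kt pt] := (cluster_pinftyP g p).1 pp k%:R
    [set u | nrm (p - u) < k.+1%:R^-1].
    by apply/nbhs_nrmP; exists k.+1%:R^-1; rewrite ?invr_gt0.
  by exists t.
have /choice[t tP] : forall k : nat, exists t, k%:R <= t /\ nrm (p - g (- t)) < k.+1%:R^-1.
  move=> k; have [|t kt pt] := (cluster_pinftyP (fun t => g (- t)) p).1 pm k%:R
    [set u | nrm (p - u) < k.+1%:R^-1].
    by apply/nbhs_nrmP; exists k.+1%:R^-1; rewrite ?invr_gt0.
  by exists t.
have xp : (fun k => g (s k)) @ \oo --> p by apply: nrm_seq_cvg => k; case: (sP k).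
have yp : (fun k => g (- t k)) @ \oo --> p by apply: nrm_seq_cvg => k; case: (tP k).
have g0s u : d (g 0) (g u) = `|u| by rewrite gi.2// sub0r normrN.
have nDp : ~ D p.
  apply: (dist_escape_lim domD chD (Dg 0) eventually_filter _ xp) => a.
  apply: filterS (nbhs_infty_ger a) => k ak.
  rewrite -[kdist D]/d g0s; apply: le_trans ak _; apply: le_trans (sP k).1 _.
  exact: ler_norm.
have [psi [sigma [tau [inc xs ys]]]] := ray_approx_pair
  (dist_oo_in_D (fun k => Dg (s k)) xp nDp)
  (dist_oo_in_D (fun k => Dg (- t k)) yp nDp).
have px : (fun k => g (s (psi k))) @ \oo --> p.
  exact: cvg_comp (increasing_cvg_oo inc) xp.
have py : (fun k => g (- t (psi k))) @ \oo --> p.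
  exact: cvg_comp (increasing_cvg_oo inc) yp.
have st : gbd sigma = gbd tau :> gromov_closure D z0.
  apply: Pinj; apply: val_inj.
  rewrite -(lim_unique px (extension_int_lim xs)).
  exact: lim_unique py (extension_int_lim ys).
have {}st : sigma = tau by case: st.
rewrite -st in ys.
(* A common end would give arbitrarily large products, but [g 0] lies between the two points and
   bounds them by [d z0 (g 0)]. *)
have [k] := ray_approx_product domD chD Dz0 delta0 gh (d z0 (g 0) + 1) xs ys.
rewrite /= (gromov_productC domD chD).
have := @gromov_product_le _ _ _ domD chD z0 g setT (- t (psi k)) (s (psi k)) 0 Dz0 gi I I I.
have s0 : 0 <= s (psi k) by apply: le_trans (sP (psi k)).1.
have t0 : 0 <= t (psi k) by apply: le_trans (tP (psi k)).1.
rewrite oppr_le0 t0 s0 => /(_ isT).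
by rewrite -[kdist D]/d; lra.
Qed.

Lemma ray_ray_approx sigma g (gD : forall k : nat, D (g k%:R)) : \val sigma g ->
  ray_approx (fun k => SigSub (mem_set (gD k)) : D) sigma.
Proof.
move=> sg; have [gi g0] := boundary_ray domD sg.
exists (fun k => k%:R), (fun=> g), g; split => //.
  by move=> k; split => //; apply: isometric_on_sub gi => t /= /andP[].
move=> t e e0; apply: filterS (nbhs_infty_ger t) => k tk; split; first by rewrite lee_fin.
by move=> s /andP[s0 _]; rewrite -[kdist D]/d (dist_refl dP)//; exact: gi.1.
Qed.

Lemma extension_bd_notin sigma : ~ D (\val (Phi (gbd sigma))).
Proof.
have [g sg] := boundary_rep domD chD sigma; have [gi g0] := boundary_ray domD sg.
have gD (k : nat) : D (g k%:R) by apply: gi.1; rewrite /= ler0n.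
have gP := extension_int_lim (ray_ray_approx gD sg).
apply: (dist_escape_lim domD chD Dz0 eventually_filter _ gP) => a.
apply: filterS (nbhs_infty_ger a) => k ak /=.
by rewrite (dist_ray_start gi g0).
Qed.

(* Two inequivalent rays landing at the same point: the geodesics joining them
   pass through a fixed ball, and their limit is a geodesic loop. *)
Lemma bd_injective sigma tau : no_geodesic_loops D (closure D) ->
  Phi (gbd sigma) = Phi (gbd tau) -> sigma = tau.
Proof.
move=> noloop Pst; apply: contrapT => nst.
have visD := extends_visibility.
have [g sg] := boundary_rep domD chD sigma; have [gi g0] := boundary_ray domD sg; rewrite -/d in gi.
have [h th] := boundary_rep domD chD tau; have [hi h0] := boundary_ray domD th; rewrite -/d in hi.
have [p bp gp] := ray_lands domD bD chD Dz0 visD gi.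
have [q bq hq] := ray_lands domD bD chD Dz0 visD hi.
have sub r : seg r `<=` halfline by move=> t /= /andP[].
have giS r : iso (seg r) g := isometric_on_sub (sub r) gi.
have hiS r : iso (seg r) h := isometric_on_sub (sub r) hi.
have gk (k : nat) : d z0 (g k%:R) = k%:R by exact: dist_ray_start gi g0 (ler0n _ k).
have hk (k : nat) : d z0 (h k%:R) = k%:R by exact: dist_ray_start hi h0 (ler0n _ k).
have gD (k : nat) : D (g k%:R) by apply: gi.1; rewrite /= ler0n.
have hD (k : nat) : D (h k%:R) by apply: hi.1; rewrite /= ler0n.
have nat_oo (k0 : R -> Cn R n) (l : Cn R n) :
    k0 t @[t --> +oo] --> l -> (fun k : nat => k0 k%:R) @ \oo --> l.
  by move=> kl; apply: cvg_comp kl; exact: cvgr_idn.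
have ps := lim_unique (nat_oo _ _ gp) (extension_int_lim (ray_ray_approx gD sg)).
have qt := lim_unique (nat_oo _ _ hq) (extension_int_lim (ray_ray_approx hD th)).
have qp : q = p by rewrite ps qt Pst.
rewrite {}qp in hq bq.
(* Unbounded products would make the two rays [4 * delta] close at every time, hence equivalent. *)
have [M MP] : exists M, forall k : nat, gromov_product D z0 (g k%:R) (h k%:R) <= M.
  apply: contrapT => H; apply: nst.
  apply: (boundary_eq domD chD (c := 4 * delta) sg th) => t t0.
  have [k tk] : exists k : nat, t < gromov_product D z0 (g k%:R) (h k%:R).
    apply: contrapT => H'; apply: H; exists t => k; rewrite leNgt; apply/negP => tk.
    by apply: H'; exists k.
  have k0 : 0 <= k%:R :> R by exact: ler0n.
  have tk' : t <= k%:R.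
    apply: (le_trans (ltW tk)); rewrite gromov_productE -[kdist D]/d.
    rewrite gk hk.
    by have := dist_ge0 dP (g k%:R) (h k%:R); move: k0; lra.
  apply: (geodesics_close domD chD delta0 gh Dz0 (giS k%:R) g0 (hiS k%:R) h0) => //.
    by rewrite t0.
  exact: ltW tk.
have /choice[c cP] := fun k : nat => isometric_segment dP (gD k) (hD k).
pose L k := d (g k%:R) (h k%:R).
have L0 k : 0 <= L k by exact: (dist_ge0 dP).
have ci k : iso (seg (L k)) (c k) by have [] := cP k.
have /choice[s sP] : forall k, exists s, seg (L k) s /\ d z0 (c k s) <= M + 2 * delta.
  move=> k; have [s sL zs] := gromov_product_center domD chD gh Dz0 (L0 k) (ci k).
  exists s; split => //; have [_ ck0 ckL] := cP k.
  by move: zs; rewrite ck0 ckL; have := MP k; rewrite -[kdist D]/d; lra.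
have I0 k : seg (L k) 0 by rewrite /= lexx L0.
have I1 k : seg (L k) (L k) by rewrite /= lexx L0.
have Is k : seg (L k) (s k) by have [] := sP k.
have ck0 k : c k 0 = g k%:R by have [] := cP k.
have ckL k : c k (L k) = h k%:R by have [] := cP k.
have Dcs k : D (c k (s k)) by exact: (ci k).1.
(* The ends are at distance [k] from [z0] and the point at [s k] is in a fixed ball, so both arms
   become infinitely long and the curves recentred at [s k] exhaust the real line. *)
have s_ge k : k%:R - (M + 2 * delta) <= s k.
  have T1 := dist_triangle dP Dz0 (Dcs k) (gD k).
  have E : d (c k (s k)) (g k%:R) = s k.
    by rewrite -ck0 (ci k).2// subr0 ger0_norm//; case/andP: (Is k).
  rewrite E gk in T1.
  by have := (sP k).2; move: T1; lra.
have Ls_ge k : k%:R - (M + 2 * delta) <= L k - s k.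
  have T1 := dist_triangle dP Dz0 (Dcs k) (hD k).
  have E : d (c k (s k)) (h k%:R) = L k - s k.
    rewrite -ckL (ci k).2// distrC ger0_norm// subr_ge0; by case/andP: (Is k).
  rewrite E hk in T1.
  by have := (sP k).2; move: T1; lra.
pose C k t := c k (s k + t).
have [F [FU oF]] := ultraFilterLemma eventually_filter.
have FF : ProperFilter F by exact: ultra_proper.
have Fs t : \forall k \near F, t <= s k.
  apply: oF; apply: filterS (nbhs_infty_ger (t + (M + 2 * delta))) => k tk.
  by apply: le_trans (s_ge k); rewrite lerBrDr.
have FLs t : \forall k \near F, t <= L k - s k.
  apply: oF; apply: filterS (nbhs_infty_ger (t + (M + 2 * delta))) => k tk.
  by apply: le_trans (Ls_ge k); rewrite lerBrDr.
have FI t : \forall k \near F, seg (L k) (s k + t).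
  apply: filterS2 (Fs (- t)) (FLs t) => k ts tL; apply/andP; split.
    by rewrite -lerBlDr sub0r.
  by rewrite -lerBrDl.
have [t _|u t e _ _ e0|gam gamI gamC] :=
    @isometric_ultralimit _ _ _ _ dP _ F C [set: R] z0 FU Dz0.
- exists (M + 2 * delta + `|t|); apply: filterS (FI t) => k It.
  have Dk := (ci k).1 _ It; split => //.
  apply: le_trans (dist_triangle dP Dz0 (Dcs k) Dk) _; apply: lerD; first exact: (sP k).2.
  by rewrite (ci k).2// opprD addrA subrr sub0r normrN.
- apply: filterS2 (FI u) (FI t) => k Iu It; rewrite /C (ci k).2//.
  by rewrite opprD addrACA subrr add0r subrr normr0 ltW.
have gamD t : D (gam t) by exact: gamI.1.
have ps' : \forall k \near F, d z0 (C k 0) <= M + 2 * delta.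
  by apply: nearW => k; rewrite /C addr0; exact: (sP k).2.
(* The forward arms end on [h], the time-reversed backward arms on [g], and both rays land at [p].
   So each cluster set is contained in [{p}], and it is nonempty by compactness. *)
have clp q' : cluster (gam t @[t --> +oo]) q' -> q' = p.
  have Ci k : iso (seg (L k - s k)) (C k).
    split=> [t /andP[t0 tL]|u t /andP[u0 uL] /andP[t0 tL]].
      by apply: (ci k).1; have /andP[? ?] := Is k; apply/andP; split; lra.
    have /andP[? ?] := Is k.
    rewrite /C (ci k).2/=; [by congr (`|_|); lra| |];
      by apply/andP; split; lra.
  have gamI' : iso halfline gam by apply: isometric_on_sub gamI.
  have Cp : C k (L k - s k) @[k --> F] --> p.
    rewrite (_ : (fun k => C k (L k - s k)) = fun k => h k%:R); last first.
      by apply/funext => k; rewrite /C addrC subrK ckL.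
    by move=> U /(nat_oo _ _ hq) /oF.
  exact: (visible_limit_cluster domD chD Dz0 visD FF Ci ps' FLs gamI'
    (fun t _ => gamC t I) Cp).
have clm q' : cluster (gam (- t) @[t --> +oo]) q' -> q' = p.
  have Ci k : iso (seg (s k)) (fun t => C k (- t)).
    split=> [t /andP[t0 tL]|u t /andP[u0 uL] /andP[t0 tL]].
      by apply: (ci k).1; have /andP[? ?] := Is k; apply/andP; split; lra.
    have /andP[? ?] := Is k.
    rewrite /C (ci k).2/=; [by rewrite distrC; congr (`|_|); lra| |];
      by apply/andP; split; lra.
  have gamI' : iso halfline (fun t => gam (- t)).
    by split => [t _//|u t _ _]; rewrite gamI.2// distrC; congr (`|_|); lra.
  have Cp : C k (- s k) @[k --> F] --> p.
    rewrite (_ : (fun k => C k (- s k)) = fun k => g k%:R); last first.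
      by apply/funext => k; rewrite /C subrr ck0.
    by move=> U /(nat_oo _ _ gp) /oF.
  have ps'' : \forall k \near F, d z0 (C k (- 0)) <= M + 2 * delta by rewrite oppr0.
  exact: (visible_limit_cluster domD chD Dz0 visD FF Ci ps'' Fs gamI'
    (fun t _ => gamC (- t) I) Cp).
apply: (noloop gam); split; first exact/(geodesicP domD).
have [p1 Dp1 cp1] := cluster_pinfty_neq0 bD (fun t _ => gamD t).
have [p2 Dp2 cp2] := cluster_pinfty_neq0 bD (fun t _ => gamD (- t)).
have -> : gam t @[t --> -oo] = gam (- t) @[t --> +oo] by rewrite -ninfty.
move: (cp1) (cp2); rewrite (clp _ cp1) (clm _ cp2) => {}cp1 {}cp2.
have Dp : closure D p := bp.1.
apply/seteqP; split => q' [_ cq'].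
  by rewrite (clp _ cq'); exact: conj Dp cp2.
by rewrite (clm _ cq'); exact: conj Dp cp1.
Qed.

Lemma extension_injective : no_geodesic_loops D (closure D) -> injective Phi.
Proof.
have [_ _ Pi] := PhiE.
move=> noloop [x|sigma] [y|tau] Pxy.
- by congr gint; apply: val_inj; rewrite -!Pi Pxy.
- by exfalso; apply: (@extension_bd_notin tau); rewrite -Pxy Pi; exact: set_valP.
- by exfalso; apply: (@extension_bd_notin sigma); rewrite Pxy Pi; exact: set_valP.
- by congr gbd; exact: bd_injective.
Qed.

(** The target is metric, so a failure of continuity of the inverse [G] at [y] is seen on a sequence
    [u] tending to [y] with [G (u k)] outside an open [O]. A subsequence of [G (u k)] converges, and
    injectivity forces its limit to be [G y]. *)
Lemma extension_homeomorphism : injective Phi -> homeomorphism Phi.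
Proof.
move=> Pinj; have [Pc Ps Pi] := PhiE; split => //.
have /choice[G GP] : forall y : closure D, exists x : gromov_closure D z0, Phi x = y.
  by move=> y; have [x _ <-] := Ps y I; exists x.
exists G; split => // [|x]; last by apply: Pinj; rewrite GP.
move=> y U; rewrite nbhsE; case=> O [oO Oy] OU.
suff : \forall v \near y, O (G v) by apply: filterS => v; exact: OU.
apply: contrapT => nO.
have /choice[u uP] : forall k : nat, exists v : closure D,
    nrm (\val y - \val v) < k.+1%:R^-1 /\ ~ O (G v).
  move=> k; apply: contrapT => H; apply: nO.
  have Uy : nbhs (\val y) [set w | nrm (\val y - w) < k.+1%:R^-1].
    by apply/nbhs_nrmP; exists k.+1%:R^-1; rewrite ?invr_gt0.
  have near_y : \forall v \near y, nrm (\val y - \val v) < k.+1%:R^-1.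
    exact: (@continuous_val _ _ y _ Uy).
  by apply: filterS near_y => v yv; apply: contrapT => nOv; apply: H; exists v.
have uy : (fun k => \val (u k)) @ \oo --> \val y.
  by apply: nrm_seq_cvg => k; case: (uP k).
have PG (v : closure D) (x : gromov_closure D z0) : \val (Phi x) = \val v -> G v = x.
  by move=> /val_inj <-; apply: Pinj; rewrite GP.
have [oO1 oO2 oO3] : gromov_open O := oO.
(* Either infinitely many terms are interior or all late terms are on the boundary, matching the
   separate clauses of [gromov_open]. *)
have [] := pselect (\forall k \near \oo, exists s, G (u k) = gbd s); last first.
  move=> /not_near_oo_subsequence[phi inc Gphi].
  have /choice[x xP] : forall k, exists x : D, G (u (phi k)) = gint z0 x.
    by move=> k; case: (G (u (phi k))) (Gphi k) => [x|s] H; [exists x|exfalso; apply: H; exists s].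
  have ux k : \val (u (phi k)) = \val (x k) by rewrite -(GP (u (phi k))) xP Pi.
  have xD k : D (\val (x k)) by exact: set_valP.
  have xy : (fun k => \val (x k)) @ \oo --> \val y.
    rewrite (_ : (fun k => \val (x k)) = (fun k => \val (u k)) \o phi).
      exact: cvg_comp (increasing_cvg_oo inc) uy.
    by apply/funext => k /=; rewrite ux.
  have [Dy|nDy] := pselect (D (\val y)).
    pose y' : D := SigSub (mem_set Dy).
    have Oy' : O (gint z0 y') by rewrite -(PG y (gint z0 y')) ?Pi.
    have [W oW WO] : exists2 W, open W & set_val @^-1` W = gint z0 @^-1` O by exact: oO1.
    have Wy : W (\val y') by have : (set_val @^-1` W) y' by rewrite WO.
    have Wn : nbhs (\val y) W by exact: open_nbhs_nbhs.
    have FW : \forall k \near \oo, W (\val (x k)) by exact: xy Wn.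
    have [k [Wk _]] := filter_meet eventually_filter FW FW.
    have : (set_val @^-1` W) (x k) by [].
    by rewrite WO /= -xP; case: (uP (phi k)).
  have xoo a : \forall k \near \oo, a <= d z0 (\val (x k)).
    have xD' : \forall k \near \oo, D (\val (x k)) by exact: nearW.
    have := dist_escape domD chD Dz0 a eventually_filter xD' xy nDy.
    by apply: filterS => k /ltW.
  have [psi [sigma [incp xs]]] := ray_approx_ex domD chD Dz0 xoo.
  have ys : G y = gbd sigma.
    apply: PG; apply: lim_unique (extension_int_lim xs) _.
    exact: cvg_comp (increasing_cvg_oo incp) xy.
  rewrite ys in Oy.
  have FO := oO2 _ _ (ray_approx_int_cvg domD chD Dz0 delta0 gh xs) Oy.
  have [k [Ok _]] := filter_meet eventually_filter FO FO.
  by move: Ok; rewrite /= -xP; case: (uP (phi (psi k))).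
move=> [N _ NP].
have /choice[s sP] : forall k, exists s, G (u (k + N)%N) = gbd s.
  by move=> k; apply: NP; rewrite /= leq_addl.
have [psi [sigma [incp ss]]] := bd_cvg_ex domD chD Dz0 delta0 gh s.
have incN : {homo (fun k => psi k + N)%N : i j / (i < j)%N}.
  by move=> i j ij; rewrite ltn_add2r incp.
have ys : G y = gbd sigma.
  apply: PG; apply: lim_unique (extension_bd_lim ss) _.
  rewrite (_ : (fun k => _) = (fun k => \val (u k)) \o (fun k => psi k + N)%N).
    exact: cvg_comp (increasing_cvg_oo incN) uy.
  by apply/funext => k /=; rewrite -sP GP.
rewrite ys in Oy.
have FO := oO3 _ _ ss Oy.
have [k [Ok _]] := filter_meet eventually_filter FO FO.
by move: Ok; rewrite /= -sP; case: (uP (psi k + N)%N).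
Qed.

End loops.

Theorem theorem3p3 (R : realType) (n : nat) (D : set (Cn R n)) (z0 : Cn R n) :
  (0 < n)%N ->
  is_domain D -> bounded_set D -> complete_hyperbolic D ->
  gromov_hyperbolic D -> D z0 ->
  (visibility D <->
     exists Phi : gromov_closure D z0 -> closure D, extends_identity Phi) /\
  (forall Phi : gromov_closure D z0 -> closure D, extends_identity Phi ->
     (homeomorphism Phi <-> no_geodesic_loops D (closure D))).
Proof.
move=> _ domD bD chD [delta [delta0 gh]] Dz0; split.
  split; first exact: visibility_extends.
  by move=> [Phi PhiE]; exact (extends_visibility domD chD Dz0 delta0 gh PhiE).
move=> Phi PhiE; split=> [[_ [G [_ PhiK _]]] g loop|noloop].
  exact (loop_not_injective domD bD chD Dz0 delta0 gh PhiE loop (can_inj PhiK)).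
apply: (extension_homeomorphism domD chD Dz0 delta0 gh PhiE).
exact (extension_injective domD bD chD Dz0 delta0 gh PhiE noloop).
Qed.
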